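(* Let $k$ be an algebraically closed field and let $A_2$ be the path algebra over $k$ of the quiver with vertices $1,2$ and arrows $\alpha:1\to 2$, $\beta:2\to 1$ modulo the relation $\alpha\beta=0$ (paths are composed from left to right). Then the projective complexes $$T^i(P^\bullet_{e_1}),\quad T^i(P^\bullet_{e_2}),\quad T^i(P^\bullet_{\alpha}),\quad T^i(P^\bullet_{\beta}),\quad T^i(P^\bullet_{(\beta\alpha)^s}),$$ $$T^i(P^\bullet_{\alpha(\beta\alpha)^s}),\quad T^i(P^\bullet_{(\beta\alpha)^s\beta})\quad\text{and}\quad T^i(P^\bullet_{\alpha(\beta\alpha)^s\beta}),$$ where $i\in\mathbb{Z}$, $s\in\mathbb{N}$, constitute an exhaustive list of pairwise non-isomorphic indecomposable objects of $\mathbf{D}^b(A_2)$.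
   Context: $\mathbf{D}^b(A_2)$ is the bounded derived category of finite-dimensional left $A_2$-modules, $T$ is its translation (shift) functor, and $\mathbb{N}$ is the set of natural numbers. $\mathbf{P}_j=A_2e_j$ denotes the indecomposable projective left module of vertex $j$, where $e_j$ is the idempotent (trivial path) at $j$. For a path $w$ from vertex $a$ to vertex $b$, $p(w):\mathbf{P}_a\to\mathbf{P}_b$ is the corresponding morphism $x\mapsto xw$. The complexes are as follows (all terms not shown are $0$, and the leftmost shown term is in degree $1$): - $P^\bullet_{e_1}$: $\mathbf{P}_1$ in degree $1$; $P^\bullet_{e_2}$: $\mathbf{P}_2$ in degree $1$. - $P^\bullet_\alpha$: $\mathbf{P}_1\xrightarrow{p(\alpha)}\mathbf{P}_2$; $P^\bullet_\beta$: $\mathbf{P}_2\xrightarrow{p(\beta)}\mathbf{P}_1$. - $P^\bullet_{(\beta\alpha)^s}$: $\mathbf{P}_2\xrightarrow{p(\beta\alpha)}\mathbf{P}_2\xrightarrow{p(\beta\alpha)}\cdots\xrightarrow{p(\beta\alpha)}\mathbf{P}_2$, with $s$ maps $p(\beta\alpha)$ and last term in degree $s+1$. - $P^\bullet_{\alpha(\beta\alpha)^s}$: $\mathbf{P}_1\xrightarrow{p(\alpha)}\mathbf{P}_2\xrightarrow{p(\beta\alpha)}\cdots\xrightarrow{p(\beta\alpha)}\mathbf{P}_2$, with $s$ maps $p(\beta\alpha)$ and last term in degree $s+2$. - $P^\bullet_{(\beta\alpha)^s\beta}$: $\mathbf{P}_2\xrightarrow{p(\beta\alpha)}\cdots\xrightarrow{p(\beta\alpha)}\mathbf{P}_2\xrightarrow{p(\beta)}\mathbf{P}_1$,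 with $s$ maps $p(\beta\alpha)$ and last term in degree $s+2$. - $P^\bullet_{\alpha(\beta\alpha)^s\beta}$: $\mathbf{P}_1\xrightarrow{p(\alpha)}\mathbf{P}_2\xrightarrow{p(\beta\alpha)}\cdots\xrightarrow{p(\beta\alpha)}\mathbf{P}_2\xrightarrow{p(\beta)}\mathbf{P}_1$, with $s$ maps $p(\beta\alpha)$ and last term in degree $s+3$. *)

(* Defs.v *)
From HB Require Import structures.
From mathcomp Require Import all_boot all_order all_algebra ring.
Set Implicit Arguments.
Unset Strict Implicit.
Unset Printing Implicit Defensive.
Import Order.TTheory GRing.Theory Num.Theory.
Local Open Scope ring_scope.

Section Linear.
Variables (A : nzRingType) (U V : lmodType A).

Definition lin_of (f : U -> V) (H : linear f) : {linear U -> V} :=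
  HB.pack f (GRing.isLinear.Build A U V *:%R f H).

Fact signed_is_linear (n : nat) (f : {linear U -> V}) :
  linear (fun x => (-1) ^+ n *: f x).
Proof.
by move=> a x y; rewrite linearP scalerDr !scalerA (commr_sign a n).
Qed.

Definition signed n f := lin_of (signed_is_linear n f).

End Linear.

Fact id_is_linear (A : nzRingType) (U : lmodType A) : linear (fun x : U => x).
Proof. by []. Qed.

Fact comp_is_linear (A : nzRingType) (U V W : lmodType A)
  (g : {linear V -> W}) (f : {linear U -> V}) : linear (fun x => g (f x)).
Proof. by move=> a x y; rewrite !linearP. Qed.

(* The derived category D^b(A) of finite-dimensional left modules over a      *)
(* k-algebra A, as the localization of the category of bounded complexes at   *)
(* quasi-isomorphisms.                                                        *)
Section Derived.
Variables (k : fieldType) (A : algType k).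

(* k acts on a left A-module through k -> A, c |-> c%:A. *)
Definition findim (M : lmodType A) : Prop :=
  exists (n : nat) (b : 'I_n -> M),
    forall x, exists c : 'I_n -> k, x = \sum_i (c i)%:A *: b i.

(* Differentials are indexed by all pairs of degrees, and vanish off          *)
(* n = m + 1; this avoids transports between degrees in shifts.               *)
Record cplx := Cplx {
  obj : int -> lmodType A;
  diff : forall m n, {linear obj m -> obj n};
  diff_shape : forall m n, m + 1 != n -> forall x, diff m n x = 0;
  diff_diff : forall m n p x, diff n p (diff m n x) = 0;
  obj_findim : forall n, findim (obj n);
  obj_bounded : exists N : nat,
    forall n, (N < `|n|)%N -> forall x : obj n, x = 0 }.

Record hom (X Y : cplx) := Hom {
  hom_fun : forall n, {linear obj X n -> obj Y n};
  hom_diff : forall m n x,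
    hom_fun n (diff X m n x) = diff Y m n (hom_fun m x) }.

Definition hom_eq X Y (f g : hom X Y) : Prop :=
  forall n, hom_fun f n =1 hom_fun g n.

Definition hom_id X : hom X X :=
  @Hom X X (fun n => lin_of (@id_is_linear A (obj X n))) (fun m n x => erefl).

Fact hom_comp_diff X Y Z (f : hom X Y) (g : hom Y Z) m n (x : obj X m) :
  hom_fun g n (hom_fun f n (diff X m n x)) =
  diff Z m n (hom_fun g m (hom_fun f m x)).
Proof. by rewrite !hom_diff. Qed.

Definition hom_comp X Y Z (f : hom X Y) (g : hom Y Z) : hom X Z :=
  @Hom X Z (fun n => lin_of (comp_is_linear (hom_fun g n) (hom_fun f n)))
    (@hom_comp_diff X Y Z f g).

Definition cycle X n (x : obj X n) : Prop := diff X n (n + 1) x = 0.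
Definition boundary X n (x : obj X n) : Prop :=
  exists y : obj X (n - 1), x = diff X (n - 1) n y.

(* H^n(f) : H^n(X) -> H^n(Y) is injective and surjective for every n. *)
Definition quasi_iso X Y (f : hom X Y) : Prop :=
  forall n,
    (forall x : obj X n, cycle x -> boundary (hom_fun f n x) -> boundary x) /\
    (forall y : obj Y n, cycle y ->
       exists x : obj X n, cycle x /\ boundary (y - hom_fun f n x)).

(* Morphisms of D^b(A) are formal composites (in diagrammatic order) of chain *)
(* maps and inverses of quasi-isomorphisms, modulo the congruence dmor_eq.    *)
Inductive dmor : cplx -> cplx -> Type :=
| DHom X Y (f : hom X Y) : dmor X Y
| DInv X Y (f : hom X Y) (qf : quasi_iso f) : dmor Y X
| DComp X Y Z (f : dmor X Y) (g : dmor Y Z) : dmor X Z.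

Inductive dmor_eq : forall X Y, dmor X Y -> dmor X Y -> Prop :=
| DEq_refl X Y (f : dmor X Y) : dmor_eq f f
| DEq_sym X Y (f g : dmor X Y) : dmor_eq f g -> dmor_eq g f
| DEq_trans X Y (f g h : dmor X Y) :
    dmor_eq f g -> dmor_eq g h -> dmor_eq f h
| DEq_comp X Y Z (f f' : dmor X Y) (g g' : dmor Y Z) :
    dmor_eq f f' -> dmor_eq g g' -> dmor_eq (DComp f g) (DComp f' g')
| DEq_assoc X Y Z W (f : dmor X Y) (g : dmor Y Z) (h : dmor Z W) :
    dmor_eq (DComp f (DComp g h)) (DComp (DComp f g) h)
| DEq_idl X Y (f : dmor X Y) : dmor_eq (DComp (DHom (hom_id X)) f) f
| DEq_idr X Y (f : dmor X Y) : dmor_eq (DComp f (DHom (hom_id Y))) f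
| DEq_hom X Y (f g : hom X Y) : hom_eq f g -> dmor_eq (DHom f) (DHom g)
| DEq_hom_comp X Y Z (f : hom X Y) (g : hom Y Z) :
    dmor_eq (DComp (DHom f) (DHom g)) (DHom (hom_comp f g))
| DEq_invr X Y (f : hom X Y) (qf : quasi_iso f) :
    dmor_eq (DComp (DHom f) (DInv qf)) (DHom (hom_id X))
| DEq_invl X Y (f : hom X Y) (qf : quasi_iso f) :
    dmor_eq (DComp (DInv qf) (DHom f)) (DHom (hom_id Y)).

Definition diso X Y : Prop :=
  exists (f : dmor X Y) (g : dmor Y X),
    dmor_eq (DComp f g) (DHom (hom_id X)) /\
    dmor_eq (DComp g f) (DHom (hom_id Y)).

Section Shift.
Variables (i : int) (X : cplx).

Fact shift_shape m n : m + 1 != n ->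
  forall x, signed `|i| (diff X (m + i) (n + i)) x = 0.
Proof.
move=> mn x; rewrite /= diff_shape ?scaler0 //.
by rewrite addrAC (inj_eq (addIr i)).
Qed.

Fact shift_diff m n p x :
  signed `|i| (diff X (n + i) (p + i))
    (signed `|i| (diff X (m + i) (n + i)) x) = 0.
Proof. by rewrite /= linearZ /= diff_diff !scaler0. Qed.

Fact shift_bounded : exists N : nat,
  forall n, (N < `|n|)%N -> forall x : obj X (n + i), x = 0.
Proof.
have [N HN] := obj_bounded X; exists (N + `|i|)%N => n Nn x; apply: HN.
rewrite -(ltn_add2r `|i|); apply: leq_trans Nn _.
rewrite -lez_nat PoszD !abszE -[X in `|X| <= _](addrK i n).
exact: ler_normB.
Qed.

(* (T^i X)^n = X^(n + i), with differential (-1)^i d. *)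
Definition shift : cplx :=
  @Cplx (fun n => obj X (n + i))
    (fun m n => signed `|i| (diff X (m + i) (n + i)))
    shift_shape shift_diff (fun n => obj_findim X (n + i)) shift_bounded.

End Shift.

Section DirectSum.
Variables X Y : cplx.

Definition dsum_diff_fun m n (z : obj X m * obj Y m) : obj X n * obj Y n :=
  (diff X m n z.1, diff Y m n z.2).

Fact dsum_diff_is_linear m n : linear (@dsum_diff_fun m n).
Proof. by move=> a x y; rewrite /dsum_diff_fun !linearP. Qed.

Fact dsum_shape m n : m + 1 != n ->
  forall z, lin_of (@dsum_diff_is_linear m n) z = 0.
Proof. by move=> mn z; rewrite /= /dsum_diff_fun !diff_shape. Qed.

Fact dsum_diff m n p z :
  lin_of (@dsum_diff_is_linear n p) (lin_of (@dsum_diff_is_linear m n) z) = 0.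
Proof. by rewrite /= /dsum_diff_fun /= !diff_diff. Qed.

Fact dsum_findim n : findim (obj X n * obj Y n)%type.
Proof.
have [p [b Hb]] := obj_findim X n; have [q [c Hc]] := obj_findim Y n.
exists (p + q)%N, (fun i => match split i with
  inl j => (b j, 0) | inr j => (0, c j) end) => -[x y].
have [s ->] := Hb x; have [t ->] := Hc y.
exists (fun i => match split i with inl j => s j | inr j => t j end).
have sl i : split (lshift q i) = inl i := unsplitK (inl i : 'I_p + 'I_q).
have sr i : split (rshift p i) = inr i := unsplitK (inr i : 'I_p + 'I_q).
rewrite big_split_ord /=.
rewrite (eq_bigr (fun i => (s i)%:A *: (b i, 0))); last first.
  by move=> i _; rewrite sl.
rewrite [X in _ + X](eq_bigr (fun i => (t i)%:A *: (0, c i))); last first.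
  by move=> i _; rewrite sr.
rewrite [LHS]surjective_pairing [RHS]surjective_pairing; congr pair.
  rewrite raddfD /= !raddf_sum /= [X in _ + X]big1 ?addr0 // => i _.
  by rewrite scaler0.
rewrite raddfD /= !raddf_sum /= [X in X + _]big1 ?add0r // => i _.
by rewrite scaler0.
Qed.

Fact dsum_bounded : exists N : nat,
  forall n, (N < `|n|)%N -> forall z : obj X n * obj Y n, z = 0.
Proof.
have [N HN] := obj_bounded X; have [M HM] := obj_bounded Y.
exists (maxn N M) => n; rewrite gtn_max => /andP[Nn Mn] [x y].
by rewrite (HN n Nn x) (HM n Mn y).
Qed.

Definition dsum : cplx :=
  @Cplx (fun n => (obj X n * obj Y n)%type)
    (fun m n => lin_of (@dsum_diff_is_linear m n))
    dsum_shape dsum_diff dsum_findim dsum_bounded.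

End DirectSum.

(* The left ideal A u, for u idempotent (for u arbitrary, the largest left    *)
(* ideal on which right multiplication by u is the identity).                 *)
Record lideal (u : A) := LIdeal { lival : A^o; _ : lival * u == lival }.
Arguments LIdeal {u}.

HB.instance Definition _ u := [isSub for @lival u].
HB.instance Definition _ u := [Choice of lideal u by <:].

Fact lideal_submod u : submod_closed (fun x : A^o => x * u == x :> A).
Proof.
split=> [|a x y /eqP xu /eqP yu]; first by rewrite unfold_in mul0r.
by rewrite unfold_in mulrDl -mulrA xu yu.
Qed.
HB.instance Definition _ u :=
  GRing.SubChoice_isSubLmodule.Build A A^o (fun x : A^o => x * u == x :> A)
    (lideal u) (lideal_submod u).

Lemma livalP u (x : lideal u) : (lival x : A) * u = lival x.
Proof. exact/eqP/(valP x). Qed.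

Lemma lival_linear u a (x y : lideal u) :
  lival (a *: x + y) = a * (lival x : A) + lival y.
Proof. exact: (linearP (\val : lideal u -> A^o)). Qed.

Section RightMul.
Variables (u v w : A) (wv : w * v = w).

Fact rmul_subproof (x : lideal u) :
  ((lival x : A) * w) * v == (lival x : A) * w.
Proof. by rewrite -mulrA wv. Qed.

Definition rmul_fun (x : lideal u) : lideal v := LIdeal _ (rmul_subproof x).

Fact rmul_is_linear : linear rmul_fun.
Proof.
move=> a x y; apply/val_inj; rewrite [RHS]lival_linear.
rewrite -[LHS]/((lival (a *: x + y) : A) * w) lival_linear.
by rewrite mulrDl -mulrA.
Qed.

(* A u -> A v, x |-> x w *)
Definition rmul : {linear lideal u -> lideal v} := lin_of rmul_is_linear.

End RightMul.

Fact lideal0 (x : lideal 0) : x = 0.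
Proof. by apply/val_inj; rewrite /= -[LHS](livalP x) mulr0. Qed.


Definition zero_cplx : cplx.
Proof.
refine (@Cplx (fun=> lideal 0) (fun m n => @rmul 0 0 0 (mulr0 0)) _ _ _ _).
- by move=> m n _ x; apply: lideal0.
- by move=> m n p x; apply: lideal0.
- by move=> n; exists 0%N, (fun=> 0) => x; exists (fun=> 0);
    rewrite big_ord0 (lideal0 x).
- by exists 0%N => n _ x; apply: lideal0.
Defined.

Definition indecomposable (X : cplx) : Prop :=
  ~ diso X zero_cplx /\
  forall Y Z : cplx, diso X (dsum Y Z) -> diso Y zero_cplx \/ diso Z zero_cplx.

Fact lideal_findim u : u * u = u -> findim A^o -> findim (lideal u).
Proof.
move=> uu [n [b Hb]].
have bu i : ((b i : A) * u) * u == (b i : A) * u by rewrite -mulrA uu.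
exists n, (fun i => LIdeal _ (bu i)) => x.
have [c Hc] := Hb (lival x); exists c; apply/val_inj.
transitivity ((lival x : A) * u); first by rewrite livalP.
rewrite [in LHS]Hc mulr_suml.
have E0 : lival (0 : lideal u) = 0 by exact: (raddf0 (\val : lideal u -> A^o)).
have ED : {morph @lival u : y z / y + z}.
  exact: (raddfD (\val : lideal u -> A^o)).
rewrite [RHS](big_morph _ ED E0); apply: eq_bigr => i _.
have := lival_linear (c i)%:A (LIdeal _ (bu i)) 0.
by rewrite E0 !addr0 => ->; rewrite /= mulrA.
Qed.

(* The complex with term A (u n) and differential x |-> x * w n in degree n. *)
Section ProjComplex.
Variables (u w : int -> A).
Hypothesis A_findim : findim A^o.
Hypothesis uu : forall n, u n * u n = u n.
Hypothesis wu : forall n, w n * u (n + 1) = w n.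
Hypothesis ww : forall n, w n * w (n + 1) = 0.
Hypothesis u_bounded : exists N : nat, forall n : int, (N < `|n|)%N -> u n = 0.

Definition pcoef m n : A := if m + 1 == n then w m else 0.

Fact pcoef_mul m n : pcoef m n * u n = pcoef m n.
Proof. by rewrite /pcoef; case: eqP => [<-|_]; rewrite ?wu ?mul0r. Qed.

Fact proj_shape m n : m + 1 != n ->
  forall x, rmul (u m) (pcoef_mul m n) x = 0.
Proof.
by move=> mn x; apply/val_inj; rewrite /= /pcoef (negPf mn) mulr0.
Qed.

Fact proj_diff m n p x :
  rmul (u n) (pcoef_mul n p) (rmul (u m) (pcoef_mul m n) x) = 0.
Proof.
apply/val_inj; rewrite /= -mulrA /pcoef.
case: eqP => [<-|_]; last by rewrite mul0r mulr0.
by case: eqP => _; rewrite ?ww !mulr0.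
Qed.

Fact proj_bounded : exists N : nat,
  forall n, (N < `|n|)%N -> forall x : lideal (u n), x = 0.
Proof.
have [N HN] := u_bounded; exists N => n Nn x.
by apply/val_inj; rewrite /= -(livalP x) [X in _ * X]HN // mulr0.
Qed.

Definition proj_cplx : cplx :=
  @Cplx (fun n => lideal (u n)) (fun m n => rmul (u m) (pcoef_mul m n))
    proj_shape proj_diff (fun n => lideal_findim (uu n) A_findim) proj_bounded.

End ProjComplex.

End Derived.

Inductive vertex := V1 | V2.

(* The paths that do not contain alpha beta; they form a basis of A_2. *)
Inductive bpath := E1 | E2 | Alpha | Beta | BetaAlpha.

Definition vertex_eqb (x y : vertex) : bool :=
  match x, y with V1, V1 | V2, V2 => true | _, _ => false end.
Fact vertex_eqP : Equality.axiom vertex_eqb.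
Proof. by case; case; constructor. Qed.
HB.instance Definition _ := hasDecEq.Build vertex vertex_eqP.

Definition bpath_code (p : bpath) : nat :=
  match p with E1 => 0 | E2 => 1 | Alpha => 2 | Beta => 3 | BetaAlpha => 4 end.
Definition bpath_decode (n : nat) : bpath :=
  nth E1 [:: E1; E2; Alpha; Beta; BetaAlpha] n.
Fact bpath_codeK : cancel bpath_code bpath_decode.
Proof. by case. Qed.
HB.instance Definition _ := Countable.copy bpath (can_type bpath_codeK).
Fact bpath_enumP : Finite.axiom [:: E1; E2; Alpha; Beta; BetaAlpha].
Proof. by case. Qed.
HB.instance Definition _ := isFinite.Build bpath bpath_enumP.

Definition src (p : bpath) : vertex :=
  match p with E1 | Alpha => V1 | E2 | Beta | BetaAlpha => V2 end.
Definition tgt (p : bpath) : vertex :=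
  match p with E1 | Beta => V1 | E2 | Alpha | BetaAlpha => V2 end.
Definition triv (v : vertex) : bpath := match v with V1 => E1 | V2 => E2 end.

(* "p then q"; None stands for 0 (not composable, or containing alpha beta). *)
Definition pmul (p q : bpath) : option bpath :=
  match p, q with
  | E1, (E1 | Alpha) => Some q
  | E2, (E2 | Beta | BetaAlpha) => Some q
  | Alpha, E2 => Some Alpha
  | Beta, E1 => Some Beta
  | Beta, Alpha => Some BetaAlpha
  | BetaAlpha, E2 => Some BetaAlpha
  | _, _ => None
  end.

Definition A2 (k : fieldType) : Type := {ffun bpath -> k}.

Section A2.
Variable k : fieldType.
Local Notation A := (A2 k).

HB.instance Definition _ := GRing.Lmodule.copy A {ffun bpath -> k^o}.

Definition A2_basis (p : bpath) : A := [ffun r => (r == p)%:R].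
Definition A2_one : A := A2_basis E1 + A2_basis E2.
Definition A2_mul (x y : A) : A :=
  [ffun r => \sum_p \sum_q (if pmul p q == Some r then x p * y q else 0)].

Fact sum_bpath (V : nmodType) (F : bpath -> V) :
  \sum_p F p = F E1 + F E2 + F Alpha + F Beta + F BetaAlpha.
Proof.
rewrite -big_enum enumT Finite.enum.unlock /= !big_cons big_nil.
by rewrite addr0 !addrA.
Qed.

Fact A2_mulE x y : A2_mul x y = [ffun r => match r with
  | E1 => x E1 * y E1
  | E2 => x E2 * y E2
  | Alpha => x E1 * y Alpha + x Alpha * y E2
  | Beta => x E2 * y Beta + x Beta * y E1
  | BetaAlpha => x E2 * y BetaAlpha + x Beta * y Alpha + x BetaAlpha * y E2
  end].
Proof.
by apply/ffunP=> r; rewrite !ffunE !sum_bpath; case: r;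
  rewrite /= !(add0r, addr0).
Qed.

Fact A2_mulA : associative A2_mul.
Proof. by move=> x y z; apply/ffunP; case; rewrite !A2_mulE !ffunE; ring. Qed.
Fact A2_mul1r : left_id A2_one A2_mul.
Proof. by move=> x; apply/ffunP; case; rewrite !A2_mulE !ffunE /=; ring. Qed.
Fact A2_mulr1 : right_id A2_one A2_mul.
Proof. by move=> x; apply/ffunP; case; rewrite !A2_mulE !ffunE /=; ring. Qed.
Fact A2_mulDl : left_distributive A2_mul +%R.
Proof. by move=> x y z; apply/ffunP; case; rewrite !A2_mulE !ffunE; ring. Qed.
Fact A2_mulDr : right_distributive A2_mul +%R.
Proof. by move=> x y z; apply/ffunP; case; rewrite !A2_mulE !ffunE; ring. Qed.
Fact A2_oner_neq0 : A2_one != 0.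
Proof.
by apply/eqP => /ffunP/(_ E1)/eqP; rewrite !ffunE /= addr0 oner_eq0.
Qed.
HB.instance Definition _ := GRing.Zmodule_isNzRing.Build A
  A2_mulA A2_mul1r A2_mulr1 A2_mulDl A2_mulDr A2_oner_neq0.

Fact A2_scaleAl (c : k) (x y : A) : c *: (x * y) = (c *: x) * y.
Proof.
rewrite -[x * y]/(A2_mul x y) -[RHS]/(A2_mul (c *: x) y) !A2_mulE.
by apply/ffunP; case; rewrite !ffunE /= /GRing.scale /=; ring.
Qed.
HB.instance Definition _ := GRing.Lmodule_isLalgebra.Build k A A2_scaleAl.
Fact A2_scaleAr (c : k) (x y : A) : c *: (x * y) = x * (c *: y).
Proof.
rewrite -[x * y]/(A2_mul x y) -[RHS]/(A2_mul x (c *: y)) !A2_mulE.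
by apply/ffunP; case; rewrite !ffunE /= /GRing.scale /=; ring.
Qed.
HB.instance Definition _ := GRing.Lalgebra_isAlgebra.Build k A A2_scaleAr.


Lemma A2_basisM p q :
  A2_basis p * A2_basis q = if pmul p q is Some r then A2_basis r else 0.
Proof.
rewrite -[LHS]/(A2_mul (A2_basis p) (A2_basis q)) A2_mulE.
apply/ffunP => r; rewrite ffunE.
by case: p; case: q; case: r; rewrite /= !ffunE /=; ring.
Qed.

Lemma A2_basis_sum (x : A) : x = \sum_p x p *: A2_basis p.
Proof.
rewrite sum_bpath; apply/ffunP; case; rewrite !ffunE /= /GRing.scale /=; ring.
Qed.

(* A_2 is the quotient of the path algebra by alpha beta = 0: it is the       *)
(* universal k-algebra with orthogonal idempotents x1 + x2 = 1 and elements   *)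
(* a in x1 B x2, b in x2 B x1 such that a b = 0.                              *)
Lemma A2_universal (B : algType k) (x1 x2 a b : B) :
  x1 * x1 = x1 -> x2 * x2 = x2 -> x1 * x2 = 0 -> x2 * x1 = 0 -> x1 + x2 = 1 ->
  x1 * a = a -> a * x2 = a -> x2 * b = b -> b * x1 = b -> a * b = 0 ->
  exists2 f : {lrmorphism A -> B},
    [/\ f (A2_basis E1) = x1, f (A2_basis E2) = x2,
        f (A2_basis Alpha) = a & f (A2_basis Beta) = b] &
    forall g : {lrmorphism A -> B},
      [/\ g (A2_basis E1) = x1, g (A2_basis E2) = x2,
          g (A2_basis Alpha) = a & g (A2_basis Beta) = b] -> g =1 f.
Proof.
move=> x11 x22 x12 x21 x1D x1a ax2 x2b bx1 ab.
pose h p := match p with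
  E1 => x1 | E2 => x2 | Alpha => a | Beta => b | BetaAlpha => b * a end.
have hM p q : h p * h q = if pmul p q is Some r then h r else 0.
  have x2a : x2 * a = 0 by rewrite -x1a mulrA x21 mul0r.
  have ax1 : a * x1 = 0 by rewrite -ax2 -mulrA x21 mulr0.
  have x1b : x1 * b = 0 by rewrite -x2b mulrA x12 mul0r.
  have bx2 : b * x2 = 0 by rewrite -bx1 -mulrA x12 mulr0.
  have aa : a * a = 0 by rewrite -{1}ax2 -mulrA x2a mulr0.
  have bb : b * b = 0 by rewrite -{1}bx1 -mulrA x1b mulr0.
  by case: p; case: q => //=;
    rewrite ?mulrA ?x1b ?x2b ?ab ?bb ?(mul0r, mulr0) // -?mulrA;
    rewrite ?ax1 ?ax2 ?aa ?(mulrA a) ?ab ?(mul0r, mulr0).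
pose f (x : A) : B := \sum_p x p *: h p.
have fE p : f (A2_basis p) = h p.
  rewrite /f (bigD1 p) //= big1 => [|q /negPf qp].
    by rewrite ffunE eqxx scale1r addr0.
  by rewrite ffunE qp scale0r.
have f_lin : linear f.
  move=> c x y; rewrite /f scaler_sumr -big_split; apply: eq_bigr => p _ /=.
  by rewrite !ffunE scalerDl scalerA.
pose fL : {linear A -> B} := lin_of f_lin.
have f_mon : monoid_morphism f.
  have f0 : f 0 = 0 := raddf0 fL.
  have fD : {morph f : x y / x + y} := raddfD fL.
  have fZ c x : f (c *: x) = c *: f x.
    by have := f_lin c x 0; rewrite !addr0 f0 addr0.
  have fS (F : bpath -> A) : f (\sum_p F p) = \sum_p f (F p).
    exact: (big_morph f fD f0).
  split=> [|x y]; first by rewrite fD !fE.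
  rewrite (A2_basis_sum x) (A2_basis_sum y) mulr_suml !fS.
  rewrite mulr_suml; apply: eq_bigr => p _; rewrite mulr_sumr fS mulr_sumr.
  apply: eq_bigr => q _.
  rewrite -scalerAl -scalerAr !fZ !fE -scalerAl -scalerAr hM A2_basisM.
  by case: (pmul p q) => [r|]; rewrite ?fE ?f0.
pose fR : {lrmorphism A -> B} := HB.pack f
  (GRing.isLinear.Build k A B *:%R f f_lin)
  (GRing.isMonoidMorphism.Build A B f f_mon).
exists fR => [|g [g1 g2 ga gb] x]; first by split; rewrite /= fE.
have gZ (g' : {lrmorphism A -> B}) c y : g' (c *: y) = c *: g' y.
  exact: linearZ.
rewrite (A2_basis_sum x) !raddf_sum; apply: eq_bigr => p _.
rewrite [LHS]gZ [RHS]gZ /= fE; congr (_ *: _); case: p => //=.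
by rewrite -ga -gb -rmorphM A2_basisM.
Qed.

Lemma A2_findim : findim (k := k) A^o.
Proof.
exists 5%N, (fun i : 'I_5 => A2_basis (bpath_decode i)) => x.
exists (fun i : 'I_5 => (x : A) (bpath_decode i)).
rewrite [LHS]A2_basis_sum sum_bpath !big_ord_recl big_ord0 addr0 !addrA.
by rewrite -!/(_ * _) -![_%:A *: _]/(_%:A * _ : A) -!scalerAl !mul1r.
Qed.

(* A string (v, [:: p_1; ...; p_r]) stands for the complex                    *)
(*   A e_v --x p_1--> A e_(tgt p_1) --x p_2--> ... --x p_r--> A e_(tgt p_r)   *)
(* with leftmost term in degree 1.                                            *)
Definition str_ok (v : vertex) (l : seq bpath) : bool :=
  path (fun p q => tgt p == src q) (triv v) l
  && sorted (fun p q => pmul p q == None) l.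

Definition str_term (v : vertex) (l : seq bpath) (n : int) : A :=
  if n is Posz j.+1
  then nth 0 [seq A2_basis (triv a) | a <- v :: map tgt l] j else 0.

Definition str_map (l : seq bpath) (n : int) : A :=
  if n is Posz j.+1 then nth 0 [seq A2_basis p | p <- l] j else 0.

Section StringComplex.
Variables (v : vertex) (l : seq bpath).
Hypothesis l_ok : str_ok v l.

Fact str_term_idem n : str_term v l n * str_term v l n = str_term v l n.
Proof.
rewrite /str_term; case: n => [[|j]|j]; rewrite ?mul0r //.
set s := v :: _; have [js|js] := ltnP j (size s).
  by rewrite (nth_map v) // A2_basisM; case: (nth _ _ _).
by rewrite nth_default ?size_map // mul0r.
Qed.

Fact str_map_term n : str_map l n * str_term v l (n + 1) = str_map l n.
Proof.
case: n => [[|j]|j]; [by rewrite mul0r| |by rewrite mul0r].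
have -> : Posz j.+1 + 1 = Posz j.+2 by rewrite -PoszD addn1.
rewrite /str_map /str_term /=.
have [js|js] := ltnP j (size l); last by rewrite nth_default ?size_map // mul0r.
rewrite !(nth_map E1) ?size_map // (nth_map v) ?size_map // (nth_map E1) //.
by rewrite A2_basisM; case: (nth _ _ _).
Qed.

Fact str_map_map n : str_map l n * str_map l (n + 1) = 0.
Proof.
case: n => [[|j]|j]; [by rewrite mul0r| |by rewrite mul0r].
have -> : Posz j.+1 + 1 = Posz j.+2 by rewrite -PoszD addn1.
rewrite /str_map /str_term /=.
have [js|js] := ltnP j.+1 (size l); last first.
  by rewrite [X in _ * X]nth_default ?size_map // mulr0.
rewrite !(nth_map E1) ?(ltnW js) // A2_basisM.
case/andP: l_ok => _; case: l js => [|p s] // js /(pathP E1)/(_ j js) /=.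
by move/eqP=> ->.
Qed.

Fact str_bounded : exists N : nat,
  forall n : int, (N < `|n|)%N -> str_term v l n = 0.
Proof.
exists (size l).+1 => -[[|j]|j] //= Hj.
by rewrite nth_default //= !size_map.
Qed.

Definition str_cplx : cplx A :=
  proj_cplx A2_findim str_term_idem str_map_term str_map_map str_bounded.

End StringComplex.

End A2.

(* Names of the complexes P_w; the arguments s range over all of nat,         *)
(* including 0.                                                               *)
Inductive pname :=
| P_e1 | P_e2 | P_a | P_b
| P_ba of nat    (* (beta alpha)^s *)
| P_aba of nat   (* alpha (beta alpha)^s *)
| P_bab of nat   (* (beta alpha)^s beta *)
| P_abab of nat. (* alpha (beta alpha)^s beta *)

Definition pstring (w : pname) : vertex * seq bpath :=
  match w with
  | P_e1 => (V1, [::])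
  | P_e2 => (V2, [::])
  | P_a => (V1, [:: Alpha])
  | P_b => (V2, [:: Beta])
  | P_ba s => (V2, nseq s BetaAlpha)
  | P_aba s => (V1, Alpha :: nseq s BetaAlpha)
  | P_bab s => (V2, rcons (nseq s BetaAlpha) Beta)
  | P_abab s => (V1, Alpha :: rcons (nseq s BetaAlpha) Beta)
  end.

Fact pstring_ok w : str_ok (pstring w).1 (pstring w).2.
Proof.
by case: w => //= s; rewrite /str_ok /=; elim: s => [|[|s] IH] //=.
Qed.

Definition P (k : fieldType) (w : pname) : cplx (A2 k) :=
  str_cplx k (pstring_ok w).

(* The string determines the complex; the coincidences are exactly            *)
(* (beta alpha)^0 = e_2, alpha (beta alpha)^0 = alpha, (beta alpha)^0 beta =  *)
(* beta.                                                                      *)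
Lemma P_pstring k w w' : pstring w = pstring w' -> P k w = P k w'.
Proof.
rewrite /P; move: (pstring_ok w) (pstring_ok w') => H H' e.
by move: H; rewrite e => H; rewrite (bool_irrelevance H H').
Qed.

(* Main.v *)
From Pilot Require Import Defs.
From HB Require Import structures.
From mathcomp Require Import all_boot all_order all_algebra.
From mathcomp Require Import boolp classical_sets.
From mathcomp Require Import ring zify.
Set Implicit Arguments.
Unset Strict Implicit.
Unset Printing Implicit Defensive.
Import Order.TTheory GRing.Theory Num.Theory.
Import Pilot.Defs.
Local Open Scope ring_scope.

(** Why the theorem is true.

    Maps out of a complex of projectives. Let P be a bounded complex with terms
    A u_n, u_n idempotent, and differentials given by right multiplication. A
    chain map P -> X is a family of elements x_n in u_n X_n with
    d x_n = w_n x_(n+1), and null-homotopies are families as well (cocycle,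
    coboundary). Since the terms are projective, Hom(P, -) up to homotopy
    inverts quasi-isomorphisms (quasi_iso_lift, quasi_iso_null), so it factors
    through the derived category although morphisms there are only formal words
    (act_rel, act_rel_eq). This is the only access to the derived category that
    the proof needs.

    Indecomposability and distinctness. The differentials of a string complex
    have coefficients in the radical. Modulo the radical an endomorphism is one
    scalar, constant along the string; for a homotopy idempotent this scalar is
    0 or 1, and an idempotent with scalar 0 has square zero, so it is
    null-homotopic (endo_idempotent). Hence one of the two summands in a
    decomposition is acyclic. An isomorphism between string complexes is also
    invertible modulo the radical, so the terms agree degree by degree
    (diso_terms), and the terms determine the string because at most one
    nontrivial path joins two given vertices.

    Exhaustiveness. It is enough to split one string complex P off from a
    nonacyclic X. A map P -> X is a string of elements of X. A map out of X
    comes from Serre duality: if a family in Hom(Z, X) is not null-homotopic,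
    then a functional that detects it defines a map from X to the complex of
    injectives I obtained from Z by replacing A u with D(u A). When the
    composite P -> X -> I is a quasi-isomorphism, X is isomorphic to the sum of
    P and the homotopy fibre of X -> I (split_quasi_iso). For each string P
    there is a string Z for which I is isomorphic to P in the derived category,
    and the composite is a quasi-isomorphism as soon as the functional has the
    value 1 on the head of the string of elements: this value propagates along
    the string, and it makes the kernel and cokernel complexes of the composite
    exact (ker_chain, coker_chain).

    It remains to find a string of elements that is detected. A null-homotopy of
    an undetected string is itself a string with an equivalent head, shorter or
    longer by one term, and as X is bounded this cannot go on (extremal_chain).
    There are three kinds of heads. If beta acts nontrivially from H(e_1 X) to
    H(e_2 X), one obtains strings that start at the vertex 2 (beta_case).
    Otherwise, in the lowest degree in which H(e_1 X) does not vanish, strings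
    can be prolonged to the left by alpha (vertex1_case). If H(e_1 X) = 0, the
    simple module at the vertex 2 splits off, which is the complex of the string
    alpha (vertex2_case). *)

(** * Isomorphisms in the derived category *)

Section DerivedIso.
Variables (k : fieldType) (A : algType k).
Implicit Types X Y Z : cplx A.

Lemma diso_sym X Y : diso X Y -> diso Y X.
Proof. by case=> f [g [fg gf]]; exists g, f. Qed.

Lemma diso_trans X Y Z : diso X Y -> diso Y Z -> diso X Z.
Proof.
suff H (U V W : cplx A) (f : dmor U V) (g : dmor V U) (f' : dmor V W) (g' : dmor
  W V) :
    dmor_eq (DComp f g) (DHom (hom_id U)) ->
    dmor_eq (DComp f' g') (DHom (hom_id V)) ->
    dmor_eq (DComp (DComp f f') (DComp g' g)) (DHom (hom_id U)).
  move=> [f [g [fg gf]]] [f' [g' [fg' gf']]].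
  by exists (DComp f f'), (DComp g' g); split; apply: H.
move=> fg fg'; apply: DEq_trans (DEq_sym (DEq_assoc _ _ _)) _.
apply: DEq_trans fg; apply: DEq_comp (DEq_refl f) _.
apply: DEq_trans (DEq_assoc _ _ _) _.
exact: DEq_trans (DEq_comp fg' (DEq_refl g)) (DEq_idl g).
Qed.

Lemma quasi_iso_diso X Y (f : hom X Y) : quasi_iso f -> diso X Y.
Proof.
move=> qf; exists (DHom f), (DInv qf).
by split; [apply: DEq_invr | apply: DEq_invl].
Qed.

Definition acyclic X := forall n (x : obj X n), cycle x -> boundary x.

Lemma boundary0 X n : boundary (0 : obj X n).
Proof. by exists 0; rewrite linear0. Qed.

Lemma boundaryS X n (x : obj X (n + 1)) :
  boundary x -> exists y, x = diff X n (n + 1) y.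
Proof.
case=> y; move: (n + 1 - 1) (addrK 1 n) y => m -> y ->; by exists y.
Qed.

Lemma boundaryB X n (x y : obj X n) :
  boundary x -> boundary y -> boundary (x - y).
Proof. by case=> a -> [b ->]; exists (a - b); rewrite linearB. Qed.

Lemma boundaryZ X n (a : A) (x : obj X n) : boundary x -> boundary (a *: x).
Proof. by case=> b ->; exists (a *: b); rewrite linearZ. Qed.

Fact zero_is_linear (U V : lmodType A) : linear (fun _ : U => 0 : V).
Proof. by move=> a x y; rewrite scaler0 addr0. Qed.

Definition zero_hom X Y : hom X Y :=
  @Hom k A X Y (fun n => lin_of (@zero_is_linear (obj X n) (obj Y n)))
    (fun m n x => esym (linear0 (diff Y m n))).

Lemma acyclic_diso0 X : acyclic X -> diso X (zero_cplx A).
Proof.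
move=> acX; apply: (@quasi_iso_diso _ _ (zero_hom X (zero_cplx A))) => n.
split=> [x cx _|y cy]; first exact: acX.
exists 0; split; first by rewrite /cycle linear0.
exists 0; apply: etrans (esym (linear0 _)).
by rewrite subr0; apply: (@lideal0 k A y).
Qed.

Fact inl_is_linear (U V : lmodType A) :
  linear (fun x : U => (x, 0) : (U * V)%type).
Proof.
by move=> a x y; rewrite [LHS]surjective_pairing [RHS]surjective_pairing;
  congr pair; rewrite /= scaler0 addr0.
Qed.

Fact dsum_inl_diff X Y m n (x : obj X m) :
  (diff X m n x, 0) = @dsum_diff_fun k A X Y m n (x, 0).
Proof. by rewrite /dsum_diff_fun /= linear0. Qed.

Definition dsum_inl X Y : hom X (dsum X Y) :=
  @Hom k A X (dsum X Y)
    (fun n => lin_of (@inl_is_linear (obj X n) (obj Y n)))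
    (fun m n x => dsum_inl_diff Y n x).

Lemma diso_dsum_acyclic X Y : acyclic Y -> diso X (dsum X Y).
Proof.
move=> acY; apply: (@quasi_iso_diso _ _ (dsum_inl X Y)) => n; split.
  by move=> x _ [[y y']] [e _]; exists y.
case=> x y; rewrite /cycle /= /dsum_diff_fun => -[cx cy].
exists x; split=> //; have [z ez] := acY _ _ cy.
exists (0, z); rewrite /= /dsum_diff_fun /= linear0 -ez.
by congr (_, _); rewrite /= ?subrr ?subr0.
Qed.

End DerivedIso.

(** * Maps out of complexes of projectives *)

Section Families.
Variables (k : fieldType) (A : algType k).

Definition fam (X : cplx A) := forall n : int, obj X n.

Variable X : cplx A.
Implicit Types x y z : fam X.

Let add x y : fam X := fun n => x n + y n.
Let opp x : fam X := fun n => - x n.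
Let zero : fam X := fun n => 0.
Let scale (a : A) x : fam X := fun n => a *: x n.

HB.instance Definition _ := gen_eqMixin (fam X).
HB.instance Definition _ := gen_choiceMixin (fam X).

Fact fam_addA : associative add.
Proof. by move=> x y z; apply: functional_extensionality_dep => n;
  apply: addrA. Qed.
Fact fam_addC : commutative add.
Proof. by move=> x y; apply: functional_extensionality_dep => n;
  apply: addrC. Qed.
Fact fam_add0 : left_id zero add.
Proof. by move=> x; apply: functional_extensionality_dep => n;
  apply: add0r. Qed.
Fact fam_addN : left_inverse zero opp add.
Proof. by move=> x; apply: functional_extensionality_dep => n;
  apply: addNr. Qed.
HB.instance Definition _ :=
  GRing.isZmodule.Build (fam X) fam_addA fam_addC fam_add0 fam_addN.

Fact fam_scaleA a b x : scale a (scale b x) = scale (a * b) x.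
Proof. by apply: functional_extensionality_dep => n; apply: scalerA. Qed.
Fact fam_scale1 : left_id 1 scale.
Proof. by move=> x; apply: functional_extensionality_dep => n;
  apply: scale1r. Qed.
Fact fam_scaleDr : right_distributive scale +%R.
Proof. by move=> a x y; apply: functional_extensionality_dep => n;
  apply: scalerDr. Qed.
Fact fam_scaleDl x : {morph scale^~ x : a b / a + b}.
Proof. by move=> a b; apply: functional_extensionality_dep => n;
  apply: scalerDl. Qed.
HB.instance Definition _ := GRing.Zmodule_isLmodule.Build A (fam X)
  fam_scaleA fam_scale1 fam_scaleDr fam_scaleDl.

Lemma famD x y n : (x + y) n = x n + y n. Proof. by []. Qed.
Lemma famN x n : (- x) n = - x n. Proof. by []. Qed.
Lemma fam0 n : (0 : fam X) n = 0. Proof. by []. Qed.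
Lemma famZ a x n : (a *: x) n = a *: x n. Proof. by []. Qed.

Lemma famP x y : (forall n : int, x n = y n) -> x = y.
Proof. exact: functional_extensionality_dep. Qed.

Definition at_deg n (x : obj X n) : fam X := dfwith (0 : fam X) x.

Lemma at_deg_in n (x : obj X n) : at_deg x n = x.
Proof. exact: dfwith_in. Qed.

Lemma at_deg_out n (x : obj X n) m : n != m -> at_deg x m = 0.
Proof. exact: dfwith_out. Qed.

Lemma at_deg_linear n : linear (@at_deg n).
Proof.
move=> a x y; apply: famP => m; rewrite famD famZ.
have [<-|nm] := eqVneq n m; first by rewrite !at_deg_in.
by rewrite !at_deg_out // scaler0 addr0.
Qed.

End Families.

Lemma addrKl (V : zmodType) (x y : V) : x + y - x = y.
Proof. by rewrite addrC addKr. Qed.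

Definition famE := (famD, famN, famZ, fam0).

Section FamHom.
Variables (k : fieldType) (A : algType k).

Definition famhom (X Y : cplx A) (f : hom X Y) (x : fam X) : fam Y :=
  fun n => hom_fun f n (x n).

Lemma famhom_linear (X Y : cplx A) (f : hom X Y) : linear (famhom f).
Proof. by move=> a x y; apply: famP => n; rewrite /famhom famE linearP. Qed.

HB.instance Definition _ (X Y : cplx A) (f : hom X Y) :=
  GRing.isLinear.Build A (fam X) (fam Y) *:%R (famhom f)
    (@famhom_linear X Y f).

(** The complex with term A u_n in degree n and differential x |-> x w_n,
    reduced to its coefficients. Maps from it to a complex X are families x of
    elements x_n = u_n x_n with d x_n = w_n x_(n+1), so no term A u_n has to be
    formed in order to speak of them. *)
Record pdata := PData {
  pu : int -> A;
  pw : int -> A;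
  puu : forall n : int, pu n * pu n = pu n;
  puw : forall n : int, pu n * pw n = pw n;
  pwu : forall n : int, pw n * pu (n + 1) = pw n;
  pww : forall n : int, pw n * pw (n + 1) = 0;
  pu_bounded : exists N : nat, forall n : int, (N < `|n|)%N -> pu n = 0 }.

Variable p : pdata.
Implicit Types X Y : cplx A.
Local Notation u := (pu p).
Local Notation w := (pw p).

Definition cocycle X (x : fam X) : Prop :=
  forall n : int, u n *: x n = x n /\ diff X n (n + 1) (x n) = w n *: x (n + 1).

(** The component s_n of a null-homotopy starts from the term A u_(n+1). The
    equation is written in degree n + 1 rather than n, so that no term of the
    complex has to be transported along (n - 1) + 1 = n. *)
Definition coboundary X (x : fam X) : Prop :=
  exists s : fam X, forall n : int, u (n + 1) *: s n = s n /\
    x (n + 1) = diff X n (n + 1) (s n) + w (n + 1) *: s (n + 1).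

Lemma cocycle0 X : cocycle (0 : fam X).
Proof. by move=> n; rewrite !famE !scaler0 linear0. Qed.

Lemma cocycleB X (x y : fam X) : cocycle x -> cocycle y -> cocycle (x - y).
Proof.
move=> cx cy n; have [ux dx] := cx n; have [uy dy] := cy n.
by rewrite !famE linearB dx dy !scalerBr ux uy.
Qed.

Lemma coboundary0 X : coboundary (0 : fam X).
Proof. by exists 0 => n; rewrite !famE !scaler0 linear0 addr0. Qed.

Lemma coboundaryB X (x y : fam X) :
  coboundary x -> coboundary y -> coboundary (x - y).
Proof.
move=> [s Hs] [t Ht]; exists (s - t) => n.
have [us xs] := Hs n; have [ut yt] := Ht n.
by rewrite !famE xs yt linearB !scalerBr us ut; split=> //;
  rewrite opprD addrACA.
Qed.

Lemma coboundaryN X (x : fam X) : coboundary x -> coboundary (- x).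
Proof. by move=> bx; rewrite -sub0r; apply: coboundaryB => //;
  apply: coboundary0. Qed.

Lemma coboundaryD X (x y : fam X) :
  coboundary x -> coboundary y -> coboundary (x + y).
Proof. by move=> bx by_; rewrite -[y]opprK; apply: coboundaryB => //;
  apply: coboundaryN. Qed.

Lemma cocycle_hom X Y (f : hom X Y) (x : fam X) :
  cocycle x -> cocycle (famhom f x).
Proof.
move=> cx n; have [ux dx] := cx n.
by rewrite /famhom -linearZ -hom_diff ux dx linearZ.
Qed.

Lemma coboundary_hom X Y (f : hom X Y) (x : fam X) :
  coboundary x -> coboundary (famhom f x).
Proof.
move=> [s Hs]; exists (famhom f s) => n; have [us xs] := Hs n.
by rewrite /famhom -linearZ -hom_diff us xs linearD /= linearZ.
Qed.

Lemma boundary_diff X n (b : obj X n) : boundary (diff X n (n + 1) b).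
Proof.
suff H m : m = n -> exists y, diff X n (n + 1) b = diff X m (n + 1) y.
  exact: H (addrK 1 n).
by move=> ->; exists b.
Qed.

(** This is acyclicity of the mapping cone of q, in terms of elements. *)
Lemma quasi_iso_cone X Y (q : hom Y X) (qq : quasi_iso q) n
    (a : obj Y (n + 1 + 1)) (b : obj X (n + 1)) :
  diff Y (n + 1 + 1) (n + 1 + 1 + 1) a = 0 ->
  hom_fun q (n + 1 + 1) a = diff X (n + 1) (n + 1 + 1) b ->
  exists (e : obj Y (n + 1)) (s : obj X n),
    diff Y (n + 1) (n + 1 + 1) e = a /\
    hom_fun q (n + 1) e = b + diff X n (n + 1) s.
Proof.
move=> da qa.
have ba : boundary (hom_fun q (n + 1 + 1) a) by rewrite qa;
  apply: boundary_diff.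
have /boundaryS[e0 ea] := (qq _).1 a da ba.
have cc : cycle (hom_fun q (n + 1) e0 - b).
  by rewrite /cycle linearB -hom_diff -ea qa subrr.
have [y [cy /boundaryS[s es]]] := (qq _).2 _ cc.
exists (e0 - y), s; rewrite !linearB cy subr0 -ea; split=> //.
by rewrite -es addrA (addrC b) subrK.
Qed.

(** Lifting along a quasi-isomorphism q, inhomogeneous version: for a = 0 it
    lifts maps up to homotopy, and for a = x shifted by one degree it lifts
    null-homotopies. The families e and s are built downwards from a degree
    above which u vanishes. *)
Lemma quasi_iso_lift_gen X Y (q : hom Y X) (qq : quasi_iso q)
    (a : forall n : int, obj Y (n + 1)) (b : fam X) :
  (forall n : int, u n *: a n = a n) -> (forall n : int, u n *: b n = b n) ->
  (forall n : int, diff Y (n + 1) (n + 1 + 1) (a n) = - (w n *: a (n + 1))) ->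
  (forall n : int, hom_fun q (n + 1) (a n) =
     diff X n (n + 1) (b n) - w n *: b (n + 1)) ->
  exists (e : fam Y) (s : fam X),
    (forall n : int, u n *: e n = e n /\
       diff Y n (n + 1) (e n) = w n *: e (n + 1) + a n) /\
       (forall n : int, u (n + 1) *: s n = s n /\
       hom_fun q (n + 1) (e (n + 1)) =
       b (n + 1) + diff X n (n + 1) (s n) + w (n + 1) *: s (n + 1)).
Proof.
move=> ua ub da qa; have [N uN] := pu_bounded p.
have uN0 (n : int) : (N%:Z < n)%R \/ (n < - N%:Z)%R -> u n = 0.
  by move=> Hn; apply: uN; lia.
have w0 n : u n = 0 -> w n = 0 by move=> un; rewrite -puw un mul0r.
have fin (j : nat) : exists (e : fam Y) (s : fam X),
    (forall n : int, u n *: e n = e n) /\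
      (forall n : int, u (n + 1) *: s n = s n) /\
       forall n : int, (N%:Z - j%:Z <= n)%R ->
      diff Y (n + 1) (n + 1 + 1) (e (n + 1)) =
        w (n + 1) *: e (n + 1 + 1) + a (n + 1) /\
       hom_fun q (n + 1) (e (n + 1)) =
        b (n + 1) + diff X n (n + 1) (s n) + w (n + 1) *: s (n + 1).
  elim: j => [|j [e [s [ue [us H]]]]].
    exists 0, 0; do 2?split=> [n|]; rewrite ?famE ?scaler0 //.
    move=> n Hn; have u0 : u (n + 1) = 0 by apply: uN0; lia.
    by rewrite -ua -ub u0 !famE !linear0 !scaler0 !scale0r !addr0.
  have aux (V : zmodType) (x y z : V) : x + y + 0 + (z - x) = z + y.
    by rewrite addr0 addrC addrA subrK.
  pose m : int := (N%:Z - j%:Z - 1)%R.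
  have [d1 q1] : diff Y (m + 1 + 1) (m + 1 + 1 + 1) (w (m + 1) *: e (m + 1 + 1)
    + a (m + 1)) = 0 /\
       hom_fun q (m + 1 + 1) (w (m + 1) *: e (m + 1 + 1) + a (m + 1)) =
     diff X (m + 1) (m + 1 + 1) (b (m + 1) + w (m + 1) *: s (m + 1)).
    have [|de qe] := H (m + 1); first by rewrite /m; lia.
    rewrite !linearD !linearZ /= de da qe qa !scalerDr !scalerA.
    by rewrite pww !scale0r add0r subrr; split=> //; apply: aux.
  have [e1 [s1 [de1 qe1]]] := quasi_iso_cone qq d1 q1.
  exists (dfwith e (u (m + 1) *: e1)), (dfwith s (u (m + 1) *: s1)).
  split=> [n|]; last split=> [n|n Hn].
  - by case: dfwithP => [|i _]; rewrite ?scalerA ?puu.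
  - by case: dfwithP => [|i _]; rewrite ?scalerA ?puu.
  have [<-|mn] := eqVneq m n.
    rewrite !dfwith_in !dfwith_out ?linearZ /= ?de1 ?qe1; try by apply/eqP; lia.
    rewrite !scalerDr !scalerA puw ua ub; split=> //.
    exact: addrAC.
  have Hn1 : (N%:Z - j%:Z <= n)%R by move: mn; rewrite /m => /eqP; lia.
  have [de qe] := H n Hn1.
  by rewrite !dfwith_out // /m; apply/eqP; lia.
have [e [s [ue [us H]]]] := fin (N + N + 2)%N.
have e0 n : u n = 0 -> e n = 0 by move=> un; rewrite -ue un scale0r.
have s0 n : u (n + 1) = 0 -> s n = 0 by move=> un; rewrite -us un scale0r.
exists e, s; split=> n; split=> //.
  have [Hn|Hn] := lerP (N%:Z - (N + N + 2)%N%:Z) (n - 1).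
    by have [] := H _ Hn; rewrite subrK.
  have un : u n = 0 by apply: uN0; right; lia.
  by rewrite e0 // w0 // -ua un !scale0r linear0 addr0.
have [Hn|Hn] := lerP (N%:Z - (N + N + 2)%N%:Z) n; first by have [] := H _ Hn.
have un : u (n + 1) = 0 by apply: uN0; right; lia.
by rewrite e0 // s0 // w0 // -ub un !scale0r !linear0 !addr0.
Qed.

Lemma quasi_iso_lift X Y (q : hom Y X) (x : fam X) :
  quasi_iso q -> cocycle x ->
  exists2 y : fam Y, cocycle y & coboundary (famhom q y - x).
Proof.
move=> qq cx.
have [||||e [s [He Hs]]] := @quasi_iso_lift_gen X Y q qq (fun=> 0) x.
- by move=> n; rewrite scaler0.
- by move=> n; have [] := cx n.
- by move=> n; rewrite linear0 scaler0 oppr0.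
- by move=> n; have [_ ->] := cx n; rewrite linear0 subrr.
exists e => [n|]; first by have [ue ->] := He n; rewrite addr0.
exists s => n; have [us] := Hs n; rewrite !famE /famhom => ->; split=> //.
by rewrite -[X in X - _]addrA addrKl.
Qed.

End FamHom.

Section Shifted.
Variables (k : fieldType) (A : algType k) (p : pdata A).
Implicit Types X Y : cplx A.

Fact shift_pww n : - pw p (n + 1) * - pw p (n + 1 + 1) = 0.
Proof. by rewrite mulrNN pww. Qed.

Fact shift_pbounded :
  exists N : nat, forall n : int, (N < `|n|)%N -> pu p (n + 1) = 0.
Proof. by have [N H] := pu_bounded p; exists N.+1 => n Hn; apply: H; lia. Qed.

Definition pdata_shift : pdata A :=
  @PData k A (fun n => pu p (n + 1)) (fun n => - pw p (n + 1))
    (fun n => puu p (n + 1))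
    (fun n => etrans (mulrN _ _) (congr1 -%R (puw p (n + 1))))
    (fun n => etrans (mulNr _ _) (congr1 -%R (pwu p (n + 1))))
    shift_pww shift_pbounded.

(** A null-homotopy t of q y solves the lifting problem of the shifted complex
    with right-hand side y; the lift is a null-homotopy of y. *)
Lemma quasi_iso_null X Y (q : hom Y X) (y : fam Y) :
  quasi_iso q -> cocycle p y -> coboundary p (famhom q y) -> coboundary p y.
Proof.
move=> qq cy [t Ht].
have [||||e [s [He _]]] := @quasi_iso_lift_gen _ _ pdata_shift X Y q qq (fun n
  => y (n + 1)) t.
- by move=> n; have [] := cy (n + 1).
- by move=> n; have [] := Ht n.
- by move=> n; have [_ ->] := cy (n + 1); rewrite /= scaleNr opprK.
- by move=> n; have [_] := Ht n; rewrite /famhom => ->;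
    rewrite /= scaleNr opprK.
exists e => n; have [ue ->] := He n; split=> //.
by rewrite /= scaleNr [- _ + _]addrC subrK.
Qed.

End Shifted.

(** * The functors represented by complexes of projectives *)

Section Rel.
Variables (k : fieldType) (A : algType k) (p : pdata A).
Implicit Types X Y Z : cplx A.

(** The action of a formal morphism on homotopy classes of maps out of a
    complex of projectives, as a relation between representatives: an inverse
    is interpreted by lifting, which is only defined up to homotopy. *)
Fixpoint act_rel X Y (f : dmor X Y) : fam X -> fam Y -> Prop :=
  match f in dmor X Y return fam X -> fam Y -> Prop with
  | DHom X Y f => fun x y => coboundary p (famhom f x - y)
  | DInv X Y f qf => fun y x => coboundary p (famhom f x - y)
  | DComp X Y Z f g => fun x z =>
      exists y, [/\ cocycle p y, act_rel f x y & act_rel g y z]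
  end.

Lemma subACA (V : zmodType) (a b c d : V) : a - b - (c - d) = a - c - (b - d).
Proof. by rewrite !opprD !opprK addrACA. Qed.

Lemma act_relB X Y (f : dmor X Y) x y x' y' :
  act_rel f x y -> act_rel f x' y' -> act_rel f (x - x') (y - y').
Proof.
elim: f x y x' y' => {X Y} [X Y f|X Y f qf|X Y Z f IHf g IHg] x y x' y' /=.
- by move=> H H'; rewrite linearB subACA; apply: coboundaryB.
- by move=> H H'; rewrite linearB subACA; apply: coboundaryB.
case=> z [cz fz gz] [z' [cz' fz' gz']]; exists (z - z').
by split; [apply: cocycleB | apply: IHf | apply: IHg].
Qed.

Lemma act_rel_cob X Y (f : dmor X Y) x y :
  coboundary p x -> coboundary p y -> act_rel f x y.
Proof.
elim: f x y => {X Y} [X Y f|X Y f qf|X Y Z f IHf g IHg] x y bx by_ /=.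
- by apply: coboundaryB => //; apply: coboundary_hom.
- by apply: coboundaryB => //; apply: coboundary_hom.
exists 0; split; first exact: cocycle0.
  by apply: IHf => //; apply: coboundary0.
by apply: IHg => //; apply: coboundary0.
Qed.

Lemma act_rel_mod X Y (f : dmor X Y) x y x' y' :
  coboundary p (x - x') -> coboundary p (y - y') -> act_rel f x y ->
    act_rel f x' y'.
Proof.
move=> bx by_ fxy; have := act_relB fxy (act_rel_cob f bx by_).
by rewrite !opprB !subrKC.
Qed.

Lemma act_rel_total X Y (f : dmor X Y) x :
  cocycle p x -> exists2 y, cocycle p y & act_rel f x y.
Proof.
elim: f x => {X Y} [X Y f|X Y f qf|X Y Z f IHf g IHg] x cx /=.
- exists (famhom f x); first exact: cocycle_hom.
  by rewrite subrr; apply: coboundary0.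
- exact: quasi_iso_lift.
have [y cy fxy] := IHf x cx; have [z cz gyz] := IHg y cy.
by exists z => //; exists y.
Qed.

(** Together with additivity: the relation is a function on homotopy classes. *)
Lemma act_rel_null X Y (f : dmor X Y) x y :
  cocycle p x -> cocycle p y -> act_rel f x y -> coboundary p x ->
    coboundary p y.
Proof.
elim: f x y => {X Y} [X Y f|X Y f qf|X Y Z f IHf g IHg] x y cx cy /=.
- move=> fxy bx; rewrite -[y](subKr (famhom f x)).
  by apply: coboundaryB => //; apply: coboundary_hom.
- move=> fyx bx; apply: (quasi_iso_null qf cy).
  by rewrite -[famhom _ _](subrK x); apply: coboundaryD.
case=> z [cz fz gz] bx; exact: IHg cz cy gz (IHf _ _ cx cz fz bx).
Qed.

(** Each defining identity of the localization holds for the relations: the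
    two identities for inverses are existence and uniqueness of lifts. *)
Lemma act_rel_eq X Y (f g : dmor X Y) : dmor_eq f g ->
  forall x y, cocycle p x -> cocycle p y -> (act_rel f x y <-> act_rel g x y).
Proof.
have b0 X' (x : fam X') : coboundary p (x - x).
  by rewrite subrr; apply: coboundary0.
have famid X' (x : fam X') : famhom (hom_id X') x = x by [].
elim=> {X Y f g}.
- by [].
- by move=> X Y f g _ IH x y cx cy; rewrite IH.
- by move=> X Y f g h _ IH _ IH' x y cx cy; rewrite IH ?IH'.
- move=> X Y Z f f' g g' _ IH _ IH' x z cx cz /=.
  by split=> -[y [cy fy gy]]; exists y; split=> //;
    by [apply/(IH _ _ cx cy) | apply/(IH' _ _ cy cz)].
- move=> X Y Z W f g h x t cx ct /=; split.
    by move=> [y [cy fy [z [cz gz hz]]]]; exists z; split=> //; exists y.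
  by move=> [z [cz [y [cy fy gy]] hz]]; exists y; split=> //; exists z.
- move=> X Y f x y cx cy /=; rewrite famid; split.
    by move=> [z [cz xz fz]]; apply: act_rel_mod fz => //; rewrite -opprB;
      apply: coboundaryN.
  by move=> fx; exists x.
- move=> X Y f x y cx cy /=; split.
    by move=> [z [cz fz zy]]; apply: act_rel_mod fz.
  by move=> fx; exists y.
- move=> X Y f g fg x y cx cy /=.
  by have -> : famhom f x = famhom g x by apply: famP => n; apply: fg.
- move=> X Y Z f g x z cx cz /=.
  have -> : famhom (hom_comp f g) x = famhom g (famhom f x) by [].
  split=> [[y [cy fy gy]]|H]; last first.
    by exists (famhom f x); split=> //; apply: cocycle_hom.
  rewrite -[X in X - z](subrK (famhom g y)) -addrA; apply: coboundaryD => //.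
  by rewrite -linearB; apply: coboundary_hom.
- move=> X Y f qf x y cx cy /=; rewrite famid; split.
    move=> [z [cz xz yz]]; apply: (quasi_iso_null qf); first exact: cocycleB.
    rewrite linearB /= -[famhom f x](subrK z) -addrA; apply: coboundaryD => //.
    by rewrite -opprB; apply: coboundaryN.
  move=> xy; exists (famhom f x); split=> //; first exact: cocycle_hom.
  by rewrite -linearB; apply: coboundary_hom; rewrite -opprB;
    apply: coboundaryN.
move=> X Y f qf x y cx cy /=; rewrite famid; split.
  move=> [z [cz xz yz]]; rewrite -[x](subrK (famhom f z)) -addrA.
  by apply: coboundaryD => //; rewrite -opprB; apply: coboundaryN.
move=> xy; have [z cz fz] := quasi_iso_lift qf cx.
exists z; split=> //; rewrite -[famhom f z](subrK x) -addrA.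
exact: coboundaryD.
Qed.

Lemma act_rel_inv X Y (f : dmor X Y) (g : dmor Y X) x y :
  dmor_eq (DComp f g) (DHom (hom_id X)) ->
  cocycle p x -> cocycle p y -> act_rel f x y -> act_rel g y x.
Proof.
move=> fg cx cy fxy; have [x' cx' gx'] := act_rel_total g cy.
apply: act_rel_mod (gx'); first by rewrite subrr; apply: coboundary0.
have /(act_rel_eq fg cx cx') /= : act_rel (DComp f g) x x' by exists y.
by move=> H; rewrite -opprB; apply: coboundaryN.
Qed.

End Rel.

(** A map from the complex of p' to that of p is right multiplication by
    coefficients h_n; it turns maps out of the latter into maps out of the
    former by left multiplication with h_n. *)
Section Precomposition.
Variables (k : fieldType) (A : algType k) (p p' : pdata A) (h : int -> A).
Hypothesis uh : forall n, pu p' n * h n = h n.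
Hypothesis hw : forall n, h n * pw p n = pw p' n * h (n + 1).
Implicit Types X Y : cplx A.

Definition precomp X (x : fam X) : fam X := fun n => h n *: x n.

Lemma precompB X : {morph @precomp X : x y / x - y}.
Proof. by move=> x y; apply: famP => n; rewrite /precomp !famE scalerBr. Qed.

Lemma cocycle_precomp X (x : fam X) : cocycle p x -> cocycle p' (precomp x).
Proof.
move=> cx n; have [ux dx] := cx n.
by rewrite /precomp linearZ /= dx !scalerA uh hw.
Qed.

Lemma coboundary_precomp X (x : fam X) :
  coboundary p x -> coboundary p' (precomp x).
Proof.
move=> [s Hs]; exists (fun n => h (n + 1) *: s n) => n.
have [us xs] := Hs n; rewrite /precomp xs !scalerA uh; split=> //.
by rewrite linearZ scalerDr !scalerA hw.
Qed.

Lemma famhom_precomp X Y (f : hom X Y) x :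
  famhom f (precomp x) = precomp (famhom f x).
Proof. by apply: famP => n; rewrite /famhom /precomp linearZ. Qed.

Lemma act_rel_precomp X Y (f : dmor X Y) x y :
  act_rel p f x y -> act_rel p' f (precomp x) (precomp y).
Proof.
elim: f x y => {X Y} [X Y f|X Y f qf|X Y Z f IHf g IHg] x y /=.
- by rewrite famhom_precomp -precompB; apply: coboundary_precomp.
- by rewrite famhom_precomp -precompB; apply: coboundary_precomp.
move=> [z [cz fz gz]]; exists (precomp z).
by split; [apply: cocycle_precomp | apply: IHf | apply: IHg].
Qed.

End Precomposition.

(** * String complexes: indecomposability and distinctness *)

Section A2Algebra.
Variable k : fieldType.
Local Notation A := (A2 k).
Local Notation B := (A2_basis k).
Implicit Types x y : A.

Lemma A2_mul_coefE x y : x * y = [ffun r => match r with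
  | E1 => x E1 * y E1
  | E2 => x E2 * y E2
  | Alpha => x E1 * y Alpha + x Alpha * y E2
  | Beta => x E2 * y Beta + x Beta * y E1
  | BetaAlpha => x E2 * y BetaAlpha + x Beta * y Alpha + x BetaAlpha * y E2
  end] :> A.
Proof. exact: A2_mulE. Qed.

Lemma A2_triv_mul x y v : (x * y) (triv v) = x (triv v) * y (triv v).
Proof. by rewrite A2_mul_coefE ffunE; case: v. Qed.

Lemma A2_basis_coef p q : B p q = (q == p)%:R.
Proof. by rewrite ffunE. Qed.

Lemma A2_coefB x y q : (x - y) q = x q - y q.
Proof. by rewrite !ffunE. Qed.

Lemma A2_sign_mul n x q : ((-1) ^+ n * x) q = (-1) ^+ n * x q.
Proof.
rewrite -(signr_odd A n) -(signr_odd k n); case: (odd n);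
  rewrite ?expr0 ?expr1 ?mul1r // !mulN1r.
by rewrite ffunE.
Qed.

(** The corner e_v A e_v is local with nilpotent radical, spanned by beta alpha
    for v = 2 and zero for v = 1. *)
Lemma corner_nilpotent x v :
  B (triv v) * x = x -> x * B (triv v) = x -> x (triv v) = 0 -> x * x = 0.
Proof.
move=> vx xv x0; have e q : x q = (B (triv v) * x * B (triv v)) q
  by rewrite vx xv.
have xE q : q != BetaAlpha -> x q = 0.
  move=> qn; have := e q; rewrite !A2_mul_coefE !ffunE.
  by case: v {vx xv e} x0 => /=; case: q qn => //= _ x0 ->; rewrite ?x0 /=;
    ring.
by apply/ffunP=> q; rewrite A2_mul_coefE !ffunE; case: q => /=;
  rewrite !(xE E1, xE E2, xE Alpha, xE Beta) //; ring.
Qed.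

(** Comparing coefficients of p: the scalar part of a chain endomorphism does
    not change along an arrow of the string. *)
Lemma scalar_along p x y : p \notin [:: E1; E2] ->
  x * B p = B p * y -> x (triv (src p)) = y (triv (tgt p)).
Proof.
move=> np /(congr1 (fun z : A => z p)); rewrite !A2_mul_coefE !ffunE.
by case: p np => //= _; rewrite ?(mulr0, mulr1, mul0r, mul1r, addr0, add0r).
Qed.

End A2Algebra.

Section Strings.
Variable k : fieldType.
Local Notation A := (A2 k).
Local Notation B := (A2_basis k).

Definition nontrivial (l : seq bpath) := all (fun p => p \notin [:: E1; E2]) l.

Lemma pstring_nontrivial w : nontrivial (pstring w).2.
Proof.
by case: w => //= s; rewrite /nontrivial /= ?all_rcons ?all_nseq ?orbT.
Qed.

Section OneString.
Variables (v : vertex) (l : seq bpath).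
Hypothesis ok : str_ok v l.

Lemma str_term_pos j : (j <= size l)%N ->
  str_term k v l (Posz j.+1) = B (triv (nth v (v :: map tgt l) j)).
Proof. by move=> jl; rewrite /str_term (nth_map v) //= size_map. Qed.

Lemma str_map_pos j : (j < size l)%N ->
  str_map k l (Posz j.+1) = B (nth E1 l j).
Proof. by move=> jl; rewrite /str_map (nth_map E1). Qed.

Lemma str_termP n :
  str_term k v l n = 0 \/
  exists2 j, n = Posz j.+1 & (j <= size l)%N.
Proof.
case: n => [[|j]|j]; [by left| |by left].
have [jl|jl] := leqP j (size l); first by right; exists j.
by left; rewrite /str_term nth_default //= !size_map.
Qed.

Lemma str_mapP n :
  str_map k l n = 0 \/ exists2 j, n = Posz j.+1 & (j < size l)%N.
Proof.
case: n => [[|j]|j]; [by left| |by left].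
have [jl|jl] := ltnP j (size l); first by right; exists j.
by left; rewrite /str_map nth_default //= !size_map.
Qed.

Lemma str_src j : (j < size l)%N ->
  src (nth E1 l j) = nth v (v :: map tgt l) j.
Proof.
case/andP: ok => /(pathP E1) H _ jl.
have /eqP <- := H j jl; case: j jl => [|j] /= jl; first by case: (v).
by rewrite (nth_map E1) // ltnW.
Qed.

Lemma str_term_map n : str_term k v l n * str_map k l n = str_map k l n.
Proof.
have [->|[j -> jl]] := str_mapP n; first by rewrite mulr0.
rewrite str_term_pos 1?ltnW // str_map_pos // -str_src // A2_basisM.
by case: (nth _ _ _).
Qed.

Variable i : int.

Fact string_puw n : str_term k v l (n + i) * ((-1) ^+ `|i| * str_map k l (n +
  i)) =
  (-1) ^+ `|i| * str_map k l (n + i).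
Proof. by rewrite mulrA commr_sign -mulrA str_term_map. Qed.

Fact string_pwu n : (-1) ^+ `|i| * str_map k l (n + i) * str_term k v l (n + 1 +
  i) =
  (-1) ^+ `|i| * str_map k l (n + i).
Proof. by rewrite -mulrA addrAC str_map_term. Qed.

Fact string_pww n : (-1) ^+ `|i| * str_map k l (n + i) *
  ((-1) ^+ `|i| * str_map k l (n + 1 + i)) = 0.
Proof.
by rewrite -mulrA (mulrA (str_map _ _ _)) commr_sign -mulrA addrAC (str_map_map
  k ok) !mulr0.
Qed.

Fact string_bounded : exists N : nat,
  forall n : int, (N < `|n|)%N -> str_term k v l (n + i) = 0.
Proof.
have [N HN] := @str_bounded k v l; exists (N + `|i|)%N => n Hn; apply: HN; lia.
Qed.

(** In the shifted complex the differential carries the sign (-1)^i. *)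
Definition string_pdata : pdata A :=
  PData (fun n => str_term_idem k v l (n + i)) string_puw string_pwu string_pww
    string_bounded.

Definition str_shift : cplx A := shift i (str_cplx k ok).
Local Notation R := str_shift.

Definition coef n (x : obj R n) : A := lival x.

Lemma coef_linear n a (x y : obj R n) : coef (a *: x + y) = a * coef x + coef y.
Proof. exact: lival_linear. Qed.

Lemma coef0 n : coef (0 : obj R n) = 0.
Proof. exact: (raddf0 (\val : lideal (str_term k v l (n + i)) -> A^o)). Qed.

Lemma coefD n (x y : obj R n) : coef (x + y) = coef x + coef y.
Proof. by rewrite -[x]scale1r coef_linear mul1r scale1r. Qed.

Lemma coefZ n a (x : obj R n) : coef (a *: x) = a * coef x.
Proof. by rewrite -[a *: x]addr0 coef_linear coef0 addr0. Qed.

Lemma coefB n (x y : obj R n) : coef (x - y) = coef x - coef y.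
Proof. by rewrite coefD -scaleN1r coefZ mulN1r. Qed.

Lemma coef_inj n (x y : obj R n) : coef x = coef y -> x = y.
Proof. exact: val_inj. Qed.

Lemma coefP n (x : obj R n) : coef x * pu string_pdata n = coef x.
Proof. exact: livalP. Qed.

Definition Coef n (a : A) (ea : a * pu string_pdata n = a) : obj R n :=
  LIdeal (introT eqP ea).

Lemma coef_diff n (x : obj R n) :
  coef (diff R n (n + 1) x) = coef x * pw string_pdata n.
Proof.
have -> : diff R n (n + 1) x = (-1) ^+ `|i| *:
    (diff (str_cplx k ok) (n + i) (n + 1 + i) x : obj R (n + 1)) by [].
rewrite coefZ; set y := diff _ _ _ _.
have -> : coef y = coef x * str_map k l (n + i).
  by rewrite /coef /= /pcoef addrAC eqxx.
by rewrite /= !mulrA (commr_sign (coef x) `|i|).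
Qed.

Definition idfam : fam R := fun n => Coef (puu string_pdata n).

Lemma cocycle_idfam : cocycle string_pdata idfam.
Proof.
move=> n; split; apply: coef_inj.
  by rewrite coefZ /coef puu.
by rewrite coef_diff coefZ /coef /= (puw string_pdata) (pwu string_pdata).
Qed.

(** The differential has coefficients in the radical, which is the common
    kernel of the two evaluations at trivial paths. *)
Lemma pw_radical n a : nontrivial l -> pw string_pdata n (triv a) = 0.
Proof.
move=> nl; rewrite /= A2_sign_mul; have [->|[j -> jl]] := str_mapP (n + i).
  by rewrite ffunE mulr0.
rewrite str_map_pos // ffunE; have := all_nthP E1 nl j jl.
by case: a; case: (nth _ _ _); rewrite //= mulr0.
Qed.

Lemma coboundary_radical (x : fam R) n a :
  nontrivial l -> coboundary string_pdata x -> coef (x n) (triv a) = 0.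
Proof.
move=> nl [s Hs]; rewrite -(subrK 1 n); have [_ ->] := Hs (n - 1).
rewrite coefD ffunE coef_diff (coefZ (pw _ _) (s _)).
rewrite (A2_triv_mul (coef _) (pw _ _)) (A2_triv_mul (pw _ _) (coef _)).
by rewrite !pw_radical // mulr0 mul0r addr0.
Qed.

End OneString.
End Strings.

Section Points.
Variables (k : fieldType) (A : algType k) (m : int).
Implicit Types X Y : cplx A.

(** Homotopy classes of maps from A placed in degree m are the elements of
    H^m. *)
Definition point : pdata A.
Proof.
refine (@PData k A (fun n => (n == m)%:R) (fun=> 0) _ _ _ _ _) => [n|n|n|n|].
- by case: (n == m); rewrite ?mulr1 ?mulr0.
- by rewrite mulr0.
- by rewrite mul0r.
- by rewrite mul0r.
- by exists `|m|%N => n Hn; case: eqP Hn => // ->; rewrite ltnn.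
Defined.

Lemma cocycle_point X (x : obj X m) : cycle x -> cocycle point (at_deg x).
Proof.
move=> cx n /=; have [<-|mn] := eqVneq m n.
  by rewrite !at_deg_in scale0r ?eqxx scale1r.
by rewrite at_deg_out // scaler0 linear0 scale0r.
Qed.

Lemma boundary_point X (x : obj X m) :
  coboundary point (at_deg x) -> boundary x.
Proof.
move=> [s Hs]; have [_] := Hs (m - 1); rewrite scale0r addr0.
by rewrite subrK at_deg_in => ->; exists (s (m - 1)).
Qed.

End Points.

Lemma diso0_acyclic (k : fieldType) (A : algType k) (X : cplx A) :
  diso X (zero_cplx A) -> acyclic X.
Proof.
move=> [f [g [fg gf]]] n x cx; apply: boundary_point.
have cx' := cocycle_point cx.
have [y cy fy] := act_rel_total f cx'.
apply: act_rel_null cy cx' (act_rel_inv fg cx' cy fy) _.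
have -> : y = 0 by apply: famP => j; apply: (@lideal0 k A (y j)).
exact: coboundary0.
Qed.

Section Projections.
Variables (k : fieldType) (A : algType k) (X Y : cplx A).

Fact dsum_p1_is_linear n : linear
  (fun z : obj (dsum X Y) n => (z.1, 0) : obj (dsum X Y) n).
Proof.
by move=> a x y; rewrite [LHS]surjective_pairing [RHS]surjective_pairing;
  congr pair; rewrite /= scaler0 addr0.
Qed.

Fact dsum_p1_diff m n (z : obj (dsum X Y) m) :
  ((diff (dsum X Y) m n z).1, 0) = diff (dsum X Y) m n (z.1, 0).
Proof. by rewrite /= /dsum_diff_fun /= linear0. Qed.

Definition dsum_p1 : hom (dsum X Y) (dsum X Y) :=
  @Hom k A (dsum X Y) (dsum X Y) (fun n => lin_of (@dsum_p1_is_linear n))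
    (fun m n z => dsum_p1_diff n z).

Fact dsum_p2_is_linear n : linear
  (fun z : obj (dsum X Y) n => (0, z.2) : obj (dsum X Y) n).
Proof.
by move=> a x y; rewrite [LHS]surjective_pairing [RHS]surjective_pairing;
  congr pair; rewrite /= scaler0 addr0.
Qed.

Fact dsum_p2_diff m n (z : obj (dsum X Y) m) :
  (0, (diff (dsum X Y) m n z).2) = diff (dsum X Y) m n (0, z.2).
Proof. by rewrite /= /dsum_diff_fun /= linear0. Qed.

Definition dsum_p2 : hom (dsum X Y) (dsum X Y) :=
  @Hom k A (dsum X Y) (dsum X Y) (fun n => lin_of (@dsum_p2_is_linear n))
    (fun m n z => dsum_p2_diff n z).

Lemma dsum_p1D2 (x : fam (dsum X Y)) : x - famhom dsum_p1 x = famhom dsum_p2 x.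
Proof.
apply: famP => n; rewrite famD famN /famhom /= [LHS]surjective_pairing /=.
by congr pair; rewrite ?subrr ?subr0.
Qed.

End Projections.

Section StringEndo.
Variables (k : fieldType) (v : vertex) (l : seq bpath).
Hypotheses (ok : str_ok v l) (nl : nontrivial l).
Variable i : int.
Local Notation A := (A2 k).
Local Notation B := (A2_basis k).
Local Notation R := (str_shift k ok i).
Local Notation string_pdata := (string_pdata k ok i).
Local Notation idfam := (idfam k ok i).

Lemma pu_first : pu string_pdata (1 - i) = B (triv v).
Proof. by rewrite /= subrK (@str_term_pos k v l 0). Qed.

Lemma puP n : pu string_pdata n = 0 \/ exists a, pu string_pdata n = B (triv a).
Proof.
rewrite /=; have [->|[j -> jl]] := @str_termP k v l (n + i); first by left.
by right; eexists; apply: str_term_pos.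
Qed.

Lemma idfam_not_null : ~ coboundary string_pdata idfam.
Proof.
move/(coboundary_radical (1 - i) v nl); rewrite /coef /=.
by have := pu_first; rewrite /= => ->; rewrite ffunE eqxx => /eqP;
  rewrite oner_eq0.
Qed.

Lemma endo_scalar (e : fam R) : cocycle string_pdata e ->
  exists c : k, forall n a, pu string_pdata n = B (triv a) ->
    coef (e n) (triv a) = c.
Proof.
move=> ce; exists (coef (e (1 - i)) (triv v)) => n a.
have H j : forall n : int, n + i = Posz j.+1 -> (j <= size l)%N ->
    coef (e n) (triv (nth v (v :: map tgt l) j)) = coef (e (1 - i)) (triv v).
  elim: j => [|j IH] {}n nj jl.
    by have -> : n = 1 - i by rewrite -[1]nj addrK.
  rewrite -(subrK 1 n); set n1 := n - 1.
  have n1j : n1 + i = Posz j.+1 by rewrite /n1; lia.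
  rewrite -(IH _ n1j (ltnW jl)) -(str_src ok jl).
  have [_ /(congr1 (@coef _ _ _ ok i _))] := ce n1.
  rewrite coef_diff (coefZ (pw _ _) (e _)) /= n1j str_map_pos // mulrA
    commr_sign -!mulrA.
  move/(can_inj (signrMK _)) => E.
  rewrite (scalar_along _ E) ?(all_nthP E1 nl) //=.
  by rewrite (nth_map E1).
move=> una; have {}una : str_term k v l (n + i) = B (triv a) by [].
have [u0|[j nj jl]] := @str_termP k v l (n + i).
  move: una; rewrite u0 => /ffunP/(_ (triv a))/eqP.
  by rewrite !ffunE eqxx eq_sym oner_eq0.
rewrite -(H j n nj jl); congr (coef _ (triv _)).
move: una; rewrite nj str_term_pos // => /ffunP/(_ (triv a))/eqP.
rewrite !ffunE eqxx; case E: (triv a == _); last by rewrite eq_sym oner_eq0.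
by move=> _; move: E; case: a; case: (nth _ _ _).
Qed.

(** Composition of endomorphisms, the left factor being read off its
    coefficients. *)
Local Notation "e ** x" := (precomp (fun n => coef (e n)) x) (at level 40).

Lemma precompE (h : int -> A) (x : fam R) n : precomp h x n = h n *: x n.
Proof. by []. Qed.

Lemma cocycle_coef p (e : fam R) : cocycle p e ->
  (forall n, pu p n * coef (e n) = coef (e n)) /\
  (forall n, coef (e n) * pw string_pdata n = pw p n * coef (e (n + 1))).
Proof.
move=> ce; split=> n; have [ue de] := ce n; first by rewrite -coefZ ue.
by rewrite -coef_diff de coefZ.
Qed.

Lemma precomp_idfam (x : fam R) : x ** idfam = x.
Proof. by apply: famP => n; apply: coef_inj; rewrite coefZ /coef /= livalP. Qed.

(** A homotopy idempotent without scalar part has square zero. *)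
Lemma endo_null (e : fam R) : cocycle string_pdata e ->
  (forall n a, pu string_pdata n = B (triv a) -> coef (e n) (triv a) = 0) ->
  coboundary string_pdata (e ** e - e) -> coboundary string_pdata e.
Proof.
move=> ce e0; have -> : e ** e = 0; last first.
  by rewrite sub0r => /coboundaryN; rewrite opprK.
apply: famP => n; apply: coef_inj; rewrite coefZ fam0 coef0.
have [/(_ n) ue _] := cocycle_coef ce; have eu := coefP (e n).
have [u0|[a ua]] := puP n; first by rewrite -[X in _ * X]eu u0 !mulr0.
by apply: (@corner_nilpotent _ _ a); rewrite -?ua ?ue ?eu // e0.
Qed.

(** The endomorphism ring of a string complex is local: the scalar c of an
    idempotent satisfies c^2 = c, and if c = 0 the idempotent is nilpotent. *)
Lemma endo_idempotent (e : fam R) : cocycle string_pdata e ->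
  coboundary string_pdata (e ** e - e) ->
  coboundary string_pdata e \/ coboundary string_pdata (idfam - e).
Proof.
move=> ce ee; have [c ec] := endo_scalar ce.
have : c * c - c = 0.
  rewrite -(ec _ _ pu_first); have := coboundary_radical (1 - i) v nl ee.
  by rewrite !famE precompE coefB coefZ A2_coefB A2_triv_mul.
move/eqP; rewrite -{3}[c]mulr1 -mulrBr mulf_eq0 subr_eq0 => /orP[|] /eqP c01.
  by left; apply: endo_null => // n a una; rewrite ec.
right; have cf := cocycleB (cocycle_idfam k ok i) ce.
apply: endo_null => // [n a una|].
  rewrite coefB A2_coefB (ec _ _ una) c01.
  by rewrite /coef -[lival _]/(pu string_pdata n) una A2_basis_coef eqxx subrr.
suff -> : (idfam - e) ** (idfam - e) - (idfam - e) = e ** e - e by [].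
apply: famP => n; apply: coef_inj;
  rewrite !famE !precompE !famE !coefB !coefZ !coefB.
have [/(_ n) ue _] := cocycle_coef ce; have eu := coefP (e n).
have -> : coef (idfam n) = pu string_pdata n by [].
by rewrite mulrBl !mulrBr ue eu puu [X in X - _]addrC opprB addrK.
Qed.

Section Splitting.
Variables (T : cplx A) (f : dmor R T) (g : dmor T R).
Hypothesis fg : dmor_eq (DComp f g) (DHom (hom_id R)).
Hypothesis gf : dmor_eq (DComp g f) (DHom (hom_id T)).
Variable x : fam T.
Hypothesis cx : cocycle string_pdata x.
Hypothesis fx : act_rel string_pdata f idfam x.

(** By functoriality z is the composite of x with the preimage of z under the
    isomorphism. *)
Lemma factor_through p (z : fam T) : cocycle p z ->
  exists e : fam R, [/\ cocycle p e, act_rel p g z e,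
    coboundary p (e ** x - z) &
    forall U (y : fam U), cocycle string_pdata y -> cocycle p (e ** y)].
Proof.
move=> cz; have [e ce ge] := act_rel_total g cz; exists e.
have [uh hw] := cocycle_coef ce.
split=> // [|U y]; last exact: cocycle_precomp.
have := act_relB (act_rel_precomp uh hw fx) (act_rel_inv gf cz ce ge).
rewrite precomp_idfam subrr => H.
apply: (act_rel_null _ _ H); [exact: cocycle0 | | exact: coboundary0].
by apply: cocycleB => //; apply: cocycle_precomp.
Qed.

(** If q kills x up to homotopy then it kills all of cohomology, which is
    computed by maps out of A. *)
Lemma split_null (q : hom T T) n (t : obj T n) :
  coboundary string_pdata (famhom q x) -> cycle t -> hom_fun q n t = t ->
    boundary t.
Proof.
move=> qx ct qt; apply: boundary_point; have ct' := cocycle_point ct.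
have [e [ce _ bz _]] := factor_through ct'; have [uh hw] := cocycle_coef ce.
have -> : at_deg t = famhom q (at_deg t).
  apply: famP => m; rewrite /famhom; have [<-|nm] := eqVneq n m.
    by rewrite !at_deg_in qt.
  by rewrite !at_deg_out ?linear0.
rewrite -[famhom q _](subKr (famhom q (e ** x))) -linearB /=.
apply: coboundaryB; last exact: coboundary_hom.
rewrite famhom_precomp; apply: (@coboundary_precomp _ _ string_pdata _ _ uh hw);
  exact: qx.
Qed.

(** Transported along the isomorphism, q becomes a homotopy idempotent of the
    string complex. *)
Lemma split_idempotent (q : hom T T) :
  (forall z : fam T, famhom q (famhom q z) = famhom q z) ->
  coboundary string_pdata (famhom q x) \/ coboundary string_pdata (x - famhom q
    x).
Proof.
move=> qq; have cqx := cocycle_hom q cx.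
have [e [ce ge bz ecc]] := factor_through cqx.
have [uh hw] := cocycle_coef ce; have fe := act_rel_inv gf cqx ce ge.
have : coboundary string_pdata (e ** e - e).
  have := act_relB (act_rel_precomp uh hw fe) fe.
  set y := _ - famhom q x => fy.
  have cee : cocycle string_pdata (e ** e - e) by apply: cocycleB => //;
    apply: ecc.
  have cy : cocycle string_pdata y by apply: cocycleB => //; apply: ecc.
  apply: act_rel_null cy cee (act_rel_inv fg cee cy fy) _.
  have -> : y = famhom q (e ** x - famhom q x).
    by rewrite linearB /= qq famhom_precomp.
  exact: coboundary_hom.
case/(endo_idempotent ce) => be; [left|right].
  exact: act_rel_null ce cqx fe be.
apply: act_rel_null (act_relB fx fe) be; apply: cocycleB => //.
exact: cocycle_idfam.
Qed.

End Splitting.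

Theorem str_shift_indecomposable : indecomposable R.
Proof.
split=> [[f [g [fg gf]]]|Y Z [f [g [fg gf]]]].
  apply: idfam_not_null; have ci := cocycle_idfam k ok i.
  have [y cy fy] := act_rel_total f ci.
  apply: act_rel_null cy ci (act_rel_inv fg ci cy fy) _.
  have -> : y = 0 by apply: famP => j; apply: (@lideal0 k A (y j)).
  exact: coboundary0.
have [x cx fx] := act_rel_total f (cocycle_idfam k ok i).
have [|bx|bx] := split_idempotent fg gf cx fx (q := dsum_p1 Y Z).
- by [].
- left; apply: acyclic_diso0 => n y cy.
  have ct : cycle ((y, 0) : obj (dsum Y Z) n).
    by rewrite /cycle /= /dsum_diff_fun /= cy linear0.
  by have [|[z z'] [-> _]] := split_null gf cx fx bx ct _; last exists z.
right; apply: acyclic_diso0 => n y cy.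
have ct : cycle ((0, y) : obj (dsum Y Z) n).
  by rewrite /cycle /= /dsum_diff_fun /= cy linear0.
rewrite dsum_p1D2 in bx.
by have [|[z z'] [_ ->]] := split_null gf cx fx bx ct _; last exists z'.
Qed.

End StringEndo.

Section StringTerms.
Variables (k : fieldType) (v v' : vertex) (l l' : seq bpath).
Hypotheses (ok : str_ok v l) (ok' : str_ok v' l') (nl : nontrivial l).
Variables i i' : int.
Local Notation A := (A2 k).
Local Notation B := (A2_basis k).

(** Modulo the radical, the composite of an isomorphism with its inverse is
    the identity on each term, so isomorphic string complexes have isomorphic
    terms. *)
Lemma diso_terms n a : diso (str_shift k ok i) (str_shift k ok' i') ->
  pu (string_pdata k ok i) n = B (triv a) ->
    pu (string_pdata k ok' i') n = B (triv a).
Proof.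
move=> [f [g [fg gf]]] una.
have ci := cocycle_idfam k ok i; have ci' := cocycle_idfam k ok' i'.
have [x cx fx] := act_rel_total f ci; have [y cy gy] := act_rel_total g ci'.
have [uh hw] := cocycle_coef cx.
have := act_relB (act_rel_precomp uh hw gy) (act_rel_inv fg ci cx fx).
rewrite precomp_idfam subrr => H.
have /(coboundary_radical n a nl) :=
  act_rel_null (cocycle0 _ _)
    (cocycleB (cocycle_precomp uh hw cy) ci) H (coboundary0 _ _).
rewrite !famE precompE coefB coefZ A2_coefB A2_triv_mul.
have -> : coef (idfam k ok i n) = B (triv a) by rewrite -una.
rewrite A2_basis_coef eqxx => /eqP; rewrite subr_eq0 => xy.
have x0 : coef (x n) (triv a) != 0.
  by apply: contraTneq xy => ->; rewrite mul0r eq_sym oner_eq0.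
move: x0; rewrite -(coefP (x n)) A2_triv_mul.
have [->|[b ->]] := puP k ok' i' n; first by rewrite ffunE mulr0 eqxx.
rewrite A2_basis_coef; have [->//|_] := eqVneq (triv a) (triv b).
by rewrite mulr0 eqxx.
Qed.

End StringTerms.

Lemma nontrivial_arrow p q : p \notin [:: E1; E2] -> q \notin [:: E1; E2] ->
  src p = src q -> tgt p = tgt q -> p = q.
Proof. by case: p; case: q. Qed.

(** At most one nontrivial path joins two given vertices, so a string is
    determined by the vertices that it visits. *)
Lemma string_determined v l l' : str_ok v l -> str_ok v l' ->
  nontrivial l -> nontrivial l' -> map tgt l = map tgt l' -> l = l'.
Proof.
move=> /andP[+ _] /andP[+ _].
elim: l l' (triv v) => [|p l IH] [|q l'] r //= /andP[rp pl] /andP[rq ql].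
move=> /andP[np nl] /andP[nq nl'] [pq ll].
have e : p = q by apply: nontrivial_arrow => //; rewrite -(eqP rp) (eqP rq).
by rewrite -e in ql *; rewrite (IH l' p).
Qed.

Theorem diso_strings (k : fieldType) v v' l l' (ok : str_ok v l)
    (ok' : str_ok v' l') i i' :
  nontrivial l -> nontrivial l' ->
  diso (str_shift k ok i) (str_shift k ok' i') -> (i, (v, l)) = (i', (v', l')).
Proof.
move=> nl nl' iso.
have uE n a := diso_terms nl (n := n) (a := a) iso.
have uE' n a := diso_terms nl' (n := n) (a := a) (diso_sym iso).
have shift_le w w' m m' (ok1 : str_ok w m) (ok2 : str_ok w' m') j j' :
    (forall n a, pu (string_pdata k ok1 j) n = A2_basis k (triv a) ->
       pu (string_pdata k ok2 j') n = A2_basis k (triv a)) -> (j <= j')%R.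
  move=> H; have := H _ _ (pu_first k ok1 j).
  have [u0|[c]] := @str_termP k w' m' (1 - j + j').
    rewrite /= u0 => /ffunP/(_ (triv w))/eqP.
    by rewrite !ffunE eqxx eq_sym oner_eq0.
  by lia.
have ii : i = i' by apply/eqP; rewrite eq_le (shift_le _ _ _ _ _ _ _ _ uE)
    (shift_le _ _ _ _ _ _ _ _ uE').
subst i'.
have size_le w w' m m' (ok1 : str_ok w m) (ok2 : str_ok w' m') :
    (forall n a, pu (string_pdata k ok1 i) n = A2_basis k (triv a) ->
       pu (string_pdata k ok2 i) n = A2_basis k (triv a)) ->
    forall j, (j <= size m)%N -> (j <= size m')%N /\
      nth w (w :: map tgt m) j = nth w' (w' :: map tgt m') j.
  move=> H j jm; have := H (Posz j.+1 - i) (nth w (w :: map tgt m) j).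
  rewrite -[pu _ _]/(str_term k w m (Posz j.+1 - i + i)).
  rewrite -[pu (string_pdata k ok2 i) _]/(str_term k w' m' (Posz j.+1 - i + i)).
  rewrite subrK str_term_pos // => /(_ erefl).
  have [jm'|jm'] := leqP j (size m'); last first.
    have -> : str_term k w' m' (Posz j.+1) = 0.
      by rewrite /str_term nth_default //= !size_map.
    move=> /ffunP/(_ (triv (nth w (w :: map tgt m) j)))/eqP.
    by rewrite !ffunE eqxx eq_sym oner_eq0.
  rewrite str_term_pos //.
  move=> /ffunP/(_ (triv (nth w' (w' :: map tgt m') j)))/eqP;
    rewrite !ffunE eqxx.
  case E: (triv _ == _); last by rewrite oner_eq0.
  by move=> _; split=> //; move: E; case: (nth w' _ _); case: (nth w _ _).
have H1 := size_le _ _ _ _ _ _ uE; have H2 := size_le _ _ _ _ _ _ uE'.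
have sl : size l = size l'.
  by apply/anti_leq; rewrite (proj1 (H1 _ (leqnn _))) (proj1 (H2 _ (leqnn _))).
have vv : v = v' by exact: (proj2 (H1 0%N isT)).
have ok1 : str_ok v l' by rewrite vv.
rewrite -vv; congr (_, (_, _)); apply: (string_determined ok ok1 nl nl').
apply: (@eq_from_nth _ v); first by rewrite !size_map.
by move=> j; rewrite size_map => jl; have := proj2 (H1 j.+1 jl); rewrite -vv.
Qed.

(** * Splitting off a string complex *)

(** Serre duality supplies maps out of X: a functional on the space of maps
    from a complex Z of projectives to X, vanishing on null-homotopic maps, is a
    map from X to the complex of injectives obtained from Z by replacing A u
    with the dual D(u A). *)

Section Functional.
Variables (k : fieldType) (A : algType k) (V : lmodType A).
Local Open Scope classical_set_scope.

Definition subspace (S : set V) :=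
  forall (c : k) x y, S x -> S y -> S (c%:A *: x + y).

(** A maximal subspace avoiding z is a hyperplane. *)
Lemma separating_functional (B : set V) (z : V) :
  B 0 -> subspace B -> ~ B z ->
  exists lam : V -> k,
    [/\ forall (c : k) x y, lam (c%:A *: x + y) = c * lam x + lam y,
        forall x, B x -> lam x = 0 & lam z = 1].
Proof.
move=> B0 subB Bz.
(* Adding B to each set makes the union of the empty chain a subspace. *)
pose P (S : set V) := subspace (S `|` B) /\ ~ (S `|` B) z.
have [|M0 [[subM Mz] maxM]] := @Zorn_bigcup V P.
  move=> F FP totF.
  have Pset0 : P set0 by rewrite /P set0U.
  have up x y : (\bigcup_(S in F) S `|` B) x -> (\bigcup_(S in F) S `|` B) y ->
      exists S, [/\ F S \/ S = set0, (S `|` B) x & (S `|` B) y].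
    move=> [[S FS Sx]|Bx] [[S' FS' Sy]|By].
    - have [SS|SS] := totF S S' FS FS'.
        by exists S'; split; [left | left; apply: SS | left].
      by exists S; split; [left | left | left; apply: SS].
    - by exists S; split; [left | left | right].
    - by exists S'; split; [left | right | left].
    - by exists set0; split; [right | right | right].
  have PF S : F S \/ S = set0 -> P S by case=> [/FP|->].
  have sub S : F S \/ S = set0 -> S `|` B `<=` \bigcup_(S in F) S `|` B.
    by case=> [FS|->] x [Sx|Bx]; by [left; exists S | right | case: Sx].
  split=> [c x y Hx Hy|Hz].
    have [S [FS Sx Sy]] := up x y Hx Hy.
    by apply: (sub S FS); apply: (PF S FS).1.
  by have [S [FS Sz _]] := up z z Hz Hz; apply: (PF S FS).2.
set M := M0 `|` B in subM Mz.
have M0_ : M 0 by right.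
have MZ (c : k) x : M x -> M (c%:A *: x).
  by move=> Mx; rewrite -[_ *: _]addr0; apply: subM.
have MD x y : M x -> M y -> M (x + y).
  by move=> Mx My; have := subM 1 _ _ Mx My; rewrite !scale1r.
have kA (c d : k) (x : V) : c%:A *: (d%:A *: x) = (c * d)%:A *: x.
  by rewrite scalerA -scalerAl mul1r scalerA.
have dec x : exists c : k, M (x - c%:A *: z).
  have [Mx|Mx] := EM (M x); first by exists 0; rewrite !scale0r subr0.
  pose M' : set V := [set y | exists m (a : k), M m /\ y = m + a%:A *: x].
  have MM' : M `<=` M'.
    by move=> m Mm; exists m, 0; rewrite !scale0r addr0.
  have M'B : M' `|` B = M'.
    by apply/seteqP; split=> [y [//|By]|y]; [apply: MM'; right | left].
  have : ~ P M'.
    apply: maxM; split=> [y M0y|H]; first by apply: MM'; left.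
    apply: Mx; left; apply: H; exists 0, 1; split=> //.
    by rewrite !scale1r add0r.
  rewrite /P M'B => nP.
  have [m [a [Mm ez]]] : M' z.
    apply: contrapT => M'z; apply: nP;
      split=> // c y y' [m [a [Mm ->]]] [m' [a' [Mm' ->]]].
    exists (c%:A *: m + m'), (c * a + a'); split; first exact: subM.
    by rewrite scalerDr !scalerDl kA addrACA.
  have a0 : a != 0.
    by apply/eqP => a0; apply: Mz; rewrite ez a0 !scale0r addr0.
  exists a^-1; rewrite ez scalerDr kA mulVf // !scale1r opprD addrCA subrr
    addr0.
  by rewrite -scaleNr -scaleNr; apply: MZ.
have uniq x c c' : M (x - c%:A *: z) -> M (x - c'%:A *: z) -> c = c'.
  move=> Mc Mc'; apply/eqP; rewrite -subr_eq0; apply: contrapT => /negP cc'.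
  apply: Mz; have := subM (-1) _ _ Mc Mc'.
  have -> : (-1)%:A *: (x - c%:A *: z) + (x - c'%:A *: z) = (c - c')%:A *: z.
    by rewrite scaleN1r scaleN1r opprB addrA subrK scalerBl scalerBl.
  move=> /(MZ (c - c')^-1); by rewrite kA mulVf ?scale1r ?scale1r.
have [lam Hlam] := boolp.choice dec.
exists lam; split=> [c x y|x Bx|].
- apply: (uniq (c%:A *: x + y)) => //; have := subM c _ _ (Hlam x) (Hlam y).
  by rewrite scalerBr addrACA -opprD kA -!scalerDl.
- by apply: (uniq x) => //; rewrite !scale0r subr0; right.
- by apply: (uniq z) => //; rewrite !scale1r subrr.
Qed.

End Functional.

Section Coinduced.
Variable k : fieldType.
Local Notation A := (A2 k).
Local Notation B := (A2_basis k).

(** The k-dual of A_2, on which a acts by (a phi)(r) = phi (r a). *)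
Definition dualA : Type := {ffun bpath -> k}.
HB.instance Definition _ := GRing.Zmodule.copy dualA {ffun bpath -> k^o}.
Implicit Types (phi psi : dualA) (a b u : A).

Definition ev phi a : k := \sum_p a p * phi p.

Definition coscale a phi : dualA := [ffun r => ev phi (B r * a)].

Definition coact u phi : dualA := [ffun r => ev phi (u * B r)].

Lemma evE phi a : ev phi a = a E1 * phi E1 + a E2 * phi E2 +
  a Alpha * phi Alpha + a Beta * phi Beta + a BetaAlpha * phi BetaAlpha.
Proof. exact: sum_bpath. Qed.

Lemma ev_basis phi r : ev phi (B r) = phi r.
Proof. by rewrite evE !ffunE; case: r => /=; ring. Qed.

Lemma ev_coscale a phi b : ev (coscale a phi) b = ev phi (b * a).
Proof.
by rewrite !evE (A2_mul_coefE b a) !ffunE !evE !A2_mul_coefE !ffunE /=; ring.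
Qed.

Lemma ev_coact u phi b : ev (coact u phi) b = ev phi (u * b).
Proof.
by rewrite !evE (A2_mul_coefE u b) !ffunE !evE !A2_mul_coefE !ffunE /=; ring.
Qed.

Lemma dualAP phi psi : (forall a, ev phi a = ev psi a) -> phi = psi.
Proof. by move=> H; apply/ffunP => r; rewrite -!ev_basis. Qed.

Lemma evD phi psi a : ev (phi + psi) a = ev phi a + ev psi a.
Proof. by rewrite !evE !ffunE; ring. Qed.

Lemma evN phi a : ev (- phi) a = - ev phi a.
Proof. by rewrite !evE !ffunE; ring. Qed.

Lemma evDr phi a b : ev phi (a + b) = ev phi a + ev phi b.
Proof. by rewrite !evE !ffunE; ring. Qed.

Lemma ev_scaleA phi (c : k) a : ev phi (c%:A * a) = c * ev phi a.
Proof.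
rewrite -scalerAl mul1r !evE; have H q : (c *: a) q = c * a q by rewrite ffunE.
by rewrite !H; ring.
Qed.

Fact coscaleA a b phi : coscale a (coscale b phi) = coscale (a * b) phi.
Proof. by apply: dualAP => r; rewrite !ev_coscale mulrA. Qed.
Fact coscale1 : left_id 1 coscale.
Proof. by move=> phi; apply: dualAP => r; rewrite ev_coscale mulr1. Qed.
Fact coscaleDr : right_distributive coscale +%R.
Proof.
by move=> a phi psi; apply: dualAP => r; rewrite evD !ev_coscale evD.
Qed.
Fact coscaleDl phi : {morph coscale^~ phi : a b / a + b}.
Proof.
by move=> a b; apply: dualAP => r; rewrite evD !ev_coscale mulrDr evDr.
Qed.
HB.instance Definition _ := GRing.Zmodule_isLmodule.Build A dualA
  coscaleA coscale1 coscaleDr coscaleDl.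

Lemma evZ a phi b : ev (a *: phi) b = ev phi (b * a).
Proof. exact: ev_coscale. Qed.

Lemma coact_linear u : linear (coact u).
Proof.
by move=> a phi psi; apply: dualAP => r;
  rewrite ev_coact !evD !evZ !ev_coact mulrA.
Qed.
HB.instance Definition _ u :=
  GRing.isLinear.Build A dualA dualA *:%R (coact u) (coact_linear u).

Lemma coactr0 u : coact u 0 = 0.
Proof. exact: raddf0. Qed.
Lemma coactD u phi psi : coact u (phi + psi) = coact u phi + coact u psi.
Proof. exact: raddfD. Qed.
Lemma coactB u phi psi : coact u (phi - psi) = coact u phi - coact u psi.
Proof. exact: raddfB. Qed.
Lemma coactN u phi : coact u (- phi) = - coact u phi.
Proof. exact: raddfN. Qed.
Lemma coactZ u a phi : coact u (a *: phi) = a *: coact u phi.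
Proof. exact: linearZ. Qed.

Lemma coact_opp u phi : coact (- u) phi = - coact u phi.
Proof.
apply: dualAP => r; rewrite evN !ev_coact mulNr !evE.
by rewrite [(- (u * r)) _]ffunE ![(- (u * r)) _]ffunE; ring.
Qed.

Lemma coact_comp u v phi : coact u (coact v phi) = coact (v * u) phi.
Proof. by apply: dualAP => r; rewrite !ev_coact mulrA. Qed.

Lemma coact0 phi : coact 0 phi = 0.
Proof. by apply: dualAP => r; rewrite ev_coact mul0r !evE !ffunE; ring. Qed.

(** For u idempotent, the dual of the right ideal u A: an injective module. *)
Record coideal u := Coideal { coval : dualA; _ : coact u coval == coval }.

HB.instance Definition _ u := [isSub for @coval u].
HB.instance Definition _ u := [Choice of coideal u by <:].

Fact coideal_submod u : submod_closed (fun phi : dualA => coact u phi == phi).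
Proof.
split=> [|a phi psi /eqP uphi /eqP upsi]; first by rewrite unfold_in linear0.
by rewrite unfold_in linearP /= uphi upsi.
Qed.
HB.instance Definition _ u :=
  GRing.SubChoice_isSubLmodule.Build A dualA (fun phi : dualA =>
    coact u phi == phi)
    (coideal u) (coideal_submod u).

Lemma covalP u (phi : coideal u) : coact u (coval phi) = coval phi.
Proof. exact/eqP/(valP phi). Qed.

Lemma coval_linear u a (phi psi : coideal u) :
  coval (a *: phi + psi) = a *: coval phi + coval psi.
Proof. exact: (linearP (\val : coideal u -> dualA)). Qed.

Lemma coval0 u : coval (0 : coideal u) = 0.
Proof. exact: (raddf0 (\val : coideal u -> dualA)). Qed.

Lemma covalD u : {morph @coval u : x y / x + y}.
Proof. exact: (raddfD (\val : coideal u -> dualA)). Qed.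

Lemma coval_inj u : injective (@coval u).
Proof. exact: val_inj. Qed.

Lemma covalZ u a (phi : coideal u) : coval (a *: phi) = a *: coval phi.
Proof. by rewrite -[a *: phi]addr0 coval_linear coval0 addr0. Qed.

Lemma evkZ (c : k) phi b : ev (c%:A *: phi) b = c * ev phi b.
Proof. by rewrite evZ -scalerAr mulr1 -ev_scaleA -scalerAl mul1r. Qed.

Lemma coideal_findim u : u * u = u -> findim (coideal u).
Proof.
move=> uu; have H phi : coact u (coact u phi) == coact u phi.
  by rewrite coact_comp uu.
pose d i : dualA := [ffun r => (r == bpath_decode i)%:R].
exists 5%N, (fun i : 'I_5 => Coideal (H (d i))) => phi.
exists (fun i : 'I_5 => coval phi (bpath_decode i)); apply: coval_inj.
rewrite (big_morph (@coval u) (@covalD u) (@coval0 u)).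
have E : coval phi = \sum_(i < 5) (coval phi (bpath_decode i))%:A *: d i.
  apply: dualAP => a; rewrite !big_ord_recl big_ord0 addr0 !evD !evkZ !evE.
  by rewrite !ffunE /=; ring.
rewrite -[LHS]covalP [in LHS]E linear_sum; apply: eq_bigr => i _.
by rewrite linearZ covalZ.
Qed.

End Coinduced.

Lemma findim_pair (k : fieldType) (A : algType k) (U V : lmodType A) :
  findim U -> findim V -> findim (U * V)%type.
Proof.
move=> [p [b Hb]] [r [c Hc]].
exists (p + r)%N, (fun i => match split i with
  inl j => (b j, 0) | inr j => (0, c j) end) => -[x x'].
have [s ->] := Hb x; have [t ->] := Hc x'.
exists (fun i => match split i with inl j => s j | inr j => t j end).
have sl i : split (lshift r i) = inl i := unsplitK (inl i : 'I_p + 'I_r).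
have sr i : split (rshift p i) = inr i := unsplitK (inr i : 'I_p + 'I_r).
rewrite big_split_ord /=.
have -> : \sum_(i < p) (match split (lshift r i) with inl j => s j | inr j =>
  t j end)%:A
    *: match split (lshift r i) with inl j => (b j, 0) | inr j => (0, c j) end =
    (\sum_(i < p) (s i)%:A *: b i, 0) :> U * V.
  rewrite [LHS]surjective_pairing !raddf_sum; congr pair.
    by apply: eq_bigr => i _; rewrite sl.
  by rewrite big1 // => i _; rewrite sl /= scaler0.
have -> : \sum_(i < r) (match split (rshift p i) with inl j => s j | inr j =>
  t j end)%:A
    *: match split (rshift p i) with inl j => (b j, 0) | inr j => (0, c j) end =
    (0, \sum_(i < r) (t i)%:A *: c i) :> U * V.
  rewrite [LHS]surjective_pairing !raddf_sum; congr pair.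
    by rewrite big1 // => i _; rewrite sr /= scaler0.
  by apply: eq_bigr => i _; rewrite sr.
by rewrite [RHS]surjective_pairing; congr pair; rewrite /= ?addr0 ?add0r.
Qed.

Section Extension.
Variables (k : fieldType) (X : cplx (A2 k)) (q : pdata (A2 k)).
Local Notation A := (A2 k).
Local Notation B := (A2_basis k).
Local Notation z := (pu q).
Local Notation y := (pw q).

Variable lam : forall n, obj X n -> k.
Hypothesis lam_linear : forall n (c : k) (s t : obj X n),
  lam (c%:A *: s + t) = c * lam s + lam t.
Hypothesis lam_coboundary : forall n (s : obj X n), z (n + 1) *: s = s ->
  lam (diff X n (n + 1) s) + lam (y n *: s) = 0.

(** The map to D(A) defined by a functional; lam_coboundary says that these
    maps commute with the differentials up to sign. *)
Definition dualize n (x : obj X n) : dualA k := [ffun r => lam (B r *: x)].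

Lemma lamD n (s t : obj X n) : lam (s + t) = lam s + lam t.
Proof. by have := lam_linear 1 s t; rewrite !scale1r mul1r. Qed.

Lemma lam0 n : lam (0 : obj X n) = 0.
Proof. by apply: (addIr (lam (0 : obj X n))); rewrite -lamD !add0r. Qed.

Lemma lamZ n (c : k) (s : obj X n) : lam (c%:A *: s) = c * lam s.
Proof. by rewrite -[_ *: s]addr0 lam_linear lam0 addr0. Qed.

Lemma ev_dualize n (x : obj X n) a : ev (dualize x) a = lam (a *: x).
Proof.
have kA p : a p *: B p = (a p)%:A * B p by rewrite -scalerAl mul1r.
rewrite [in RHS](A2_basis_sum a) sum_bpath !scalerDl !lamD !kA -!scalerA !lamZ.
by rewrite evE !ffunE.
Qed.

Lemma dualize_linear n : linear (@dualize n).
Proof.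
by move=> a s t; apply: dualAP => r;
  rewrite evD evZ !ev_dualize scalerDr lamD scalerA.
Qed.
HB.instance Definition _ n :=
  GRing.isLinear.Build A (obj X n) (dualA k) *:%R (@dualize n) (@dualize_linear
    n).

Lemma dualize0 n : dualize (0 : obj X n) = 0.
Proof. exact: raddf0. Qed.
Lemma dualizeB n (s t : obj X n) : dualize (s - t) = dualize s - dualize t.
Proof. exact: raddfB. Qed.
Lemma dualizeZ n a (s : obj X n) : dualize (a *: s) = a *: dualize s.
Proof. exact: linearZ. Qed.

Lemma dualize_diff n (x : obj X n) :
  coact (z (n + 1)) (dualize (diff X n (n + 1) x)) = - coact (y n) (dualize x).
Proof.
apply: dualAP => r; rewrite evN !ev_coact !ev_dualize -linearZ.
have zs : z (n + 1) *: (z (n + 1) * r *: x) = z (n + 1) * r *: x.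
  by rewrite scalerA mulrA puu.
have /eqP := lam_coboundary zs; rewrite addr_eq0 => /eqP ->.
by rewrite scalerA mulrA pwu.
Qed.

(** The homotopy fibre of the map from X to the complex with terms D(z_n A):
    the term in degree n is X_n plus D(z_(n-1) A). As for the differentials of a
    complex, the coefficients are indexed by all pairs of degrees and vanish
    unless the second is the successor of the first. *)
Definition Jcoef m n : A := if m + 1 == n then y (m - 1) else 0.
Definition gcoef m n : A := if m + 1 == n then z m else 0.

Fact Jcoef_mul m n : Jcoef m n * z (n - 1) = Jcoef m n.
Proof.
rewrite /Jcoef; case: eqP => [<-|_]; last by rewrite mul0r.
by rewrite addrK -[X in z X](subrK 1 m) pwu.
Qed.

Fact gcoef_mul m n : gcoef m n * z (n - 1) = gcoef m n.
Proof.
by rewrite /gcoef; case: eqP => [<-|_]; rewrite ?mul0r // addrK puu.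
Qed.

Definition ext_val m n (x : obj X m) (phi : coideal (z (m - 1))) : dualA k :=
  coact (gcoef m n) (dualize x) + coact (Jcoef m n) (coval phi).

Fact ext_subproof m n (x : obj X m) (phi : coideal (z (m - 1))) :
  coact (z (n - 1)) (ext_val n x phi) == ext_val n x phi.
Proof. by rewrite /ext_val raddfD /= !coact_comp gcoef_mul Jcoef_mul. Qed.

Definition ext_diff_fun m n (e : obj X m * coideal (z (m - 1))) :
    obj X n * coideal (z (n - 1)) :=
  (diff X m n e.1, Coideal (ext_subproof n e.1 e.2)).

Fact ext_diff_is_linear m n : linear (@ext_diff_fun m n).
Proof.
move=> a s t; rewrite [LHS]surjective_pairing [RHS]surjective_pairing.
congr pair; first by rewrite /= linearP.
apply: coval_inj; rewrite [RHS]coval_linear /= /ext_val coval_linear linearP /=.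
by rewrite !coact_linear scalerDr addrACA.
Qed.

Fact ext_shape m n : m + 1 != n ->
  forall e, lin_of (@ext_diff_is_linear m n) e = 0.
Proof.
move=> mn e; rewrite /= [LHS]surjective_pairing; congr pair.
  by rewrite /= diff_shape.
apply: coval_inj; rewrite coval0 /= /ext_val /gcoef /Jcoef (negPf mn) !coact0.
by rewrite addr0.
Qed.

Fact ext_diff m n p e :
  lin_of (@ext_diff_is_linear n p) (lin_of (@ext_diff_is_linear m n) e) = 0.
Proof.
rewrite /= [LHS]surjective_pairing; congr pair; first by rewrite /= diff_diff.
apply: coval_inj; rewrite coval0 /= /ext_val /= /ext_val raddfD /= !coact_comp.
have [np|np] := eqVneq (n + 1) p; last first.
  by rewrite /gcoef /Jcoef (negPf np) !mulr0 !coact0 !addr0.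
have [mn|mn] := eqVneq (m + 1) n; last first.
  rewrite diff_shape // !raddf0 /gcoef /Jcoef (negPf mn) !mul0r !coact0.
  by rewrite !addr0.
subst p n; rewrite /gcoef /Jcoef !eqxx addrK dualize_diff puw.
by rewrite -[X in _ * y X](subrK 1 m) pww coact0 addr0 addNr.
Qed.

Definition ext : cplx A.
Proof.
refine (@Cplx k A (fun n => (obj X n * coideal (z (n - 1)))%type)
  (fun m n => lin_of (@ext_diff_is_linear m n)) ext_shape ext_diff _ _).
- move=> n; exact: findim_pair (obj_findim X n) (coideal_findim (puu q (n -
    1))).
have [N HN] := obj_bounded X; have [M HM] := pu_bounded q.
exists (maxn N M.+1) => n; rewrite gtn_max => /andP[Nn Mn] [x phi].
rewrite (HN n Nn x); congr pair; apply: coval_inj.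
have z0 : z (n - 1) = 0 by apply: HM; lia.
by rewrite -covalP [X in coact X]z0 coact0 coval0.
Defined.

End Extension.

Section Splitting.
Variables (k : fieldType) (X : cplx (A2 k)) (q : pdata (A2 k)).
Local Notation A := (A2 k).
Local Notation B := (A2_basis k).
Local Notation z := (pu q).
Local Notation y := (pw q).

Variable lam : forall n, obj X n -> k.
Hypothesis lam_linear : forall n (c : k) (s t : obj X n),
  lam (c%:A *: s + t) = c * lam s + lam t.
Hypothesis lam_coboundary : forall n (s : obj X n), z (n + 1) *: s = s ->
  lam (diff X n (n + 1) s) + lam (y n *: s) = 0.

Variables (v : vertex) (l : seq bpath) (ok : str_ok v l) (i : int).
Local Notation R := (str_shift k ok i).
Local Notation u := (pu (string_pdata k ok i)).
Local Notation w := (pw (string_pdata k ok i)).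
Local Notation E := (ext lam_linear lam_coboundary).

Variable x : fam X.
Hypothesis cx : cocycle (string_pdata k ok i) x.

(** The composite of the map given by x with the one given by the functionals
    sends p in A u_n to p c_n. *)
Definition composite_coef n : dualA k := coact (z n) (dualize lam (x n)).
Local Notation c := composite_coef.

(** The composite has exact kernel and cokernel complexes. *)
Hypothesis ker_exact : forall n p,
  p * u (n + 1) = p -> p * w (n + 1) = 0 -> p *: c (n + 1) = 0 ->
  exists p', [/\ p' * u n = p', p = p' * w n & p' *: c n = 0].
Hypothesis coker_exact : forall n (phi : dualA k) p1,
  coact (z (n + 1)) phi = phi -> p1 * u (n + 1 + 1) = p1 ->
  coact (y (n + 1)) phi = p1 *: c (n + 1 + 1) ->
  exists p psi, [/\ p * u (n + 1) = p, coact (z n) psi = psi &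
    phi = p *: c (n + 1) + coact (y n) psi].

(** The composite anticommutes with the differentials, because the target is
    shifted by one degree. *)
Lemma ccoef_chain n : w n *: c (n + 1) = - coact (y n) (c n).
Proof.
have [_ dx] := cx n; rewrite /composite_coef -linearZ -linearZ /= -dx.
by rewrite (dualize_diff lam_linear lam_coboundary) coact_comp puw.
Qed.

Definition split_fun n (e : obj (dsum R E) n) : obj X n :=
  coef e.1 *: x n + e.2.1.

Fact split_is_linear n : linear (@split_fun n).
Proof.
move=> a s t; rewrite /split_fun.
have -> : (a *: s + t).1 = a *: s.1 + t.1 by [].
have -> : (a *: s + t).2.1 = a *: s.2.1 + t.2.1 by [].
rewrite coef_linear scalerDl scalerDr scalerA.
exact: addrACA.
Qed.

Fact split_diff m n (e : obj (dsum R E) m) :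
  split_fun (diff (dsum R E) m n e) = diff X m n (split_fun e).
Proof.
have [<-|mn] := eqVneq (m + 1) n; last first.
  rewrite !(diff_shape mn); exact: (raddf0 (lin_of (@split_is_linear n))).
rewrite {1}/split_fun.
have -> : (diff (dsum R E) m (m + 1) e).1 = diff R m (m + 1) e.1 by [].
have -> : (diff (dsum R E) m (m + 1) e).2.1 = diff X m (m + 1) e.2.1 by [].
have [_ dx] := cx m.
by rewrite coef_diff -scalerA -dx linearD linearZ.
Qed.

Definition split_hom : hom (dsum R E) X :=
  @Hom k A (dsum R E) X (fun n => lin_of (@split_is_linear n))
    (fun m n e => @split_diff m n e).

Lemma ker_exact_pred n p : p * u n = p -> p * w n = 0 -> p *: c n = 0 ->
  exists p', [/\ p' * u (n - 1) = p', p = p' * w (n - 1) & p' *: c (n - 1) = 0].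
Proof. by have := @ker_exact (n - 1) p; rewrite subrK. Qed.

Lemma coker_exact_pred n (phi : dualA k) p1 :
  coact (z n) phi = phi -> p1 * u (n + 1) = p1 ->
  coact (y n) phi = p1 *: c (n + 1) ->
  exists p psi, [/\ p * u n = p, coact (z (n - 1)) psi = psi &
    phi = p *: c n + coact (y (n - 1)) psi].
Proof. by have := @coker_exact (n - 1) phi p1; rewrite subrK. Qed.

Lemma pred_ww n : w (n - 1) * w n = 0.
Proof. by have := pww (string_pdata k ok i) (n - 1); rewrite subrK. Qed.

Lemma pred_yy n : y (n - 1) * y n = 0.
Proof. by have := pww q (n - 1); rewrite subrK. Qed.

Lemma coact_dualize_diff m n (s : obj X m) : m + 1 = n ->
  coact (z n) (dualize lam (diff X m n s)) = - coact (y m) (dualize lam s).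
Proof. by move=> <-; apply: dualize_diff. Qed.

Lemma coval_ext_diff m n (e : obj E m) : m + 1 = n ->
  coval (diff E m n e).2 =
  coact (z m) (dualize lam e.1) + coact (y (m - 1)) (coval e.2).
Proof. by move=> mn; rewrite /= /ext_val /gcoef /Jcoef mn eqxx. Qed.

Lemma coef_diff_eq m n (p : obj R m) : m + 1 = n ->
  coef (diff R m n p) = coef p * w m.
Proof. by move=> <-; apply: coef_diff. Qed.

(** By ker_exact and coker_exact the composite is a quasi-isomorphism; hence
    X is, up to quasi-isomorphism, the sum of the string complex and of the
    homotopy fibre. This is the diagram chase behind that. *)
Lemma split_injective n (e : obj (dsum R E) n) :
  cycle e -> boundary (split_fun e) -> boundary e.
Proof.
case: e => p0 [x0 phi]; rewrite /cycle /split_fun /= => ce [y0 ey].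
have C0 : diff R n (n + 1) p0 = 0 := congr1 fst ce.
have C1 : coef p0 * w n = 0 by rewrite -coef_diff C0 coef0.
have C3 : diff E n (n + 1) (x0, phi) = 0 := congr1 snd ce.
have C2 : coact (z n) (dualize lam x0) = - coact (y (n - 1)) (coval phi).
  apply/eqP; rewrite -addr_eq0; apply/eqP.
  by rewrite -(@coval_ext_diff n (n + 1) (x0, phi)) // C3 coval0.
pose m := n - 1; have mn : m + 1 = n := subrK 1 n.
pose th := coval phi - coact (z m) (dualize lam y0).
have zth : coact (z m) th = th by rewrite /th coactB coact_comp puu covalP.
have yth : coact (y m) th = coef p0 *: c n.
  rewrite /th coactB coact_comp puw /composite_coef -coactZ -dualizeZ //.
  have -> : coef p0 *: x n = diff X m n y0 - x0 by rewrite -ey addrK.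
  by rewrite dualizeB // coactB C2 (coact_dualize_diff _ mn) opprK addrC.
have p0u : coef p0 * u (m + 1) = coef p0 by rewrite mn; apply: coefP.
have [|p1 [psi [p1u zpsi eth]]] := coker_exact_pred zth p0u.
  by rewrite mn.
have wc : w m *: c n = - coact (y m) (c m) by rewrite -ccoef_chain mn.
have [|||p2 [p2u ep2 p2c]] := @ker_exact_pred n (coef p0 + p1 * w m).
- by rewrite mulrDl -mulrA -[X in _ * (_ * u X)]mn pwu coefP.
- by rewrite mulrDl -mulrA pred_ww mulr0 C1 addr0.
- rewrite scalerDl -scalerA wc -yth eth coactD coactZ coact_comp pred_yy coact0.
  by rewrite addr0 scalerN subrr.
have p'u : (p2 - p1) * u m = p2 - p1 by rewrite mulrBl p2u p1u.
exists (Coef p'u, (y0 - (p2 - p1) *: x m, Coideal (introT eqP zpsi))).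
have ep : (p2 - p1) * w m = coef p0 by rewrite mulrBl -ep2 addrK.
congr (_, (_, _)).
- by apply: coef_inj; rewrite (coef_diff_eq _ mn).
- have [_ dx] := cx m; rewrite -/m linearB linearZ /=.
  have -> : diff X m n y0 = coef p0 *: x n + x0 by [].
  have -> : diff X m n (x m) = w m *: x n by move: dx; rewrite mn.
  by rewrite scalerA ep addrC addKr.
apply: coval_inj; rewrite (@coval_ext_diff m n) //=.
rewrite dualizeB // dualizeZ // coactB coactZ -/(composite_coef m) scalerBl p2c
  sub0r opprK.
by rewrite -addrA -eth /th addrC subrK.
Qed.

Lemma split_surjective n (t : obj X n) : cycle t ->
  exists e : obj (dsum R E) n, cycle e /\ boundary (t - split_fun e).
Proof.
move=> ct; pose phi := coact (z n) (dualize lam t).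
have zphi : coact (z n) phi = phi by rewrite /phi coact_comp puu.
have yphi : coact (y n) phi = 0 *: c (n + 1).
  rewrite scale0r /phi coact_comp puw -[LHS]opprK -(@coact_dualize_diff n (n +
    1)) //.
  by rewrite ct dualize0 // coactr0 oppr0.
have [p [psi [pu' zpsi ephi]]] := coker_exact_pred zphi (mul0r _) yphi.
have yy m : coact (y m) (coact (y (m - 1)) psi) = 0.
  by rewrite coact_comp pred_yy coact0.
have [|||p' [p'u ep' p'c]] := @ker_exact_pred (n + 1) (p * w n).
- by rewrite -mulrA pwu.
- by rewrite -mulrA pww mulr0.
- rewrite -scalerA ccoef_chain scalerN -coactZ.
  have -> : p *: c n = phi - coact (y (n - 1)) psi by rewrite ephi addrK.
  by rewrite coactB yphi scale0r yy subrr oppr0.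
move: p'u ep' p'c; rewrite addrK => p'u ep' p'c.
have pp'u : (p - p') * u n = p - p' by rewrite mulrBl p'u pu'.
have zpsi' : coact (z (n - 1)) (- psi) = - psi.
  by rewrite -[- psi]scaleN1r coactZ zpsi.
exists (Coef pp'u, (t - (p - p') *: x n, Coideal (introT eqP zpsi'))).
split; last first.
  by rewrite /split_fun /coef /= [X in t - X]addrC subrK subrr;
    apply: boundary0.
congr (_, (_, _)).
- by apply: coef_inj; rewrite coef_diff coef0 /coef /= mulrBl ep' subrr.
- have [_ dx] := cx n; rewrite linearB linearZ /= dx ct sub0r scalerA.
  by rewrite mulrBl ep' subrr scale0r oppr0.
apply: coval_inj; rewrite (@coval_ext_diff n (n + 1)) //.
apply: etrans (esym (coval0 _)); rewrite /=.
rewrite dualizeB // dualizeZ // coactB coactZ -/(composite_coef n) -/phi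
  scalerBl p'c subr0.
rewrite ephi addrKl -[- psi]scaleN1r coactZ scaleN1r subrr.
by [].
Qed.

Lemma split_quasi_iso : quasi_iso split_hom.
Proof.
by move=> n; split; [apply: split_injective | apply: split_surjective].
Qed.

End Splitting.

(** * Exactness of the composites, locally *)

Section LocalAlgebra.
Variable k : fieldType.
Local Notation A := (A2 k).
Local Notation B := (A2_basis k).
Implicit Types (p a : A) (phi c : dualA k).

Lemma coscale_coef p c : p *: c = [ffun r => match r with
  | E1 => p E1 * c E1 + p Alpha * c Alpha
  | E2 => p E2 * c E2 + p Beta * c Beta + p BetaAlpha * c BetaAlpha
  | Alpha => p E2 * c Alpha
  | Beta => p E1 * c Beta + p Alpha * c BetaAlpha
  | BetaAlpha => p E2 * c BetaAlpha
  end] :> dualA k.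
Proof.
rewrite -[LHS]/(coscale p c); apply/ffunP => r; rewrite !ffunE evE.
by case: r; rewrite !A2_mul_coefE !ffunE /=; ring.
Qed.

Lemma coact_basis_coef q phi : coact (B q) phi = [ffun r =>
  if pmul q r is Some s then phi s else 0] :> dualA k.
Proof.
apply/ffunP => r; rewrite !ffunE A2_basisM.
by case: (pmul q r) => [s|]; rewrite ?ev_basis // evE !ffunE; ring.
Qed.

Lemma mulr_basis_coef p q : p * B q = [ffun r => match q, r with
  | E1, E1 => p E1 | E1, Beta => p Beta
  | E2, E2 => p E2 | E2, Alpha => p Alpha | E2, BetaAlpha => p BetaAlpha
  | Alpha, Alpha => p E1 | Alpha, BetaAlpha => p Beta
  | Beta, Beta => p E2
  | BetaAlpha, BetaAlpha => p E2
  | _, _ => 0 end] :> A.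
Proof.
rewrite A2_mul_coefE; apply/ffunP => r; rewrite !ffunE.
by case: q; case: r; rewrite /=; ring.
Qed.

Lemma coact_sign e a phi : coact ((-1) ^+ e * a) phi = (-1) ^+ e *: coact a phi.
Proof.
by apply: dualAP => r; rewrite evZ !ev_coact (commr_sign r) !mulrA (commr_sign
  a).
Qed.

Lemma mul_sign_eq0 e p a : p * ((-1) ^+ e * a) = 0 -> p * a = 0.
Proof.
rewrite mulrA commr_sign -mulrA => /(congr1 ( *%R ((-1) ^+ e))).
by rewrite signrMK mulr0.
Qed.

Lemma coact_sign_eq0 e a phi : coact ((-1) ^+ e * a) phi = 0 -> coact a phi = 0.
Proof.
rewrite coact_sign => /(congr1 ( *:%R ((-1) ^+ e))).
by rewrite scalerA -expr2 sqrr_sign scale1r scaler0.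
Qed.

Lemma sign_mul_sign e p a : (-1) ^+ e * p * ((-1) ^+ e * a) = p * a.
Proof. by rewrite -(commr_sign p) -mulrA signrMK. Qed.

Lemma e1_coef p : p * B E1 = p -> [/\ p E2 = 0, p Alpha = 0 & p BetaAlpha = 0].
Proof. by move=> <-; rewrite mulr_basis_coef !ffunE. Qed.

Lemma e2_coef p : p * B E2 = p -> p E1 = 0 /\ p Beta = 0.
Proof. by move=> <-; rewrite mulr_basis_coef !ffunE. Qed.

Lemma d1_coef phi : coact (B E1) phi = phi ->
  [/\ phi E2 = 0, phi Beta = 0 & phi BetaAlpha = 0].
Proof. by move=> <-; rewrite coact_basis_coef !ffunE. Qed.

Lemma d2_coef phi : coact (B E2) phi = phi -> phi E1 = 0 /\ phi Alpha = 0.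
Proof. by move=> <-; rewrite coact_basis_coef !ffunE. Qed.

(** delta and c22 t are the possible composites A e_i -> D(e_j A), as elements
    of the dual of A supported on paths from j to i: delta Beta for i = 1 and
    j = 2, delta Alpha for i = 2 and j = 1, delta E1 for i = j = 1, and c22 t
    for i = j = 2, an isomorphism whatever t is because it does not vanish on
    the socle. The map given by delta E2, with image the socle, occurs for the
    string alpha. The numbers in ker_ij and coker_ij below are i and j. *)
Definition delta r : dualA k := [ffun p => (p == r)%:R].
Definition c22 (t : k) : dualA k :=
  [ffun r => match r with E2 => t | BetaAlpha => 1 | _ => 0 end].

Lemma A2_eq (x y : A) : x E1 = y E1 -> x E2 = y E2 -> x Alpha = y Alpha ->
  x Beta = y Beta -> x BetaAlpha = y BetaAlpha -> x = y.
Proof. by move=> *; apply/ffunP; case. Qed.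

Lemma dualA_eq (x y : dualA k) : x E1 = y E1 -> x E2 = y E2 ->
  x Alpha = y Alpha ->
  x Beta = y Beta -> x BetaAlpha = y BetaAlpha -> x = y.
Proof. by move=> *; apply/ffunP; case. Qed.

Lemma coact_neg_sign e a phi :
  coact (- ((-1) ^+ e * a)) phi = - ((-1) ^+ e *: coact a phi).
Proof. by rewrite coact_opp coact_sign. Qed.

Lemma coact_neg_sign_eq0 e a phi : coact (- ((-1) ^+ e * a)) phi = 0 ->
  coact a phi = 0.
Proof.
by rewrite coact_opp => /eqP; rewrite oppr_eq0 => /eqP /coact_sign_eq0.
Qed.

Lemma ker_zero (u w p : A) c : p = 0 ->
  exists p', [/\ p' * u = p', p = p' * w & p' *: c = 0].
Proof. by move=> ->; exists 0; rewrite !mul0r scale0r. Qed.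

Lemma ker_lift e (g b u w p : A) c : c = 0 -> w = (-1) ^+ e * g ->
  b * u = b -> p = b * g -> exists p', [/\ p' * u = p', p = p' * w & p' *: c =
    0].
Proof.
move=> -> -> bu ->; exists ((-1) ^+ e * b).
by rewrite scaler0 sign_mul_sign -mulrA bu.
Qed.

Lemma coker_proj (u z y : A) c phi : (exists p, p * u = p /\ phi = p *: c) ->
  exists p psi, [/\ p * u = p, coact z psi = psi & phi = p *: c + coact y psi].
Proof. by move=> [p [pu ->]]; exists p, 0; rewrite !coactr0 addr0. Qed.

Lemma coker_zero (u z y : A) c phi : phi = 0 ->
  exists p psi, [/\ p * u = p, coact z psi = psi & phi = p *: c + coact y psi].
Proof. by move=> ->; apply: coker_proj; exists 0; rewrite mul0r scale0r. Qed.

Lemma coker_lift e (g u z y : A) c phi psi : y = - ((-1) ^+ e * g) ->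
  coact z psi = psi -> phi = coact g psi ->
  exists p psi, [/\ p * u = p, coact z psi = psi & phi = p *: c + coact y psi].
Proof.
move=> -> zpsi ->; exists 0, (- ((-1) ^+ e *: psi)).
split; [by rewrite mul0r | by rewrite coactN coactZ zpsi |].
rewrite scale0r add0r coact_neg_sign coactN coactZ scalerN opprK.
by rewrite scalerA -expr2 sqrr_sign scale1r.
Qed.

Lemma ker22 p t : p * B E2 = p -> p *: c22 t = 0 -> p = 0.
Proof.
move=> /e2_coef[p1 pb]; rewrite coscale_coef => /ffunP H.
have := (H Beta, H E2, H BetaAlpha); rewrite !ffunE !mulr1 !mulr0 !addr0 add0r.
move=> [[pa p2] p2']; move: p2; rewrite p2' mul0r add0r => pba.
by apply: A2_eq; rewrite ?ffunE.
Qed.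

Lemma ker12 p : p * B E1 = p -> p *: delta Beta = 0 -> p = 0.
Proof.
move=> /e1_coef[p2 pa pba]; rewrite coscale_coef => /ffunP H.
have := (H Beta, H E2); rewrite !ffunE /= !mulr1 !mulr0 !addr0 add0r =>
  -[p1 pb].
by apply: A2_eq; rewrite ?ffunE.
Qed.

(** The kernel of A e_2 -> D(e_1 A) is the socle, hence the image of the
    differential beta alpha; in ker11 it is the image of beta. *)
Lemma ker21 p : p * B E2 = p -> p *: delta Alpha = 0 ->
  p = (p BetaAlpha *: B E2) * B BetaAlpha.
Proof.
move=> /e2_coef[p1 pb]; rewrite coscale_coef => /ffunP H.
have := (H Alpha, H E1); rewrite !ffunE /= !mulr1 !mulr0 !add0r => -[p2 pa].
by rewrite mulr_basis_coef; apply: A2_eq;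
  rewrite ?ffunE //= /GRing.scale /= mulr1.
Qed.

Lemma ker11 p : p * B E1 = p -> p *: delta E1 = 0 ->
  p = (p Beta *: B E2) * B Beta.
Proof.
move=> /e1_coef[p2 pa pba]; rewrite coscale_coef => /ffunP H.
have := H E1; rewrite !ffunE /= !mulr1 !mulr0 !addr0 => p1.
by rewrite mulr_basis_coef; apply: A2_eq;
  rewrite ?ffunE //= /GRing.scale /= mulr1.
Qed.

Lemma radical_alpha p : p * B E2 = p -> p E2 = 0 ->
  p = (p Alpha *: B E1 + p BetaAlpha *: B Beta) * B Alpha.
Proof.
move=> /e2_coef[p1 pb] p2.
by rewrite mulr_basis_coef; apply: A2_eq; rewrite !ffunE //= /GRing.scale /=;
  ring.
Qed.

Lemma coker22 phi t : coact (B E2) phi = phi ->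
  exists p, p * B E2 = p /\ phi = p *: c22 t.
Proof.
move=> /d2_coef[p1 pa].
exists (phi BetaAlpha *: B E2 + phi Beta *: B Alpha +
        (phi E2 - phi BetaAlpha * t) *: B BetaAlpha); split.
  by rewrite mulr_basis_coef; apply: A2_eq; rewrite !ffunE //= /GRing.scale /=;
    ring.
rewrite coscale_coef; apply: dualA_eq;
  rewrite !ffunE //= ?p1 ?pa /GRing.scale /=; ring.
Qed.

Lemma coker21 phi : coact (B E1) phi = phi ->
  exists p, p * B E2 = p /\ phi = p *: delta Alpha.
Proof.
move=> /d1_coef[p2 pb pba]; exists (phi Alpha *: B E2 + phi E1 *: B Alpha);
  split.
  by rewrite mulr_basis_coef; apply: A2_eq; rewrite !ffunE //= /GRing.scale /=;
    ring.
rewrite coscale_coef; apply: dualA_eq;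
  rewrite !ffunE //= ?p2 ?pb ?pba /GRing.scale /=; ring.
Qed.

Lemma coker12 phi : coact (B E2) phi = phi -> coact (B BetaAlpha) phi = 0 ->
  exists p, p * B E1 = p /\ phi = p *: delta Beta.
Proof.
move=> /d2_coef[p1 pa]; rewrite coact_basis_coef => /ffunP/(_ E2);
  rewrite !ffunE /= => pba.
exists (phi Beta *: B E1 + phi E2 *: B Beta); split.
  by rewrite mulr_basis_coef; apply: A2_eq; rewrite !ffunE //= /GRing.scale /=;
    ring.
rewrite coscale_coef; apply: dualA_eq;
  rewrite !ffunE //= ?p1 ?pa ?pba /GRing.scale /=; ring.
Qed.

Lemma coker11 phi : coact (B E1) phi = phi -> coact (B Alpha) phi = 0 ->
  exists p, p * B E1 = p /\ phi = p *: delta E1.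
Proof.
move=> /d1_coef[p2 pb pba]; rewrite coact_basis_coef => /ffunP/(_ E2);
  rewrite !ffunE /= => pa.
exists (phi E1 *: B E1); split.
  by rewrite mulr_basis_coef; apply: A2_eq; rewrite !ffunE //= /GRing.scale /=;
    ring.
rewrite coscale_coef; apply: dualA_eq;
  rewrite !ffunE //= ?p2 ?pb ?pa ?pba /GRing.scale /=; ring.
Qed.

(** The multiples of delta E2 form the socle of D(e_2 A), the kernel of the
    differential to D(e_1 A) given by beta. *)
Lemma cosocle phi : coact (B E2) phi = phi -> coact (B Beta) phi = 0 ->
  phi = (phi E2 *: B E2) *: delta E2.
Proof.
move=> /d2_coef[p1 pa]; rewrite coact_basis_coef => /ffunP H.
have := (H E1, H Alpha); rewrite !ffunE /= => -[pb pba].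
rewrite coscale_coef; apply: dualA_eq;
  rewrite !ffunE //= ?p1 ?pa ?pb ?pba /GRing.scale /=; ring.
Qed.

Lemma delta_image q : q = Alpha \/ q = BetaAlpha ->
  coact (B q) (delta q) = delta E2.
Proof.
by move=> qq; rewrite coact_basis_coef; apply/ffunP => s; rewrite !ffunE;
  case: qq => ->; case: s => /=; rewrite ?ffunE.
Qed.

Lemma beta_image phi : coact (B E1) phi = phi ->
  exists psi, coact (B E2) psi = psi /\ phi = coact (B Beta) psi.
Proof.
move=> /d1_coef[p2 pb pba].
exists [ffun r => match r with Beta => phi E1 | BetaAlpha => phi Alpha | _ =>
  0 end].
rewrite !coact_basis_coef; split; apply: dualA_eq; rewrite !ffunE //= ?ffunE //.
Qed.

End LocalAlgebra.

(** * String complexes by position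

    The terms and arrows of a string are given by inequalities between
    positions; int_cases decides the resulting case distinctions. *)

Ltac int_cases := repeat (case: ifP => ?); first [done | exfalso; lia].

Section Tables.
Variable k : fieldType.
Local Notation A := (A2 k).
Local Notation B := (A2_basis k).

(** The string visiting vertex 1 (if L holds), M times vertex 2, and vertex 1
    again (if R holds). For M = 0 exactly one of L and R is meant to hold. *)
Definition string_name (L : bool) (M : nat) (R : bool) : pname :=
  match M, L, R with
  | 0%N, _, _ => P_e1
  | s.+1, false, false => P_ba s
  | s.+1, true, false => P_aba s
  | s.+1, false, true => P_bab s
  | s.+1, true, true => P_abab s
  end.

Definition string_term (L : bool) (M : nat) (R : bool) (j : int) : A :=
  if (0 <= j) && (j < L%:Z) then B E1
  else if (L%:Z <= j) && (j < (L + M)%:Z) then B E2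
  else if ((L + M)%:Z <= j) && (j < (L + M + R)%:Z) then B E1 else 0.

Definition string_arrow (L : bool) (M : nat) (R : bool) (j : int) : A :=
  if M == 0%N then 0
  else if (0 <= j) && (j < L%:Z) then B Alpha
  else if (L%:Z <= j) && (j + 1 < (L + M)%:Z) then B BetaAlpha
  else if R && (j + 1 == (L + M)%:Z) then B Beta else 0.

Lemma str_term_string_name L M R n : (M == 0%N) ==> (L != R) ->
  str_term k (pstring (string_name L M R)).1 (pstring (string_name L M R)).2 n =
  string_term L M R (n - 1).
Proof.
rewrite /string_term => H; case: n => [[|j]|j] /=; last first.
- by int_cases.
- case: M L R H => [|s] [] [] //= _; rewrite ?map_rcons ?map_nseq /=;
    (case: j => [|j] /=; last (try (case: j => [|j] /=)));
    rewrite ?nth_nil ?nth_rcons ?nth_nseq ?size_nseq ?size_map; by int_cases.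
by int_cases.
Qed.

Lemma str_map_string_name L M R n : (M == 0%N) ==> (L != R) ->
  str_map k (pstring (string_name L M R)).2 n = string_arrow L M R (n - 1).
Proof.
rewrite /string_arrow => H; case: n => [[|j]|j] /=; last first.
- by int_cases.
- case: M L R H => [|s] [] [] //= _; rewrite ?map_rcons ?map_nseq /=;
    (try (case: j => [|j] /=));
    rewrite ?nth_nil ?nth_rcons ?nth_nseq ?size_nseq ?size_map; by int_cases.
by int_cases.
Qed.

End Tables.

(** * Summands detected by functionals *)

Section PData.
Variables (k : fieldType) (A : algType k) (p : pdata A).

Fact pneg_pww n : - pw p n * - pw p (n + 1) = 0.
Proof. by rewrite mulrNN pww. Qed.

Definition pdata_opp : pdata A :=
  @PData k A (pu p) (fun n => - pw p n) (puu p)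
    (fun n => etrans (mulrN _ _) (congr1 -%R (puw p n)))
    (fun n => etrans (mulNr _ _) (congr1 -%R (pwu p n)))
    pneg_pww (pu_bounded p).

End PData.

Section NullFunctional.
Variables (k : fieldType) (A : algType k) (q : pdata A) (X : cplx A).

Lemma scaler_central (V : lmodType A) a (c : k) (x : V) :
  a *: (c%:A *: x) = c%:A *: (a *: x).
Proof. by rewrite !scalerA -scalerAr mulr1 -scalerAl mul1r. Qed.

Lemma coboundary_subspace : subspace (@coboundary k A q X).
Proof.
move=> c x y [s Hs] [t Ht]; exists (c%:A *: s + t) => n.
have [us xs] := Hs n; have [ut yt] := Ht n.
rewrite !famE; split; first by rewrite scalerDr scaler_central us ut.
by rewrite xs yt linearD linearZ /= !scalerDr (scaler_central (pw q _)) addrACA.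
Qed.

Lemma at_deg_coboundary n (s : obj X n) : pu q (n + 1) *: s = s ->
  coboundary q (at_deg (diff X n (n + 1) s) + at_deg (pw q n *: s)).
Proof.
move=> us; exists (at_deg s) => j; have [<-|nj] := eqVneq n j.
  rewrite famE !at_deg_in !at_deg_out ?scaler0 ?addr0 //; by apply/eqP; lia.
rewrite (at_deg_out s nj) scaler0 linear0 add0r famE; split=> //.
rewrite at_deg_out ?add0r; last by apply/eqP; move/eqP: nj; lia.
have [e|nj1] := eqVneq n (j + 1).
  by subst n; rewrite !at_deg_in.
by rewrite !at_deg_out ?scaler0.
Qed.

(** A family which is not null-homotopic is detected by a functional on all
    families that vanishes on the null-homotopic ones; its restrictions to
    single degrees are the functionals lam. *)
Lemma null_functional m (t : obj X m) : ~ coboundary q (at_deg t) ->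
  exists lam : forall n, obj X n -> k,
    [/\ forall n (c : k) (s s' : obj X n),
          lam n (c%:A *: s + s') = c * lam n s + lam n s',
        forall n (s : obj X n), pu q (n + 1) *: s = s ->
          lam (n + 1) (diff X n (n + 1) s) + lam n (pw q n *: s) = 0 &
        lam m t = 1].
Proof.
move=> nt; have [L [L_lin L0 Lt]] :=
  separating_functional (coboundary0 q X) coboundary_subspace nt.
exists (fun n s => L (at_deg s)); split=> // [n c s s'|n s us].
  by rewrite at_deg_linear L_lin.
have := L_lin 1 (at_deg (diff X n (n + 1) s)) (at_deg (pw q n *: s)).
by rewrite !scale1r mul1r => <-; apply/L0/at_deg_coboundary.
Qed.

End NullFunctional.

(** The string complex is a direct summand of X, and both are indecomposable. *)
Lemma indecomposable_string (k : fieldType) (X : cplx (A2 k)) (q : pdata (A2 k))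
    (lam : forall n, obj X n -> k)
    (lam_linear : forall n (c : k) (s t : obj X n),
       lam n (c%:A *: s + t) = c * lam n s + lam n t)
    (lam_coboundary : forall n (s : obj X n), pu q (n + 1) *: s = s ->
       lam (n + 1) (diff X n (n + 1) s) + lam n (pw q n *: s) = 0)
    (w : pname) (i : int) (x : fam X) :
  let p := string_pdata k (pstring_ok w) i in
  let c := composite_coef q lam x in
  cocycle p x ->
  (forall n a, a * pu p (n + 1) = a -> a * pw p (n + 1) = 0 ->
     a *: c (n + 1) = 0 ->
     exists a', [/\ a' * pu p n = a', a = a' * pw p n & a' *: c n = 0]) ->
  (forall n (phi : dualA k) a,
     coact (pu q (n + 1)) phi = phi -> a * pu p (n + 1 + 1) = a ->
     coact (pw q (n + 1)) phi = a *: c (n + 1 + 1) ->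
     exists a' psi, [/\ a' * pu p (n + 1) = a', coact (pu q n) psi = psi &
       phi = a' *: c (n + 1) + coact (pw q n) psi]) ->
  indecomposable X -> diso X (shift i (P k w)).
Proof.
move=> p c cx ker coker [_ indX].
have qi := split_quasi_iso lam_linear lam_coboundary cx ker coker.
have iso := quasi_iso_diso qi.
have [R0|E0] := indX _ _ (diso_sym iso).
  by case: (@str_shift_indecomposable k _ _ (pstring_ok w) (pstring_nontrivial
    w) i).
apply: diso_trans (diso_sym iso) _; apply: diso_sym.
exact: diso_dsum_acyclic (diso0_acyclic E0).
Qed.

Section StringData.
Variable k : fieldType.
Local Notation A := (A2 k).

Definition string_data (L : bool) (M : nat) (R : bool) (d : int) : pdata A :=
  string_pdata k (pstring_ok (string_name L M R)) (1 - d).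

Lemma pu_string_data L M R d n : (M == 0%N) ==> (L != R) ->
  pu (string_data L M R d) n = string_term k L M R (n - d).
Proof.
move=> H; rewrite /= str_term_string_name //; congr string_term; lia.
Qed.

Lemma pw_string_data L M R d n : (M == 0%N) ==> (L != R) ->
  pw (string_data L M R d) n =
    (-1) ^+ `|1 - d|%N * string_arrow k L M R (n - d).
Proof.
move=> H; rewrite /= str_map_string_name //;
  congr (_ * string_arrow _ _ _ _ _); lia.
Qed.

End StringData.

(** * Extremal strings *)

Section Extremal.
Variables (k : fieldType) (X : cplx (A2 k)) (m : int) (L : bool).
Local Notation A := (A2 k).
Local Notation B := (A2_basis k).

(** A chain is a string of elements starting with terms at the vertex 2; its
    head is an element at the vertex 1, and head_arrow multiplies the head into
    the component of t: at the vertex 2 in general (L false), and at the vertex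
    1 for strings which are going to be prolonged to the left by alpha (L
    true). *)
Definition head_arrow : A := if L then B E1 else B Beta.

Definition tail_data (N : nat) (R : bool) : pdata A :=
  string_data k false N R m.

(** The complex Z for which D Hom(Z, -) is Hom(-, P), where P is the string
    complex that is to be split off. When the string ends with beta, the probe
    has two more terms at the vertex 2, because A e_1 has the injective
    resolution D(e_2 A) -> D(e_2 A) -> D(e_1 A). The sign of its differential is
    chosen so that null-homotopies become chains. *)
Definition probe_data (N : nat) (R : bool) : pdata A :=
  pdata_opp (string_data k L (N + R.*2 - L) R m).

Definition chain_head (N : nat) (x : fam X) : obj X m :=
  if N == 0%N then x m else B Alpha *: x m.

Variable t : obj X m.

Definition good_chain (N : nat) (R : bool) (x : fam X) : Prop :=
  [/\ (0 < N)%N || R, cocycle (tail_data N R) x & boundary (head_arrow *: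
    chain_head N x - t)].

Lemma gterm_shift M R (j : int) : (0 <= j)%R -> (1 < M)%N ->
  string_term k L (M - L) R (j + 1) = string_term k false (M - 1) R j.
Proof.
rewrite /string_term => j0 M1; case: L; by int_cases.
Qed.

Lemma gmap_shift M R (j : int) : (0 <= j)%R -> (1 < M)%N ->
  string_arrow k L (M - L) R (j + 1) = string_arrow k false (M - 1) R j.
Proof.
rewrite /string_arrow => j0 M1; case: L; by int_cases.
Qed.

Lemma gmap_neg M R (j : int) : (j < 0)%R -> string_arrow k false M R j = 0.
Proof.
rewrite /string_arrow => j0; by int_cases.
Qed.

Lemma gmap_first M R : (1 < M)%N ->
  string_arrow k L (M - L) R 0 = head_arrow * B Alpha.
Proof.
move=> M1; rewrite /string_arrow /head_arrow; case: L; rewrite A2_basisM /=;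
  by int_cases.
Qed.

Lemma gmap_single N R : (0 < N)%N || R -> (N + R.*2 <= 1)%N ->
  string_arrow k L (N + R.*2 - L) R 0 = 0.
Proof.
case: R => /= NR N1; first by lia.
have -> : N = 1%N by lia.
by case: L.
Qed.

Lemma gterm_cut N (j : int) : (j < N%:Z)%R ->
  string_term k false N true j = string_term k false N false j.
Proof.
rewrite /string_term => j0; by int_cases.
Qed.

Lemma gmap_cut N (j : int) : (j + 1 < N%:Z)%R ->
  string_arrow k false N true j = string_arrow k false N false j.
Proof.
rewrite /string_arrow => j0; by int_cases.
Qed.

Lemma tail_ok N R : (0 < N)%N || R -> (N == 0%N) ==> (false != R).
Proof. by case: N; case: R. Qed.

Lemma probe_ok N R : (0 < N)%N || R ->
  (N + R.*2 - L == 0)%N ==> (L != R).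
Proof. by case: L; case: R => /=; lia. Qed.

Let e : nat := `|1 - m|%N.

(** If the probe does not detect the head of a chain, a null-homotopy of the
    head is itself, up to sign, a chain with an equivalent head. *)
Lemma chain_step N R x : ~ boundary t -> good_chain N R x ->
  coboundary (probe_data N R) (at_deg (head_arrow *: chain_head N x)) ->
  (1 < N + R.*2)%N /\ exists x', good_chain (N + R.*2 - 1) R x'.
Proof.
move=> nt [NR cx bx] [s Hs].
have zu n : pu (probe_data N R) n = string_term k L (N + R.*2 - L) R (n - m).
  exact: pu_string_data (probe_ok NR).
have zw n : pw (probe_data N R) n =
    - ((-1) ^+ e * string_arrow k L (N + R.*2 - L) R (n - m)).
  by rewrite -(pw_string_data k _ _ (probe_ok NR)).
have head_eq : head_arrow *: chain_head N x =
    diff X (m - 1) m (s (m - 1)) + pw (probe_data N R) m *: s m.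
  by have [_] := Hs (m - 1); rewrite subrK at_deg_in.
have tE : t = head_arrow *: chain_head N x - (head_arrow *: chain_head N x - t)
  by rewrite subKr.
have N1 : (1 < N + R.*2)%N.
  rewrite ltnNge; apply/negP => N1; apply: nt; rewrite tE.
  apply: boundaryB => //; exists (s (m - 1)).
  rewrite head_eq zw subrr.
  by rewrite gmap_single // mulr0 oppr0 scale0r addr0.
split=> //.
pose x' : fam X := fun n => if (m <= n)%R then - ((-1) ^+ e *: s n) else 0.
have x'ge n : (m <= n)%R -> x' n = - ((-1) ^+ e *: s n) by rewrite /x' => ->.
have x'lt n : (n < m)%R -> x' n = 0 by rewrite /x' ltNge => /negPf ->.
have NR' : (0 < N + R.*2 - 1)%N || R by rewrite subn_gt0 N1.
exists x'; split=> // [n|].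
  rewrite pu_string_data ?tail_ok // pw_string_data ?tail_ok //.
  have [mn|nm] := lerP m n; last first.
    by rewrite (x'lt n nm) gmap_neg ?mulr0 ?scale0r ?scaler0 ?linear0 //; lia.
  have [us ds] := Hs n.
  rewrite !x'ge //; last by lia.
  split.
    have e1 : string_term k false (N + R.*2 - 1) R (n - m) =
      pu (probe_data N R) (n + 1).
      rewrite zu -gterm_shift //; last by lia.
      congr string_term; lia.
    by rewrite e1 scalerN scalerA commr_sign -scalerA us.
  have dsn : diff X n (n + 1) (s n) =
    - (pw (probe_data N R) (n + 1) *: s (n + 1)).
    apply/eqP; rewrite -addr_eq0 -ds at_deg_out //; apply/eqP; lia.
  rewrite linearN linearZ /= dsn zw scaleNr opprK.
  have -> : string_arrow k L (N + R.*2 - L) R (n + 1 - m) =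
      string_arrow k false (N + R.*2 - 1) R (n - m).
    rewrite -gmap_shift //; last by lia.
    congr string_arrow; lia.
  by rewrite scalerN !scalerA (commr_sign (_ * string_arrow _ _ _ _ _)).
have -> : head_arrow *: chain_head (N + R.*2 - 1) x' - t =
    (head_arrow *: chain_head N x - t) - diff X (m - 1) m (s (m - 1)).
  rewrite /chain_head ifF; last by lia.
  rewrite head_eq zw subrr gmap_first // x'ge // !scalerN scaleNr.
  have E : ((-1) ^+ e * (head_arrow * B Alpha)) *: s m =
    head_arrow *: (B Alpha *: ((-1) ^+ e *: s m)).
    by rewrite !scalerA (commr_sign (head_arrow * _)).
  by rewrite E -[X in _ = X - _]addrA addrKl.
by apply: boundaryB => //; exists (s (m - 1)).
Qed.

(** A chain which is not detected by its probe gives way to a chain that is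
    shorter by one term if it ends at the vertex 2, and longer by one term if it
    ends with beta. Neither can go on forever: a chain at the vertex 2 has at
    least one term, and a chain ending with beta that reaches beyond the degrees
    in which X lives is also a chain ending at the vertex 2. *)
Theorem extremal_chain x0 : ~ boundary t -> good_chain 0 true x0 ->
  exists N R x, good_chain N R x /\
    ~ coboundary (probe_data N R) (at_deg (head_arrow *: chain_head N x)).
Proof.
move=> nt g0; apply: contrapT => none.
have all_null N R x : good_chain N R x ->
    coboundary (probe_data N R) (at_deg (head_arrow *: chain_head N x)).
  by move=> gx; apply: contrapT => nx; apply: none; exists N, R, x.
have no_false N x : ~ good_chain N false x.
  elim: N x => [|N IH] x gx; first by case: gx.
  have [_ [x']] := chain_step nt gx (all_null _ _ _ gx).
  by rewrite addn0 subn1; apply: IH.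
have all_true N : exists x, good_chain N true x.
  elim: N => [|N [x gx]]; first by exists x0.
  have [_ [x' gx']] := chain_step nt gx (all_null _ _ _ gx).
  by exists x'; move: gx'; rewrite addn2 subn1.
have [b Hb] := obj_bounded X.
have [x [_ cx bx]] := all_true (b + `|m|).+1%N.
set N := (b + `|m|).+1%N in cx bx.
have x0' n : (m + N%:Z <= n)%R -> x n = 0 by move=> Hn; apply: Hb;
  rewrite /N in Hn; lia.
apply: (no_false N x); split=> // n; have [ux dx] := cx n; move: ux dx.
rewrite !pu_string_data ?pw_string_data //.
have [nN|Nn] := ltrP (n - m) N%:Z; last first.
  have xn : x n = 0 by apply: x0'; lia.
  have xn1 : x (n + 1) = 0 by apply: x0'; lia.
  by rewrite xn xn1 !scaler0 linear0.
rewrite gterm_cut // => -> ->; split=> //.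
have [nN1|Nn1] := ltrP (n - m + 1) N%:Z; first by rewrite gmap_cut.
have xn1 : x (n + 1) = 0 by apply: x0'; lia.
by rewrite xn1 !scaler0.
Qed.

End Extremal.

Lemma sign_shift (A : nzRingType) (m : int) (L : bool) :
  (-1) ^+ absz (1 - (m - (L + L)%:Z))%R = (-1) ^+ absz (1 - m)%R :> A.
Proof.
set a := absz _; set b := absz _.
have ab : odd a = odd b by rewrite /a /b; case: (L); lia.
by rewrite -(signr_odd _ a) -(signr_odd _ b) ab.
Qed.

(** * The composite for an extremal string

    Exactness is checked degree by degree. To the left of m only the string
    complex has terms, and its differential is exact there; from m to m + N the
    composite has the form described above; the two last terms of the probe
    contribute the end of the injective resolution of A e_1. *)

Section ChainSplits.
Variables (k : fieldType) (X : cplx (A2 k)) (m : int) (L : bool).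
Local Notation A := (A2 k).
Local Notation B := (A2_basis k).
Variables (N : nat) (R : bool).
Hypothesis NR : (0 < N)%N || R.

Let q := probe_data k m L N R.
Let z := pu q.
Let y := pw q.
Let d : int := m - (L + L)%:Z.
Let p := string_data k L (N + L) R d.
Let u := pu p.
Let w := pw p.
Let e : nat := `|1 - m|%N.

Variable lam : forall n, obj X n -> k.
Hypothesis lam_linear : forall n (c : k) (s t : obj X n),
  lam (c%:A *: s + t) = c * lam s + lam t.
Hypothesis lam_coboundary : forall n (s : obj X n), z (n + 1) *: s = s ->
  lam (diff X n (n + 1) s) + lam (y n *: s) = 0.
Variable x : fam X.
Hypothesis cx : cocycle p x.
Hypothesis lam_head : lam (head_arrow k L *: chain_head m N x) = 1.

Lemma chain_ok : (N + L == 0)%N ==> (L != R).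
Proof. by move: NR; case: L; case: R; case: N. Qed.

Lemma uE n : u n = string_term k L (N + L) R (n - m + (L + L)%:Z).
Proof. by rewrite /u pu_string_data ?chain_ok // /d; congr string_term;
  lia. Qed.

Lemma wE n : w n = (-1) ^+ e * string_arrow k L (N + L) R (n - m + (L + L)%:Z).
Proof.
by rewrite /w pw_string_data ?chain_ok // sign_shift /d;
  congr (_ * string_arrow _ _ _ _ _); lia.
Qed.

Lemma zE n : z n = string_term k L (N + R.*2 - L) R (n - m).
Proof. exact: pu_string_data (probe_ok L NR). Qed.

Lemma yE n : y n = - ((-1) ^+ e * string_arrow k L (N + R.*2 - L) R (n - m)).
Proof. by rewrite -(pw_string_data k _ _ (probe_ok L NR)). Qed.

Lemma lamN n (s : obj X n) : lam (- s) = - lam s.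
Proof.
by have := lamZ lam_linear (-1) s; rewrite mulN1r scaleN1r scaleN1r.
Qed.

Lemma lam_sign n a (s : obj X n) :
  lam (((-1) ^+ e * a) *: s) = (-1) ^+ e * lam (a *: s).
Proof.
rewrite -(signr_odd A e) -(signr_odd k e); case: (odd e);
  rewrite ?expr0 ?expr1 ?mul1r //.
by rewrite !mulN1r scaleNr lamN.
Qed.

(** The path of the composite in the degree m + j: the functionals are
    normalized at j = 0, and lam_coboundary carries the value 1 along the
    chain. *)
Definition head_path (j : int) : A :=
  if (j == 0)%R then (if N == 0%N then head_arrow k L else head_arrow k L * B
    Alpha)
  else if (j < N%:Z)%R then B BetaAlpha else B Beta.

Lemma lam_along (j : nat) n : n = m + j%:Z -> (j < N)%N || R && (j == N) ->
  lam (head_path j *: x n) = 1.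
Proof.
elim: j n => [|j IH] n nj jN.
  have -> : n = m by rewrite nj addr0.
  rewrite -lam_head /head_path /chain_head eqxx.
  by case: ifP; rewrite ?scalerA.
rewrite -(subrK 1 n); set n1 := n - 1.
have nj1 : n1 = m + j%:Z by rewrite /n1 nj; lia.
rewrite -(IH _ nj1); last by lia.
have [ux dx] := cx n1.
have un1 : u n1 = B E2 by rewrite uE /string_term; case: L; int_cases.
have zn1 : z (n1 + 1) = B E2.
  by rewrite zE /string_term; move: (NR) jN; case: (L); case: (R) => ? ?;
    int_cases.
have zx : z (n1 + 1) *: x n1 = x n1 by rewrite zn1 -un1.
have := lam_coboundary zx; rewrite dx.
have -> : pw p n1 = (-1) ^+ e * head_path j.+1.
  rewrite -[pw p n1]/(w n1) wE /string_arrow /head_path; congr (_ * _).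
  by move: jN; case: (L); case: (R) => ?; int_cases.
have -> : y n1 = - ((-1) ^+ e * head_path j).
  rewrite yE; congr (- (_ * _)); rewrite /head_path.
  case: (posnP j) => [j0|j0].
    have -> : n1 - m = 0 by rewrite nj1 j0; lia.
    rewrite gmap_first; last by lia.
    by rewrite j0 eqxx ifF //; lia.
  by rewrite /string_arrow; move: jN; case: (L); case: (R) => ?; int_cases.
rewrite scaleNr lamN !lam_sign => /eqP; rewrite subr_eq0 => /eqP.
exact: (can_inj (signrMK _)).
Qed.

Local Notation c := (composite_coef q lam x).

Lemma ccoef_coef n r : c n r = lam ((z n * B r * u n) *: x n).
Proof.
have ux : u n *: x n = x n by have [] := cx n.
by rewrite -ev_basis ev_coact (ev_dualize lam_linear) -[in RHS]scalerA ux.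
Qed.

Lemma c0 n : z n = 0 -> c n = 0.
Proof. by move=> z0; rewrite /composite_coef -/z z0 coact0. Qed.

Lemma c_22 n : z n = B E2 -> u n = B E2 -> lam (B BetaAlpha *: x n) = 1 ->
  c n = c22 (lam (B E2 *: x n)).
Proof.
move=> zn un l1; apply/ffunP => r; rewrite ccoef_coef zn un ffunE.
by case: r; rewrite ?A2_basisM ?mul0r ?A2_basisM ?scale0r ?(lam0 lam_linear).
Qed.

Lemma c_12 n : z n = B E2 -> u n = B E1 -> lam (B Beta *: x n) = 1 ->
  c n = delta k Beta.
Proof.
move=> zn un l1; apply/ffunP => r; rewrite ccoef_coef zn un ffunE.
by case: r; rewrite ?A2_basisM ?mul0r ?A2_basisM ?scale0r ?(lam0 lam_linear).
Qed.

Lemma c_21 n : z n = B E1 -> u n = B E2 -> lam (B Alpha *: x n) = 1 ->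
  c n = delta k Alpha.
Proof.
move=> zn un l1; apply/ffunP => r; rewrite ccoef_coef zn un ffunE.
by case: r; rewrite ?A2_basisM ?mul0r ?A2_basisM ?scale0r ?(lam0 lam_linear).
Qed.

Lemma c_11 n : z n = B E1 -> u n = B E1 -> lam (B E1 *: x n) = 1 ->
  c n = delta k E1.
Proof.
move=> zn un l1; apply/ffunP => r; rewrite ccoef_coef zn un ffunE.
by case: r; rewrite ?A2_basisM ?mul0r ?A2_basisM ?scale0r ?(lam0 lam_linear).
Qed.


Lemma c_middle (j : nat) : (j < N)%N -> ~~ (L && (j == 0)%N) ->
  [/\ u (m + j%:Z) = B E2, z (m + j%:Z) = B E2 & exists t, c (m + j%:Z) =
    c22 t].
Proof.
move=> jN Lj; have un : u (m + j%:Z) = B E2 by rewrite uE /string_term;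
  case: L; int_cases.
have zn : z (m + j%:Z) = B E2.
  by rewrite zE /string_term; move: Lj (NR) jN; case: (L);
    case: (R) => /= ? ? ?; int_cases.
split=> //; exists (lam (B E2 *: x (m + j%:Z))); apply: c_22 => //.
rewrite -(@lam_along j _ erefl) ?jN // /head_path.
case: ifP => [j0|_]; last by rewrite ifT.
rewrite ifF; last by lia.
have -> : head_arrow k L = B Beta by move: Lj; rewrite /head_arrow;
  case: (L) => //=; lia.
by rewrite A2_basisM.
Qed.

Lemma c_start : L -> (0 < N)%N ->
  [/\ u m = B E2, z m = B E1 & c m = delta k Alpha].
Proof.
move=> LL N0; have um : u m = B E2 by rewrite uE /string_term; move: LL;
  case: (L) => // _; int_cases.
have zm : z m = B E1 by rewrite zE /string_term; move: LL; case: (L) => // _;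
  int_cases.
split=> //; apply: c_21 => //; have := @lam_along 0 m.
rewrite addr0 N0 => /(_ erefl isT); rewrite /head_path eqxx ifF; last by lia.
by rewrite /head_arrow LL A2_basisM.
Qed.

Lemma c_end : R -> ~~ (L && (N == 0)%N) ->
  [/\ u (m + N%:Z) = B E1, z (m + N%:Z) = B E2 & c (m + N%:Z) = delta k Beta].
Proof.
move=> RR LN.
have un : u (m + N%:Z) = B E1.
  by rewrite uE /string_term; move: RR; case: (R) => // _; case: (L); int_cases.
have zn : z (m + N%:Z) = B E2.
  by rewrite zE /string_term; move: RR LN; case: (R) => // _;
    case: (L) => /= ?; int_cases.
split=> //; apply: c_12 => //; have := @lam_along N _ erefl.
rewrite RR eqxx orbT => /(_ isT); rewrite /head_path.
case: ifP => [N0|N0].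
  have N00 : N = 0%N by lia.
  rewrite N00 eqxx /= (_ : head_arrow k L = B Beta) //.
  by move: LN; rewrite /head_arrow N00 eqxx; case: (L).
by rewrite ifF //; lia.
Qed.

Lemma c_only : L -> N = 0%N -> [/\ u m = B E1, z m = B E1 & c m = delta k E1].
Proof.
move=> LL N0; have RR : R by move: NR; rewrite N0.
have um : u m = B E1.
  by rewrite uE /string_term N0; move: LL RR; case: (L); case: (R) => // _ _;
    int_cases.
have zm : z m = B E1.
  by rewrite zE /string_term N0; move: LL RR; case: (L); case: (R) => // _ _;
    int_cases.
split=> //; apply: c_11 => //; have := @lam_along 0 m.
rewrite addr0 N0 RR => /(_ erefl isT); rewrite /head_path eqxx N0 eqxx.
by rewrite /head_arrow LL.
Qed.

(** The degrees according to the terms of the two complexes. Start and Only are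
    the degree m for strings prolonged to the left; in Only the chain consists
    of its head alone. *)
Variant position : int -> Prop :=
| Before n of (n < m)%R : position n
| Middle (j : nat) of (j < N)%N & ~~ (L && (j == 0)%N) : position (m + j%:Z)
| Start of L & (0 < N)%N : position m
| End of R & ~~ (L && (N == 0)%N) : position (m + N%:Z)
| Only of L & N = 0%N : position m
| After n of (m + (N + R)%:Z <= n)%R : position n.

Lemma positionP n : position n.
Proof.
have [nm|mn] := ltrP n m; first exact: Before.
have [nN|Nn] := lerP (m + (N + R)%:Z) n; first exact: After.
have [j nj] : exists j : nat, n = m + j%:Z by exists `|n - m|%N; lia.
have jNR : (j < N + R)%N by lia.
rewrite nj {nj}.
have [jN|Nj] := ltnP j N.
  case E: (L && (j == 0)%N); last by apply: Middle; rewrite ?E.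
  by case/andP: E => LL /eqP ->; rewrite addr0; apply: Start => //; lia.
have [RR ->] : R /\ j = N by case: (R) jNR => /=; lia.
case E: (L && (N == 0)%N); last by apply: End; rewrite ?E.
by case/andP: E => LL /eqP N0; rewrite N0 addr0; apply: Only.
Qed.

Lemma u_after n : (m + (N + R)%:Z <= n)%R -> u n = 0.
Proof. by rewrite uE /string_term; case: (L); case: (R) => /= ?; int_cases. Qed.

Lemma z_before n : (n < m)%R -> z n = 0.
Proof. by rewrite zE /string_term; case: (L); case: (R) => /= ?; int_cases. Qed.

Lemma ker_chain n a : a * u (n + 1) = a -> a * w (n + 1) = 0 ->
  a *: c (n + 1) = 0 ->
  exists a', [/\ a' * u n = a', a = a' * w n & a' *: c n = 0].
Proof.
have [D nD] : exists D, D = n + 1 by exists (n + 1).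
rewrite -nD; case: (positionP D) nD => {D}
  [D Dm|j jN Lj|LL N0|RR LN|LL N0|D ND] nD au aw ac.
- have cn : c n = 0 by apply: c0; apply: z_before; lia.
  have [ll|/negP nL] := boolP (L : bool); last first.
    apply: ker_zero; rewrite -au uE /string_term; move: nL; case: (L) => // _.
    by rewrite -[RHS](mulr0 a); congr (_ * _); int_cases.
  have [D1|D1] := eqVneq D (m - 1).
    have uD : u D = B E2 by rewrite uE /string_term; move: ll;
      case: (L) => // _; int_cases.
    have un : u n = B E1 by rewrite uE /string_term; move: ll;
      case: (L) => // _; int_cases.
    have wn : w n = (-1) ^+ e * B Alpha.
      by rewrite wE /string_arrow; move: ll; case: (L) => // _; congr (_ * _);
        int_cases.
    rewrite uD in au; have a2 : a E2 = 0.
      have [g [wD ge]] : exists g, w D = (-1) ^+ e * B g /\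
        (g = Beta \/ g = BetaAlpha).
        rewrite wE; case: (posnP N) => N0.
          exists Beta; split; last by left.
          by congr (_ * _); rewrite /string_arrow N0; move: ll NR; case: (L);
            case: (R);
            rewrite ?N0 // => _ _; int_cases.
        exists BetaAlpha; split; last by right.
        by congr (_ * _); rewrite /string_arrow; move: ll; case: (L) => // _;
          int_cases.
      move: aw; rewrite wD => /mul_sign_eq0;
        rewrite mulr_basis_coef => /ffunP/(_ g).
      by rewrite !ffunE; case: ge => ->.
    apply: (ker_lift cn wn _ (radical_alpha au a2)).
    by rewrite un mulrDl -!scalerAl !A2_basisM.
  have [D2|D2] := eqVneq D (m - 2).
    have uD : u D = B E1 by rewrite uE /string_term; move: ll;
      case: (L) => // _; int_cases.
    have wD : w D = (-1) ^+ e * B Alpha.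
      by rewrite wE /string_arrow; move: ll; case: (L) => // _; congr (_ * _);
        int_cases.
    apply: ker_zero; move: aw; rewrite wD => /mul_sign_eq0.
    rewrite mulr_basis_coef => /ffunP H; have := (H Alpha, H BetaAlpha).
    rewrite !ffunE => -[a1 ab]; move: au; rewrite uD => /e1_coef[a2 aa aba].
    by apply: A2_eq; rewrite ?ffunE.
  apply: ker_zero; rewrite -au -[RHS](mulr0 a); congr (_ * _).
  by rewrite uE /string_term; move: ll; case: (L) => // _; int_cases.
- have [uD _ [t cD]] := c_middle jN Lj; apply: ker_zero.
  by move: au ac; rewrite uD cD; apply: ker22.
- have [uD _ cD] := c_start LL N0; have cn : c n = 0 by apply: c0;
    apply: z_before; lia.
  have un : u n = B E2 by rewrite uE /string_term; move: LL; case: (L) => // _;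
    int_cases.
  have wn : w n = (-1) ^+ e * B BetaAlpha.
    by rewrite wE /string_arrow; move: LL; case: (L) => // _; congr (_ * _);
      int_cases.
  move: au ac; rewrite uD cD => au ac; apply: (ker_lift cn wn _ (ker21 au ac)).
  by rewrite un -scalerAl A2_basisM.
- have [uD _ cD] := c_end RR LN; apply: ker_zero.
  by move: au ac; rewrite uD cD; apply: ker12.
- have [uD _ cD] := c_only LL N0; have cn : c n = 0 by apply: c0;
    apply: z_before; lia.
  have RR : R by move: NR; rewrite N0.
  have un : u n = B E2 by rewrite uE /string_term; move: LL; case: (L) => // _;
    int_cases.
  have wn : w n = (-1) ^+ e * B Beta.
    by rewrite wE /string_arrow; move: LL RR; case: (L); case: (R) => // _ _;
      congr (_ * _); int_cases.
  move: au ac; rewrite uD cD => au ac; apply: (ker_lift cn wn _ (ker11 au ac)).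
  by rewrite un -scalerAl A2_basisM.
by apply: ker_zero; rewrite -au (u_after ND) mulr0.
Qed.


Lemma coker_chain n (phi : dualA k) a :
  coact (z (n + 1)) phi = phi -> a * u (n + 1 + 1) = a ->
  coact (y (n + 1)) phi = a *: c (n + 1 + 1) ->
  exists a' psi, [/\ a' * u (n + 1) = a', coact (z n) psi = psi &
    phi = a' *: c (n + 1) + coact (y n) psi].
Proof.
have [D nD] : exists D, D = n + 1 by exists (n + 1).
rewrite -nD; case: (positionP D) nD => {D}
  [D Dm|j jN Lj|LL N0|RR LN|LL N0|D ND] nD zphi ua yphi.
- by apply: coker_zero; rewrite -zphi (z_before Dm) coact0.
- have [uD zD [t cD]] := c_middle jN Lj; apply: coker_proj.
  by rewrite uD cD; apply: coker22; rewrite -zD.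
- have [uD zD cD] := c_start LL N0; apply: coker_proj.
  by rewrite uD cD; apply: coker21; rewrite -zD.
- have [uD zD cD] := c_end RR LN; apply: coker_proj; rewrite uD cD.
  have a0 : a = 0 by rewrite -ua u_after ?mulr0 //; move: RR;
    case: (R) => // _; lia.
  apply: coker12; first by rewrite -zD.
  have yD : y (m + N%:Z) = - ((-1) ^+ e * B BetaAlpha).
    rewrite yE /string_arrow; congr (- (_ * _)).
    by move: RR LN; case: (R) => // _; case: (L) => /= ?; int_cases.
  by move: yphi; rewrite a0 scale0r yD => /coact_neg_sign_eq0.
- have [uD zD cD] := c_only LL N0; apply: coker_proj; rewrite uD cD.
  have RR : R by move: NR; rewrite N0.
  have a0 : a = 0.
    by rewrite -ua u_after ?mulr0 // N0; move: RR; case: (R) => // _; lia.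
  apply: coker11; first by rewrite -zD.
  have yD : y m = - ((-1) ^+ e * B Alpha).
    rewrite yE /string_arrow N0; congr (- (_ * _)).
    by move: RR LL; case: (R) => // _; case: (L) => // _; int_cases.
  by move: yphi; rewrite a0 scale0r yD => /coact_neg_sign_eq0.
have a0 : a = 0 by rewrite -ua u_after ?mulr0 //; lia.
have [RR|/negP nR] := boolP (R : bool); last first.
  apply: coker_zero; rewrite -zphi zE.
  rewrite (_ : string_term _ _ _ _ _ = 0) ?coact0 // /string_term.
  by move: nR ND (NR); case: (R) => // _ /= ? ?; case: (L); int_cases.
move: ND; rewrite RR => ND.
have [D1|D1] := eqVneq D (m + (N + 1)%:Z).
  have zD : z D = B E2 by rewrite zE /string_term RR; case: (L); int_cases.
  have yD : y D = - ((-1) ^+ e * B Beta).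
    by rewrite yE /string_arrow RR; congr (- (_ * _)); case: (L); int_cases.
  have bphi : coact (B Beta) phi = 0.
    by move: yphi; rewrite a0 scale0r yD => /coact_neg_sign_eq0.
  rewrite zD in zphi; have phiE := cosocle zphi bphi.
  have [LN|LN] := boolP (L && (N == 0)%N).
    have zn : z n = B E1.
      by rewrite zE /string_term RR; move: LN; case: (L) => //= ?; int_cases.
    have yn : y n = - ((-1) ^+ e * B Alpha).
      rewrite yE /string_arrow RR; congr (- (_ * _)).
      by move: LN; case: (L) => //= ?; int_cases.
    apply: (coker_lift (psi := (phi E2 *: B E2) *: delta k Alpha) _ _ yn).
      rewrite zn coactZ; congr (_ *: _); rewrite coact_basis_coef.
      by apply/ffunP; case; rewrite !ffunE //= ffunE.
    by rewrite coactZ delta_image; [|left].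
  have zn : z n = B E2.
    by rewrite zE /string_term RR; move: LN; case: (L) => //= ?; int_cases.
  have yn : y n = - ((-1) ^+ e * B BetaAlpha).
    rewrite yE /string_arrow RR; congr (- (_ * _)).
    by move: LN; case: (L) => //= ?; int_cases.
  apply: (coker_lift (psi := (phi E2 *: B E2) *: delta k BetaAlpha) _ _ yn).
    rewrite zn coactZ; congr (_ *: _); rewrite coact_basis_coef.
    by apply/ffunP; case; rewrite !ffunE //= ffunE.
  by rewrite coactZ delta_image; [|right].
have [D2|D2] := eqVneq D (m + (N + 2)%:Z).
  have zD : z D = B E1 by rewrite zE /string_term RR; case: (L); int_cases.
  have zn : z n = B E2 by rewrite zE /string_term RR; case: (L); int_cases.
  have yn : y n = - ((-1) ^+ e * B Beta).
    by rewrite yE /string_arrow RR; congr (- (_ * _)); case: (L); int_cases.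
  rewrite zD in zphi; have [psi [zpsi ephi]] := beta_image zphi.
  by apply: (coker_lift _ _ yn _ ephi); rewrite zn.
apply: coker_zero; rewrite -zphi zE.
rewrite (_ : string_term _ _ _ _ _ = 0) ?coact0 // /string_term RR.
by case: (L); int_cases.
Qed.

End ChainSplits.

(** * Exhaustiveness *)

Section Exhaustive.
Variables (k : fieldType) (X : cplx (A2 k)).
Local Notation A := (A2 k).
Local Notation B := (A2_basis k).
Hypothesis indX : indecomposable X.

Lemma chain_splits m L N R (x : fam X) : (0 < N)%N || R ->
  cocycle (string_data k L (N + L) R (m - (L + L)%:Z)) x ->
  ~ coboundary (probe_data k m L N R) (at_deg (head_arrow k L *: chain_head m N
    x)) ->
  exists (i : int) (w : pname), diso X (shift i (P k w)).
Proof.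
move=> NR cx nx; have [lam [lam_lin lam_cob lam1]] := null_functional nx.
eexists; eexists; apply: (indecomposable_string lam_lin lam_cob cx) => //.
  exact: (ker_chain NR lam_lin lam_cob cx lam1).
exact: (coker_chain NR lam_lin lam_cob cx lam1).
Qed.

Lemma cocycle_below L M R d (x : fam X) n : (M == 0%N) ==> (L != R) ->
  cocycle (string_data k L M R d) x -> (n < d)%R -> x n = 0.
Proof.
move=> ok cx nd; have [<- _] := cx n; rewrite pu_string_data //.
rewrite (_ : string_term _ _ _ _ _ = 0) ?scale0r // /string_term.
by int_cases.
Qed.

(** The two terms A e_1 -> A e_2 to the left of a chain; stated in degrees n,
    n + 1 and n + 1 + 1 so that no element has to be transported. *)
Lemma prolong_chain n N R (x : fam X) (a : obj X (n + 1)) (b : obj X n) :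
  let m := n + 1 + 1 in let e := `|1 - m|%N in
  (0 < N)%N || R -> cocycle (tail_data k m N R) x ->
  B E2 *: a = a -> B E1 *: b = b ->
  diff X (n + 1) m a = (-1) ^+ e *: (B Beta *: chain_head m N x) ->
  diff X n (n + 1) b = (-1) ^+ e *: (B Alpha *: a) ->
  exists x' : fam X, x' m = x m /\
    cocycle (string_data k true (N + true) R (m - (true + true)%:Z)) x'.
Proof.
move=> m e NR cx a2 b1 da db.
have okT := tail_ok NR.
have okP : (N + true == 0)%N ==> (true != R) by rewrite addn1.
have xlt j : (j < m)%R -> x j = 0 := @cocycle_below _ _ _ _ _ j okT cx.
pose x' : fam X := dfwith (dfwith x a) b.
have xn : x' n = b by rewrite /x' dfwith_in.
have xn1 : x' (n + 1) = a.
  by rewrite /x' dfwith_out ?dfwith_in //; apply/eqP; lia.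
have xo j : j != n -> j != n + 1 -> x' j = x j.
  by move=> jn jn1; rewrite /x' !dfwith_out // eq_sym.
exists x'; split; first by apply: xo; apply/eqP; rewrite /m; lia.
move=> j; rewrite pu_string_data // pw_string_data // (sign_shift A m true) -/e.
have -> : j - (m - (true + true)%:Z) = j - n by rewrite /m /=; lia.
have [->|jn] := eqVneq j n.
  rewrite subrr xn xn1 db scalerA; split=> //.
  by rewrite /string_arrow addn1.
have [->|jn1] := eqVneq j (n + 1).
  have xm : x' (n + 1 + 1) = x m by apply: xo; apply/eqP; lia.
  have -> : n + 1 - n = 1 by lia.
  rewrite xn1 xm; split; first by rewrite /string_term addn1.
  rewrite da -scalerA; congr (_ *: _); rewrite /chain_head /string_arrow.
  have [N0|N0] := posnP N.
    have RR : R by move: NR; rewrite N0.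
    by rewrite N0 RR.
  case: ifP => [?|_]; first by exfalso; lia.
  rewrite scalerA A2_basisM /=; congr (_ *: _).
  by int_cases.
have [mj|jm] := lerP m j.
  rewrite !xo; try by apply/eqP; rewrite /m in mj *; lia.
  have [+ +] := cx j; rewrite pu_string_data // pw_string_data //.
  have -> : string_term k true (N + true) R (j - n) =
    string_term k false N R (j - m).
    by rewrite /string_term /m in mj *; int_cases.
  have -> // : string_arrow k true (N + true) R (j - n) =
    string_arrow k false N R (j - m).
    rewrite /string_arrow /m in mj *; move: NR; case: (R) => /= ?;
      by int_cases.
have jn' : (j < n)%R by move/eqP: jn; move/eqP: jn1; rewrite /m in jm; lia.
rewrite xo // xlt // !scaler0 linear0; split=> //.
rewrite (_ : string_arrow _ _ _ _ _ = 0) ?mulr0 ?scale0r // /string_arrow.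
by int_cases.
Qed.

Lemma start_chain m L (v t : obj X m) : cycle v -> B E1 *: v = v ->
  head_arrow k L *: v = t -> good_chain L t 0 true (at_deg v).
Proof.
move=> cv v1 kv; split=> //.
  move=> n; rewrite pu_string_data // pw_string_data // /string_arrow eqxx mulr0
    scale0r.
  have [<-|mn] := eqVneq m n; last by rewrite at_deg_out // scaler0 linear0.
  by rewrite at_deg_in subrr /string_term.
by rewrite /chain_head eqxx at_deg_in kv subrr; apply: boundary0.
Qed.

(** The element v alone is a chain whose head is multiplied into beta v, so the
    extremal strings begin at the vertex 2. *)
Lemma beta_case m (v : obj X m) : cycle v -> B E1 *: v = v ->
  ~ boundary (B Beta *: v) -> exists (i : int) (w : pname), diso X (shift i (P k
    w)).
Proof.
move=> cv v1 nbv.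
have [N [R [x [[NR cx _] nx]]]] :=
  extremal_chain nbv (start_chain (L := false) cv v1 erefl).
apply: (chain_splits (L := false) NR _ nx).
by rewrite addn0 subr0.
Qed.

Lemma alpha_beta_zero V (x : V : lmodType A) : B Alpha *: (B Beta *: x) =
  0.
Proof. by rewrite scalerA A2_basisM scale0r. Qed.

(** Strings beginning with alpha. In the lowest degree in which H(e_1 X) does
    not vanish, the obstruction to prolonging a chain by alpha is zero; the step
    by beta alpha (or beta) before it exists since beta v is a boundary. *)
Lemma vertex1_case n (v : obj X (n + 1 + 1)) : cycle v -> B E1 *: v = v ->
  ~ boundary v -> boundary (B Beta *: v) ->
  (forall v' : obj X (n + 1), cycle v' -> B E1 *: v' = v' -> boundary v') ->
  exists (i : int) (w : pname), diso X (shift i (P k w)).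
Proof.
move=> cv v1 nv bv low.
have [N [R [x [[NR cx bx] nx]]]] :=
  extremal_chain nv (start_chain (L := true) cv v1 v1).
set h := chain_head _ N x in bx nx.
pose e := absz (1 - (n + 1 + 1))%R.
have h1 : B E1 *: h = h.
  have [ux _] := cx (n + 1 + 1).
  rewrite /h /chain_head; case: ifP => [/eqP N0|_];
    last by rewrite scalerA A2_basisM.
  by move: ux; rewrite pu_string_data ?tail_ok // subrr N0; move: NR;
    rewrite N0; case: (R).
have /boundaryS [a0 da0] : boundary (B Beta *: h).
  rewrite -[h](subrK v) scalerDr -[B Beta *: v]opprK.
  rewrite -[X in _ - X]scaleN1r; apply: boundaryB; last exact: boundaryZ.
  by apply: boundaryZ; move: bx; rewrite /head_arrow h1.
pose a := B E2 *: ((-1) ^+ e *: a0).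
have a2 : B E2 *: a = a by rewrite /a scalerA A2_basisM.
have da : diff X (n + 1) (n + 1 + 1) a = (-1) ^+ e *: (B Beta *: h).
  by rewrite /a !linearZ /= -da0 !scalerA (commr_sign (B E2)) -mulrA A2_basisM.
clearbody a; have /boundaryS [b0 db0] : boundary (B Alpha *: a).
  apply: low; last by rewrite scalerA A2_basisM.
  by rewrite /cycle linearZ /= da scalerA (commr_sign (B Alpha)) -scalerA
    alpha_beta_zero scaler0.
pose b := B E1 *: ((-1) ^+ e *: b0).
have b1 : B E1 *: b = b by rewrite /b scalerA A2_basisM.
have db : diff X n (n + 1) b = (-1) ^+ e *: (B Alpha *: a).
  by rewrite /b !linearZ /= -db0 !scalerA (commr_sign (B E1)) -mulrA A2_basisM.
have [x' [xm cx']] := prolong_chain NR cx a2 b1 da db.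
apply: (chain_splits (L := true) NR cx'); move: nx.
by rewrite /h /chain_head xm.
Qed.


(** The case of vanishing H(e_1 X): then X is a sum of shifted copies of the
    simple module at the vertex 2, whose projective and injective resolutions
    are the string complexes of alpha and, up to duality, of beta. *)
Lemma vertex2_case n (x : obj X (n + 1)) : cycle x -> B E2 *: x = x ->
  ~ boundary x -> boundary (B Alpha *: x) ->
  (forall v : obj X (n + 1), cycle v -> B E1 *: v = v -> boundary v) ->
  exists (i : int) (w : pname), diso X (shift i (P k w)).
Proof.
move=> cx x2 nx /boundaryS [b0 db0] low.
pose q := pdata_opp (string_data k false 1 true (n + 1)).
pose p := string_data k true 1 false n.
pose e := absz (1 - n)%R; pose e' := absz (1 - (n + 1))%R.
have zE j : pu q j = string_term k false 1 true (j - (n + 1))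
  by exact: pu_string_data.
have yE j : pw q j = - ((-1) ^+ e' * string_arrow k false 1 true (j - (n + 1))).
  by rewrite -pw_string_data.
have uE j : pu p j = string_term k true 1 false (j - n)
  by exact: pu_string_data.
have wE j : pw p j = (-1) ^+ e * string_arrow k true 1 false (j - n)
  by exact: pw_string_data.
pose b := B E1 *: ((-1) ^+ e *: b0).
have b1 : B E1 *: b = b by rewrite /b scalerA A2_basisM.
have db : diff X n (n + 1) b = (-1) ^+ e *: (B Alpha *: x).
  by rewrite /b !linearZ /= -db0 !scalerA (commr_sign (B E1)) -mulrA A2_basisM.
clearbody b.
have z1 : pu q (n + 1) = B E2 by rewrite zE subrr.
have z2 : pu q (n + 1 + 1) = B E1 by rewrite zE addrAC addrN add0r.
have y1 : pw q (n + 1) = - ((-1) ^+ e' * B Beta) by rewrite yE subrr.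
have yo j : j != n + 1 -> pw q j = 0.
  move=> /eqP jn; rewrite yE (_ : string_arrow _ _ _ _ _ =
    0) ?mulr0 ?oppr0 // /string_arrow.
  by int_cases.
have nz : ~ coboundary q (at_deg x).
  move=> [s Hs]; apply: nx; have [_] := Hs n; rewrite at_deg_in => ->.
  have [us2 ds] := Hs (n + 1).
  have bs : boundary (s (n + 1)).
    apply: low; last by rewrite -z2.
    move: ds; rewrite at_deg_out; last by apply/eqP; lia.
    rewrite (yo (n + 1 + 1)); last by apply/eqP; lia.
    by rewrite scale0r addr0 => /esym.
  rewrite y1 scaleNr -scalerA; apply: boundaryB; first exact: boundary_diff.
  by do 2![apply: boundaryZ].
have [lam [lam_lin lam_cob lam1]] := null_functional nz.
pose x' : fam X := dfwith (at_deg x) b.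
have x'n : x' n = b by rewrite /x' dfwith_in.
have x'n1 : x' (n + 1) = x.
  by rewrite /x' dfwith_out ?at_deg_in //; apply/eqP; lia.
have x'o j : j != n -> j != n + 1 -> x' j = 0.
  by move=> jn jn1; rewrite /x' dfwith_out ?at_deg_out // eq_sym.
have cx' : cocycle p x'.
  move=> j; have [->|jn] := eqVneq j n.
    by rewrite x'n x'n1 uE wE subrr db -scalerA.
  have [->|jn1] := eqVneq j (n + 1).
    rewrite x'n1 [x' (n + 1 + 1)]x'o; try by apply/eqP; lia.
    by rewrite uE (_ : n + 1 - n = 1) ?scaler0 //; lia.
  rewrite x'o // linear0 wE (_ : string_arrow _ _ _ _ _ = 0).
    by rewrite mulr0 scale0r scaler0.
  rewrite /string_arrow; move/eqP: jn; move/eqP: jn1 => ? ?.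
  by int_cases.
pose c := composite_coef q lam x'.
have z0 j : (j <= n)%R -> pu q j = 0.
  move=> ?; rewrite zE /string_term.
  by int_cases.
have c0 j : (j <= n)%R -> c j = 0 by move=> jn;
  rewrite /c /composite_coef z0 // coact0.
have lam_ba : lam _ (B BetaAlpha *: x) = 0.
  have zb : pu q (n + 1) *: (B Beta *: b) = B Beta *: b.
    by rewrite z1 scalerA A2_basisM.
  have := lam_cob _ _ zb; rewrite yo; last by apply/eqP; lia.
  have -> : diff X n (n + 1) (B Beta *: b) = ((-1) ^+ e * B BetaAlpha) *: x.
    by rewrite linearZ /= db !scalerA (commr_sign (B Beta)) -mulrA A2_basisM.
  rewrite scale0r (lam0 lam_lin) addr0.
  rewrite -(signr_odd A e); case: (odd e); last by rewrite expr0 mul1r.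
  by rewrite expr1 mulN1r scaleNr (lamN lam_lin) => /eqP;
    rewrite oppr_eq0 => /eqP.
have cn1 : c (n + 1) = delta k E2.
  apply/ffunP => r; rewrite -ev_basis /c /composite_coef ev_coact (ev_dualize
    lam_lin).
  rewrite x'n1 z1 -{1}x2 scalerA ffunE.
  case: r; rewrite ?A2_basisM ?mul0r ?A2_basisM ?scale0r ?(lam0 lam_lin) //.
  by rewrite x2.
have un : pu p n = B E1 by rewrite uE subrr.
have un1 : pu p (n + 1) = B E2 by rewrite uE (_ : n + 1 - n = 1) //; lia.
have wn : pw p n = (-1) ^+ e * B Alpha by rewrite wE subrr.
have uo j : j != n -> j != n + 1 -> pu p j = 0.
  move=> /eqP ? /eqP ?; rewrite uE /string_term.
  by int_cases.
exists (1 - n), (string_name true 1 false).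
have ker j a : a * pu p (j + 1) = a -> a * pw p (j + 1) = 0 ->
    a *: c (j + 1) = 0 ->
    exists a', [/\ a' * pu p j = a', a = a' * pw p j & a' *: c j = 0].
  have [D jD] : exists D, D = j + 1 by exists (j + 1).
  rewrite -jD => au aw ac; have [Dn1|Dn1] := eqVneq D (n + 1).
    have -> : j = n by lia.
    move: au ac; rewrite Dn1 un1 cn1 => au.
    rewrite coscale_coef => /ffunP/(_ E2) ac2.
    have a2 : a E2 = 0 by move: ac2; rewrite !ffunE /= mulr1 !mulr0 !addr0.
    apply: (ker_lift (c0 n (lexx n)) wn _ (radical_alpha au a2)).
    by rewrite un mulrDl -!scalerAl !A2_basisM.
  apply: ker_zero; have [Dn|Dn] := eqVneq D n; last by rewrite -au uo ?mulr0.
  move: au aw; rewrite Dn un wn => /e1_coef[a2 aa aba] /mul_sign_eq0.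
  rewrite mulr_basis_coef => /ffunP H; have := (H Alpha, H BetaAlpha).
  by rewrite !ffunE => -[a1 ab]; apply: A2_eq; rewrite ?ffunE.
apply: (indecomposable_string lam_lin lam_cob cx' ker _ indX) => j phi a.
have [D jD] : exists D, D = j + 1 by exists (j + 1).
rewrite -/c -jD => zphi ua yphi; have [Dn1|Dn1] := eqVneq D (n + 1).
  apply: coker_proj; exists (phi E2 *: B E2).
  move: zphi yphi ua; rewrite Dn1 z1 y1 un1 cn1 => zphi yphi ua.
  split; first by rewrite -scalerAl A2_basisM.
  apply: cosocle => //; apply: (@coact_neg_sign_eq0 _ e').
  by rewrite yphi -ua uo ?mulr0 ?scale0r //; apply/eqP; lia.
have [Dn2|Dn2] := eqVneq D (n + 1 + 1).
  have -> : j = n + 1 by lia.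
  move: zphi; rewrite Dn2 z2 => /beta_image[psi [zpsi ephi]].
  by apply: (coker_lift _ _ y1 _ ephi); rewrite z1.
apply: coker_zero; rewrite -zphi zE (_ : string_term _ _ _ _ _ =
  0) ?coact0 // /string_term.
by move/eqP: Dn1; move/eqP: Dn2 => ? ?;
  int_cases.
Qed.

Lemma split_vertices m (x : obj X m) : x = B E1 *: x + B E2 *: x.
Proof. by rewrite -scalerDl -[LHS]scale1r. Qed.

Lemma exhaustive : exists (i : int) (w : pname), diso X (shift i (P k w)).
Proof.
have [[m [v [cv v1 nbv]]]|no_beta] := EM (exists m (v : obj X m),
    [/\ cycle v, B E1 *: v = v & ~ boundary (B Beta *: v)]).
  exact: beta_case cv v1 nbv.
have bbeta m (v : obj X m) : cycle v -> B E1 *: v = v -> boundary (B Beta *: v).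
  by move=> cv v1; apply: contrapT => nbv; apply: no_beta; exists m, v.
pose V1 m := exists v : obj X m, [/\ cycle v, B E1 *: v = v & ~ boundary v].
have reindex (m : int) : m = m - 1 - 1 + 1 + 1 by lia.
have [[m Vm]|noV] := EM (exists m, V1 m).
  have [N HN] := obj_bounded X.
  have V1_ge j : V1 j -> (- N%:Z <= j)%R.
    move=> [v [_ _ nv]]; rewrite leNgt; apply/negP => jN; apply: nv.
    by have -> : v = 0 by [apply: HN; lia]; apply: boundary0.
  have ex : exists j : nat, `[< V1 (j%:Z - N%:Z) >].
    exists (absz (m + N%:Z)%R); apply/asboolP; have := V1_ge _ Vm => mN.
    by have -> : (absz (m + N%:Z)%R)%:Z - N%:Z = m by lia.
  case: (ex_minnP ex) => j /asboolP; set m0 := j%:Z - N%:Z => Vm0 minj.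
  move: (reindex m0) (erefl m0) Vm0; set n := m0 - 1 - 1 => {1 3}-> e0.
  move=> [v [cv v1 nv]]; apply: (vertex1_case cv v1 nv (bbeta _ _ cv v1)).
  move=> v' cv' v1'; apply: contrapT => nv'.
  have Vn : V1 (n + 1) by exists v'.
  have := V1_ge _ Vn => nN.
  have /minj : `[< V1 ((absz (n + 1 + N%:Z)%R)%:Z - N%:Z) >].
    by apply/asboolP; have -> : (absz (n + 1 + N%:Z)%R)%:Z - N%:Z = n + 1
      by lia.
  by rewrite /n /m0 in nN *; lia.
have acV m (v : obj X m) : cycle v -> B E1 *: v = v -> boundary v.
  by move=> cv v1; apply: contrapT => nv; apply: noV; exists m, v.
have cycleZ m a (x : obj X m) : cycle x -> cycle (a *: x).
  by rewrite /cycle linearZ /= => ->; rewrite scaler0.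
have [m [x [cx nx]]] : exists m (x : obj X m), cycle x /\ ~ boundary x.
  apply: contrapT => H; apply: indX.1; apply: acyclic_diso0 => m x cx.
  by apply: contrapT => nx; apply: H; exists m, x.
have b1 : boundary (B E1 *: x).
  by apply: acV; [apply: cycleZ | rewrite scalerA A2_basisM].
have n2 : ~ boundary (B E2 *: x).
  move=> b2; apply: nx; rewrite (split_vertices x) -[B E2 *: x]opprK.
  by apply: boundaryB => //; rewrite -scaleN1r; apply: boundaryZ.
have ba : boundary (B Alpha *: (B E2 *: x)).
  apply: acV; first exact/(cycleZ _ _ _)/cycleZ.
  by rewrite !scalerA !A2_basisM.
have x2 : B E2 *: (B E2 *: x) = B E2 *: x by rewrite scalerA A2_basisM.
move: (cycleZ m (B E2) x cx) x2 n2 ba; move: (_ *: x) => {x cx nx b1} x.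
have em : m = m - 1 + 1 by lia.
move: x; rewrite em => x cx x2 nx ba.
exact: vertex2_case cx x2 nx ba (acV _).
Qed.

End Exhaustive.

Theorem theorem3 (k : closedFieldType) :
  (forall (i : int) (w : pname), indecomposable (shift i (P k w))) /\
  (forall (i j : int) (w w' : pname),
     (i, pstring w) <> (j, pstring w') ->
     ~ diso (shift i (P k w)) (shift j (P k w'))) /\
  (forall X : cplx (A2 k), indecomposable X ->
     exists (i : int) (w : pname), diso X (shift i (P k w))).
Proof.
split=> [i w|]; first exact: str_shift_indecomposable (pstring_nontrivial w) i.
split=> [i j w w' ne iso|X]; last exact: exhaustive.
apply: ne.
have := diso_strings (pstring_nontrivial w) (pstring_nontrivial w') iso.
by case: (pstring w) => ? ?; case: (pstring w').
Qed.
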